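(* Let $A=C_q(B_+)$ and $H=U_q(\mathfrak b_+)$ (the same Hopf algebra over $\Bbbk(q)$, viewed in two roles, paired as in the context). For a finite set $I\subset\mathbb N\setminus\{1\}$ let $\Gamma_I$ be the differential calculus on $A$ and $L_I$ the quantum tangent space on $H$ defined in the context. (a) The map $I\mapsto \Gamma_I$ is a bijection from the finite subsets $I\subset\mathbb N\setminus\{1\}$ to the finite dimensional differential calculi on $A$, and $I\mapsto L_I$ is a bijection from the finite subsets $I\subset\mathbb N\setminus\{1\}$ to the finite dimensional quantum tangent spaces on $H$; $L_I$ is the quantum tangent space corresponding to $\Gamma_I$. Moreover $\dim\Gamma_I=\dim L_I=\sum_{n\in I}n$. (b) The finite dimensional coirreducible calculi $\Gamma$ and the finite dimensional irreducible quantum tangent spaces $L$ are exactly those corresponding to $I=\{n\}$ with $n\ge 2$, $n$ being the dimension. The calculus $\Gamma_{\{n\}}$ has a right invariant basis $\eta_0,\dots,\eta_{n-1}$ such that $$\mathrm dX=\eta_1+(q^{n-1}-1)\eta_0X,\qquad \mathrm dg=(q^{n-1}-1)\eta_0 g,$$ $$[a,\eta_0]=\mathrm da\quad\text{for all } a\in A,$$ $$[g,\eta_i]_{q^{n-1-i}}=0\quad\text{for all } i,\qquad [X,\eta_i]_{q^{n-1-i}}=\begin{cases}\eta_{i+1}& \text{if } i<n-1,\\ 0&\text{if } i=n-1,\end{cases}$$ where $[a,b]_p:=ab-p\,ba$ and $[a,b]:=[a,b]_1$. If $\phi_0,\dots,\phi_{n-1}$ is the dual basis of $L_{\{n\}}$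 and $\partial_i:=\partial_{\phi_i}$, the braided derivations are $$\partial_i{:}f{:}={:}\,Q_{n-1-i,g}\,Q_{n-1-i,X}\,\tfrac1{[i]_q!}(\partial_{q,X})^i f\,{:}\quad (1\le i\le n-1),\qquad \partial_0{:}f{:}={:}\,Q_{n-1,g}Q_{n-1,X}f-f\,{:}$$ for all $f\in\Bbbk(q)[X,g,g^{-1}]$ (commuting variables), where the normal ordering ${:}\cdot{:}:\Bbbk(q)[X,g,g^{-1}]\to A$ is the linear map $g^sX^m\mapsto g^sX^m$ ($s\in\mathbb Z$, $m\in\mathbb N_0$). (c) Finite dimensional $\Gamma$ and $L$ decompose into direct sums of coirreducible, respectively irreducible, ones: $\Gamma_I=\bigoplus_{n\in I}\Gamma_{\{n\}}$ and $L_I=\bigoplus_{n\in I}L_{\{n\}}$.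
   Context: $\Bbbk$ is a field of characteristic $0$, $\Bbbk(q)$ the field of rational functions in $q$. $\mathbb N$ = positive integers, $\mathbb N_0$ = non-negative integers. $[n]_q=\sum_{i=0}^{n-1}q^i$, $[n]_q!=[1]_q\cdots[n]_q$. $U_q(\mathfrak b_+)=C_q(B_+)$ is the Hopf algebra over $\Bbbk(q)$ generated by $X,g,g^{-1}$ with $gg^{-1}=g^{-1}g=1$, $Xg=qgX$, $\Delta X=X\otimes1+g\otimes X$, $\Delta g=g\otimes g$, $\epsilon(X)=0$, $\epsilon(g)=1$, $S X=-g^{-1}X$, $S g=g^{-1}$. It is paired with itself by $\langle X^ng^m,X^rg^s\rangle=\delta_{n,r}[n]_q!\,q^{-n(n-1)/2}q^{-ms}$ ($n,r\in\mathbb N_0$, $m,s\in\mathbb Z$). Differential calculi. ''Differential calculus'' means bicovariant first order differential calculus. By Woronowicz these are in bijection with subspaces $M\subseteq\ker\epsilon\subset A$ that are left crossed submodules, i.e. $AM\subseteq M$ and $\mathrm{Ad_L}(M)\subseteq A\otimes M$ where $\mathrm{Ad_L}(v)=v_{(1)}S v_{(3)}\otimes v_{(2)}$. The calculus of $M$ is $\Gamma=(\ker\epsilon/M)\otimes A$ with right action $(v\otimes b)c=v\otimes bc$, left action $a(v\otimes b)=a_{(1)}v\otimes a_{(2)}b$, and $\mathrm da=\pi(\Delta a-1\otimes a)$, $\pi$ the canonical projection (applied to the first factor). The dimension of $\Gamma$ is $\dim(\ker\epsilon/M)$; a right invariant basis is a basis of $\ker\epsilon/M$, where $v\in \ker\epsilon/M$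 is identified with $v\otimes 1\in\Gamma$. $\Gamma$ is coirreducible if it is nonzero and has no proper nonzero quotient calculus (equivalently $M$ is a maximal proper crossed submodule of $\ker\epsilon$). Quantum tangent spaces. A quantum tangent space on $H$ is a subspace $L\subseteq\ker\epsilon\subset H$ invariant under the left adjoint action $h\triangleright x=h_{(1)}xS h_{(2)}$ ($h\in H$) and such that $x_{(1)}\otimes(x_{(2)}-\epsilon(x_{(2)})1)\in H\otimes L$ for $x\in L$; it is irreducible if nonzero without proper nonzero subspaces of the same kind. The quantum tangent space corresponding to the calculus of $M$ is $\{x\in\ker\epsilon\subset H:\langle x,m\rangle=0\ \forall m\in M\}$. It pairs with $\ker\epsilon/M$; ''dual basis'' refers to this pairing. For $x\in L$ the braided derivation is $\partial_x:A\to A$, $\partial_x(a)=\langle x,a_{(1)}\rangle a_{(2)}$ for $a$ in $A$ (so $\partial_x$ is the evaluation of $\mathrm d$ on $x$). The correspondence. For finite $I\subset\mathbb N\setminus\{1\}$, $\Gamma_I$ is the calculus given by $$M_I=\bigoplus_{k\ge0}X^k\Big(\prod_{n\in I\cup\{1\},\,n>k}(1-q^{1-n}g)\Big)\Bbbk(q)[g,g^{-1}],$$ and $L_I=\mathrm{span}\{g^{1-n}-1,\ X^kg^{1-n}: n\in I,\ 1\le k\le n-1\}$. For functions of several variables including $x$ over $\Bbbk(q)$: $(Q_{m,x}f)(x)=f(q^mx)$ for $m\in\mathbb Z$, and $(\partial_{q,x}f)(x)=\frac{f(x)-f(qx)}{x(1-q)}$. *)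

(* Defs.v *)
From HB Require Import structures.
From mathcomp Require Import all_boot all_order all_algebra.
From mathcomp Require Import finmap boolp.
From mathcomp Require Import monalg ring.

Set Implicit Arguments.
Unset Strict Implicit.
Unset Printing Implicit Defensive.

Import GRing.Theory Num.Theory.
Local Open Scope ring_scope.

(* A field with a distinguished nonzero element q; k(q) is [ratq k]. *)
Record qField := QField {
  qbase :> fieldType;
  qparam : qbase;
  qparam_neq0 : qparam != 0 }.

Fact ratq_neq0 (k : fieldType) : FracField.tofrac ('X : {poly k}) != 0.
Proof. by rewrite tofrac_eq0 polyX_eq0. Qed.

Definition ratq (k : fieldType) : qField :=
  @QField {fraction {poly k}} (FracField.tofrac 'X) (ratq_neq0 k).

Section LinearAlgebra.
Variable F : fieldType.

Record subspace (V : lmodType F) := Subspace {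
  subspace_pred :> {pred V};
  subspace_closed : submod_closed subspace_pred }.

Fact subspace_zmod_closed (V : lmodType F) (N : subspace V) :
  zmod_closed (subspace_pred N).
Proof. exact: GRing.submod_closedB (subspace_closed N). Qed.

HB.instance Definition _ (V : lmodType F) (N : subspace V) :=
  GRing.isZmodClosed.Build V (subspace_pred N) (subspace_zmod_closed N).

(* [asbool] makes the existential a boolean predicate (classically). *)
Definition span_pred (V : lmodType F) (S : V -> Prop) : {pred V} :=
  fun v => `[< exists s : seq (F * V),
      (forall p, p \in s -> S p.2) /\ v = \sum_(p <- s) p.1 *: p.2 >].

Fact span_closed (V : lmodType F) (S : V -> Prop) : submod_closed (span_pred S).
Proof.
split=> [|c u v /asboolP[s [sS ->]] /asboolP[t [tS ->]]]; apply/asboolP.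
  by exists [::]; rewrite big_nil.
exists ([seq (c * p.1, p.2) | p <- s] ++ t); split.
  by move=> p; rewrite mem_cat => /orP[/mapP[p' /sS ? ->]|/tS].
rewrite big_cat big_map scaler_sumr /=; congr (_ + _).
by apply: eq_bigr => p _; rewrite scalerA.
Qed.

Definition span (V : lmodType F) (S : V -> Prop) : subspace V :=
  Subspace (span_closed S).

(* Only the values e 0, ..., e n.-1 matter. *)
Definition is_basis (V : lmodType F) (P : {pred V}) (n : nat) (e : nat -> V) :=
  (forall i, (i < n)%N -> e i \in P) /\
  (forall v, v \in P ->
     exists! c : {ffun 'I_n -> F}, v = \sum_(i < n) c i *: e i).

Definition has_dim (V : lmodType F) (P : {pred V}) (n : nat) :=
  exists e : nat -> V, is_basis P n e.

(* Internal direct sum of the Ls n, n in J. *)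
Definition direct_sum (V : lmodType F) (J : {fset nat})
    (L : subspace V) (Ls : nat -> subspace V) :=
  (forall x, x \in L <-> exists2 y : {ffun J -> V},
     (forall i, y i \in Ls (val i)) & x = \sum_i y i) /\
  (forall y : {ffun J -> V}, (forall i, y i \in Ls (val i)) ->
     \sum_i y i = 0 -> forall i, y i = 0).

Section Quotient.
Variables (V : lmodType F) (N : subspace V).

Definition lquot : Type := Quotient.quot (subspace_pred N).
HB.instance Definition _ := GRing.Zmodule.on lquot.

Definition lpi (v : V) : lquot := \pi_(Quotient.quot (subspace_pred N))%qT v.

Definition lrepr (x : lquot) : V := repr (x : Quotient.quot (subspace_pred N)).

Lemma lreprK : cancel lrepr lpi. Proof. exact: reprK. Qed.

Lemma lpi_eq u v : (lpi u == lpi v) = (u - v \in N).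
Proof. by rewrite /lpi Quotient.idealrBE. Qed.

Lemma lpiD u v : lpi (u + v) = lpi u + lpi v.
Proof. exact: raddfD. Qed.

Definition lquot_scale (c : F) (x : lquot) : lquot := lpi (c *: lrepr x).

Lemma lpiZ c v : lpi (c *: v) = lquot_scale c (lpi v).
Proof.
apply/eqP; rewrite lpi_eq -scalerBr -[_ *: _]addr0.
have [N0 NL] := subspace_closed N; apply: NL => //.
by rewrite -lpi_eq lreprK.
Qed.

Fact lquot_scaleA a b x : lquot_scale a (lquot_scale b x) = lquot_scale (a * b) x.
Proof. by rewrite -[x]lreprK -!lpiZ scalerA. Qed.
Fact lquot_scale1 : left_id 1 lquot_scale.
Proof. by move=> x; rewrite -[x]lreprK -!lpiZ scale1r. Qed.
Fact lquot_scaleDr : right_distributive lquot_scale +%R.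
Proof.
by move=> a x y; rewrite -[x]lreprK -[y]lreprK -lpiD -!lpiZ -lpiD scalerDr.
Qed.
Fact lquot_scaleDl x : {morph lquot_scale^~ x : a b / a + b}.
Proof. by move=> a b; rewrite -[x]lreprK -!lpiZ -lpiD scalerDl. Qed.

HB.instance Definition _ := GRing.Zmodule_isLmodule.Build F lquot
  lquot_scaleA lquot_scale1 lquot_scaleDr lquot_scaleDl.

End Quotient.
End LinearAlgebra.

(* With A the algebra generated by X, g, g^-1, having basis X^n g^s, an element
   of A (x) V is a finitely supported family of elements of V indexed by
   (n, s): [pbw V] is A (x) V. A itself is the case V = K ([Cq] below), and
   A (x) A is [pbw A]. The same type is used for V (x) A: there the A-factor is
   still the one carried by the index. *)
Definition pbw (K : qField) (V : lmodType (qbase K)) : Type :=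
  {malg V[(nat * int)%type]}.

Section PbwZmod.
Variable K : qField.
Local Notation F := (qbase K).
Local Notation q := (qparam K).
Local Notation B := (nat * int)%type.

HB.instance Definition _ (V : lmodType F) := GRing.Zmodule.copy (pbw V)
  {malg V[(nat * int)%type]}.

End PbwZmod.

(* Sum over the support: the additive extension of (i, v) |-> f i v. *)
HB.lock Definition mext (K : qField) (V : lmodType (qbase K)) (W : zmodType)
    (f : nat * int -> V -> W) (a : pbw V) : W :=
  \sum_(i <- msupp (a : {malg V[(nat * int)%type]})) f i a@_i.

HB.lock Definition mono (K : qField) (V : lmodType (qbase K)) (i : nat * int)
    (v : V) : pbw V := << v *g i >>.
HB.lock Definition coef (K : qField) (V : lmodType (qbase K)) (a : pbw V)
    (i : nat * int) : V := (a : {malg V[(nat * int)%type]})@_i.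

Section Tensor.
Variable K : qField.
Local Notation F := (qbase K).
Local Notation q := (qparam K).
Local Notation B := (nat * int)%type.


Lemma pbwP (V : lmodType F) (a b : pbw V) : (forall i, coef a i = coef b i) -> a = b.
Proof. by rewrite [@coef]unlock => ab; apply/malgP. Qed.

Lemma coefD (V : lmodType F) (a b : pbw V) i : coef (a + b) i = coef a i + coef b i.
Proof. by rewrite [@coef]unlock; exact: mcoeffD. Qed.
Lemma coef_mono (V : lmodType F) i (v : V) j : coef (mono i v) j = v *+ (i == j).
Proof. by rewrite [@coef]unlock [@mono]unlock; exact: mcoeffU. Qed.
Lemma coef0 (V : lmodType F) i : coef (0 : pbw V) i = 0.
Proof. by rewrite [@coef]unlock; exact: mcoeff0. Qed.

Lemma mextw (V : lmodType F) (W : zmodType) (f : B -> V -> W) (D : {fset B})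
    (a : pbw V) : (forall i, f i 0 = 0) -> (msupp a `<=` D)%fset ->
  mext f a = \sum_(i <- D) f i (coef a i).
Proof.
move=> f0 sD; rewrite [@mext]unlock [@coef]unlock; apply: big_fset_incl => // i _ ia.
by rewrite mcoeff_outdom.
Qed.

Lemma mextD (V : lmodType F) (W : zmodType) (f : B -> V -> W) :
  (forall i u v, f i (u + v) = f i u + f i v) -> {morph mext f : a b / a + b}.
Proof.
move=> fD a b; have f0 i : f i 0 = 0.
  by apply: (addrI (f i 0)); rewrite -fD !addr0.
pose D := (msupp a `|` msupp b `|` msupp (a + b))%fset.
rewrite !(@mextw _ _ f D) //; first last.
- by rewrite /D fsubsetUr.
- by rewrite /D -fsetUA fsubsetUl.
- by rewrite /D [(msupp a `|` msupp b)%fset]fsetUC -fsetUA fsubsetUl.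
by rewrite -big_split /=; apply: eq_bigr => i _; rewrite coefD fD.
Qed.

Lemma mext_add (V : lmodType F) (W : zmodType) (f f1 f2 : B -> V -> W) a :
  (forall i v, f i v = f1 i v + f2 i v) -> mext f a = mext f1 a + mext f2 a.
Proof. by move=> E; rewrite [@mext]unlock -big_split; apply: eq_bigr => i _; exact: E. Qed.

Lemma mext_mono (V : lmodType F) (W : zmodType) (f : B -> V -> W) i v :
  (forall i, f i 0 = 0) -> mext f (mono i v) = f i v.
Proof.
move=> f0; rewrite (@mextw _ _ _ [fset i]%fset) //; last by rewrite [@mono]unlock msuppU_le.
by rewrite big_seq_fset1 coef_mono eqxx.
Qed.

Lemma pbw_ind (V : lmodType F) (P : pbw V -> Prop) :
  (forall a b, P a -> P b -> P (a + b)) -> (forall i v, P (mono i v)) ->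
  forall a, P a.
Proof.
move=> PD PU a; have P0 : P 0.
  by have := PU (0%N, 0) 0; rewrite [@mono]unlock monalgU0.
rewrite [a]monalgE; elim/big_rec: _ => // i x _; apply: PD.
by have := PU i (a@_i); rewrite [@mono]unlock.
Qed.

Lemma monoD (V : lmodType F) i (u v : V) : mono i (u + v) = mono i u + mono i v.
Proof. by rewrite [@mono]unlock; exact: monalgUD. Qed.
Lemma mono0 (V : lmodType F) i : mono i (0 : V) = 0.
Proof. by rewrite [@mono]unlock; exact: monalgU0. Qed.

Definition pbw_scale (V : lmodType F) (c : F) (a : pbw V) : pbw V :=
  mext (fun i v => mono i (c *: v)) a.

Lemma pbw_scaleD (V : lmodType F) c : {morph @pbw_scale V c : a b / a + b}.
Proof. by apply: mextD => i u v; rewrite scalerDr monoD. Qed.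
Lemma pbw_scaleU (V : lmodType F) c i (v : V) :
  pbw_scale c (mono i v) = mono i (c *: v).
Proof. by rewrite /pbw_scale mext_mono // => j; rewrite scaler0 mono0. Qed.

Fact pbw_scaleA (V : lmodType F) b c (a : pbw V) :
  pbw_scale b (pbw_scale c a) = pbw_scale (b * c) a.
Proof.
elim/pbw_ind: a => [a a' IH IH'|i v]; first by rewrite !pbw_scaleD IH IH'.
by rewrite !pbw_scaleU scalerA.
Qed.
Fact pbw_scale1 (V : lmodType F) : left_id 1 (@pbw_scale V).
Proof.
elim/pbw_ind=> [a a' IH IH'|i v]; first by rewrite !pbw_scaleD IH IH'.
by rewrite !pbw_scaleU scale1r.
Qed.
Fact pbw_scaleDr (V : lmodType F) : right_distributive (@pbw_scale V) +%R.
Proof. by move=> c a b; rewrite pbw_scaleD. Qed.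
Fact pbw_scaleDl (V : lmodType F) a : {morph (@pbw_scale V)^~ a : b c / b + c}.
Proof.
move=> b c; elim/pbw_ind: a => [a a' IH IH'|i v].
  by rewrite !pbw_scaleD IH IH' addrACA.
by rewrite !pbw_scaleU scalerDl monoD.
Qed.

HB.instance Definition _ (V : lmodType F) := GRing.Zmodule_isLmodule.Build F (pbw V)
  (@pbw_scaleA V) (@pbw_scale1 V) (@pbw_scaleDr V) (@pbw_scaleDl V).

Lemma monoZ (V : lmodType F) c i (v : V) : c *: mono i v = mono i (c *: v).
Proof. exact: pbw_scaleU. Qed.

End Tensor.

(* A (x) C as an algebra: (X^n g^s (x) u) (X^m g^t (x) v)
   = q^(-sm) X^(n+m) g^(s+t) (x) uv, since g X = q^-1 X g. *)
HB.lock Definition pbw_mul (K : qField) (C : algType (qbase K)) (a b : pbw C) :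
    pbw C :=
  mext (fun i u => mext (fun j v =>
    mono ((i.1 + j.1)%N, i.2 + j.2)
      (qparam K ^ (- (i.2 * j.1%:Z)) *: (u * v))) b) a.

Arguments pbw_mul {K C} a b.
Arguments mono {K V} i v.
Arguments coef {K V} a i.
Arguments mext {K V W} f a.

Section Ring.
Variable K : qField.
Local Notation F := (qbase K).
Local Notation q := (qparam K).
Local Notation B := (nat * int)%type.
Variable C : algType F.
Implicit Types a b c : pbw C.

Lemma pbw_mulDr a : {morph pbw_mul a : b c / b + c}.
Proof.
rewrite [@pbw_mul]unlock => b c; apply: mext_add => i t.
by apply: mextD => j u v; rewrite mulrDr scalerDr monoD.
Qed.

Lemma pbw_mulDl c : {morph pbw_mul^~ c : a b / a + b}.
Proof.
rewrite [@pbw_mul]unlock; apply: mextD => i u v; apply: mext_add => j w.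
by rewrite mulrDl scalerDr monoD.
Qed.

Lemma pbw_mulUU i j (u v : C) : pbw_mul (mono i u) (mono j v) =
  mono ((i.1 + j.1)%N, i.2 + j.2) (q ^ (- (i.2 * j.1%:Z)) *: (u * v)).
Proof.
rewrite [@pbw_mul]unlock mext_mono => [|i']; last first.
  by rewrite [@mext]unlock big1 // => j' _; rewrite mul0r scaler0 mono0.
by rewrite mext_mono // => j'; rewrite mulr0 scaler0 mono0.
Qed.

Fact pbw_mulA : associative (@pbw_mul K C).
Proof.
move=> a b c; elim/pbw_ind: a => [a a' IH IH'|i u].
  by rewrite !pbw_mulDl IH IH'.
elim/pbw_ind: b => [b b' IH IH'|j v].
  by rewrite pbw_mulDl !pbw_mulDr pbw_mulDl IH IH'.
elim/pbw_ind: c => [c c' IH IH'|l w]; first by rewrite !pbw_mulDr IH IH'.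
rewrite !pbw_mulUU /= -scalerAr -scalerAl !scalerA -!expfzDr ?qparam_neq0 //.
rewrite addnA addrA mulrA; congr (mono _ (q ^ _ *: _)).
by rewrite PoszD; ring.
Qed.

Definition pbw_one : pbw C := mono (0%N, 0) 1.

Fact pbw_mul1 : left_id pbw_one (@pbw_mul K C).
Proof.
elim/pbw_ind=> [a a' IH IH'|i u]; first by rewrite pbw_mulDr IH IH'.
by rewrite pbw_mulUU /= mul0r oppr0 scale1r mul1r add0r; case: i.
Qed.

Fact pbw_mulr1 : right_id pbw_one (@pbw_mul K C).
Proof.
elim/pbw_ind=> [a a' IH IH'|i u]; first by rewrite pbw_mulDl IH IH'.
by rewrite pbw_mulUU /= mulr0 oppr0 scale1r mulr1 addr0 addn0; case: i.
Qed.

Fact pbw_one_neq0 : pbw_one != 0.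
Proof.
apply/eqP => /(congr1 (fun a => coef a (0%N, 0))).
by rewrite coef_mono coef0 eqxx; apply/eqP; rewrite oner_eq0.
Qed.

HB.instance Definition _ := GRing.Zmodule_isNzRing.Build (pbw C)
  pbw_mulA pbw_mul1 pbw_mulr1 (fun a b c => pbw_mulDl c a b) pbw_mulDr pbw_one_neq0.

Lemma mono_mul i j (u v : C) : mono i u * mono j v =
  mono ((i.1 + j.1)%N, i.2 + j.2) (q ^ (- (i.2 * j.1%:Z)) *: (u * v)).
Proof. exact: pbw_mulUU. Qed.

Fact pbw_scaleAl (c : F) a b : c *: (a * b) = (c *: a) * b.
Proof.
elim/pbw_ind: a => [a a' IH IH'|i u].
  by rewrite scalerDr !mulrDl scalerDr IH IH'.
elim/pbw_ind: b => [b b' IH IH'|j v]; first by rewrite !mulrDr scalerDr IH IH'.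
by rewrite monoZ !mono_mul monoZ -scalerAl !scalerA mulrC.
Qed.

HB.instance Definition _ := GRing.Lmodule_isLalgebra.Build F (pbw C) pbw_scaleAl.

Fact pbw_scaleAr (c : F) a b : c *: (a * b) = a * (c *: b).
Proof.
elim/pbw_ind: a => [a a' IH IH'|i u]; first by rewrite !mulrDl scalerDr IH IH'.
elim/pbw_ind: b => [b b' IH IH'|j v].
  by rewrite scalerDr !mulrDr scalerDr IH IH'.
by rewrite monoZ !mono_mul monoZ -scalerAr !scalerA mulrC.
Qed.

HB.instance Definition _ := GRing.Lalgebra_isAlgebra.Build F (pbw C) pbw_scaleAr.

End Ring.

(* C_q(B_+) = U_q(b_+). The lemmas of UniversalProperty together with XgE, gVE,
   gVgE and Cq_generated say that it is the algebra presented by the generators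
   X, g, g^-1 and the relations g g^-1 = g^-1 g = 1, X g = q g X. *)
Notation Cq K := (pbw (qbase K)^o).

Section HopfAlgebra.
Variable K : qField.
Local Notation F := (qbase K).
Local Notation q := (qparam K).
Local Notation A := (Cq K).

Definition XG (n : nat) (s : int) : A := mono (n, s) 1.
Definition genX : A := XG 1 0.
Definition geng : A := XG 0 1.
Definition gengV : A := XG 0 (-1).

Section UniversalProperty.
Variables (C : algType F) (x y yV : C).

Definition zpow (s : int) : C :=
  match s with Posz m => y ^+ m | Negz m => yV ^+ m.+1 end.

(* The morphism A -> C with X |-> x, g |-> y, g^-1 |-> yV. *)
Definition alg_lift (a : A) : C :=
  mext (fun i (c : F^o) => c *: (x ^+ i.1 * zpow i.2)) a.

Hypotheses (yyV : y * yV = 1) (yVy : yV * y = 1) (xy : x * y = q *: (y * x)).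

Lemma zpowS s : zpow (s + 1) = zpow s * y.
Proof.
case: s => [m|[|m]].
- by rewrite -PoszD addn1 /= exprSr.
- by rewrite /= expr1 yVy subnn expr0.
have -> : Negz m.+1 + 1 = Negz m by rewrite !NegzE -[in LHS]addn1 PoszD opprD addrNK.
by rewrite /= [in RHS]exprSr -mulrA yVy mulr1.
Qed.

Lemma zpowD s t : zpow (s + t) = zpow s * zpow t.
Proof.
elim: t => [|m IH|m IH]; first by rewrite addr0 mulr1.
  by rewrite -addn1 PoszD addrA zpowS IH [in RHS]zpowS mulrA.
have H u : zpow (u - 1) = zpow u * yV.
  by rewrite -[u in RHS](addrNK 1) zpowS -mulrA yyV mulr1.
by rewrite -addn1 PoszD opprD addrA !H IH mulrA.
Qed.

Lemma zpow_comm1 s : zpow s * x = q ^ (- s) *: (x * zpow s).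
Proof.
have yx : y * x = q^-1 *: (x * y) by rewrite xy scalerA mulVf ?qparam_neq0 ?scale1r.
have yVx : yV * x = q *: (x * yV).
  rewrite -[LHS]mulr1 -yyV mulrA -[_ * x * y]mulrA xy -scalerAr mulrA yVy mul1r.
  by rewrite -scalerAl.
elim: s => [|m IH|m IH]; first by rewrite oppr0 scale1r mul1r mulr1.
  rewrite -addn1 PoszD zpowS -mulrA yx -scalerAr [in LHS]mulrA IH -scalerAl scalerA -mulrA.
  by rewrite opprD expfzDr ?qparam_neq0 // mulrC exprN1.
rewrite -addn1 PoszD opprD zpowD -mulrA /= expr1 yVx -scalerAr [in LHS]mulrA IH.
by rewrite -scalerAl scalerA -mulrA opprD opprK expfzDr ?qparam_neq0 // mulrC.
Qed.

Lemma zpow_comm s r :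
  zpow s * x ^+ r = q ^ (- (s * r%:Z)) *: (x ^+ r * zpow s).
Proof.
elim: r => [|r IH]; first by rewrite mulr0 oppr0 scale1r mulr1 mul1r.
rewrite exprSr mulrA IH -scalerAl -[_ * zpow s * x]mulrA zpow_comm1.
rewrite -scalerAr scalerA [in LHS]mulrA.
by rewrite -expfzDr ?qparam_neq0 // -addn1 PoszD mulrDr mulr1 opprD.
Qed.

Lemma alg_liftD : {morph alg_lift : a b / a + b}.
Proof. by apply: mextD => i u v; rewrite scalerDl. Qed.
Lemma alg_lift_mono i (c : F) : alg_lift (mono i (c : F^o)) = c *: (x ^+ i.1 * zpow i.2).
Proof. by rewrite /alg_lift mext_mono // => j; rewrite scale0r. Qed.

Lemma alg_liftM : {morph alg_lift : a b / a * b}.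
Proof.
move=> a b; elim/pbw_ind: a => [a a' IH IH'|i u].
  by rewrite mulrDl !alg_liftD mulrDl IH IH'.
elim/pbw_ind: b => [b b' IH IH'|j v].
  by rewrite mulrDr !alg_liftD mulrDr IH IH'.
have E : (x ^+ i.1 * zpow i.2) * (x ^+ j.1 * zpow j.2) =
    q ^ (- (i.2 * j.1%:Z)) *: (x ^+ (i.1 + j.1) * zpow (i.2 + j.2)).
  rewrite exprD zpowD -mulrA [zpow i.2 * (_ * _)]mulrA zpow_comm.
  by rewrite -scalerAl -scalerAr !mulrA.
rewrite mono_mul !alg_lift_mono /= -scalerAl -scalerAr E !scalerA.
have -> : u * v * q ^ (- (i.2 * j.1%:Z)) = q ^ (- (i.2 * j.1%:Z)) * u * v.
  by rewrite mulrC mulrA.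
by [].
Qed.

Lemma alg_liftZ (c : F) a : alg_lift (c *: a) = c *: alg_lift a.
Proof.
elim/pbw_ind: a => [a a' IH IH'|i u].
  by rewrite scalerDr !alg_liftD scalerDr IH IH'.
by rewrite monoZ !alg_lift_mono scalerA.
Qed.

Lemma alg_lift_gen :
  [/\ alg_lift 1 = 1, alg_lift genX = x, alg_lift geng = y & alg_lift gengV = yV].
Proof.
rewrite /genX /geng /gengV /XG; split; rewrite alg_lift_mono scale1r /=.
- by rewrite mulr1.
- by rewrite mulr1 expr1.
- by rewrite mul1r expr1.
- by rewrite mul1r expr1.
Qed.

End UniversalProperty.

Lemma XG_mul n s m t :
  XG n s * XG m t = q ^ (- (s * m%:Z)) *: XG (n + m) (s + t).
Proof. by rewrite /XG mono_mul monoZ mulr1. Qed.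

Lemma gVE : geng * gengV = 1. Proof. by rewrite XG_mul /= scale1r. Qed.
Lemma gVgE : gengV * geng = 1. Proof. by rewrite XG_mul /= scale1r. Qed.
Lemma XgE : genX * geng = q *: (geng * genX).
Proof.
by rewrite !XG_mul scalerA mul0r oppr0 mulr1 exprN1 mulfV ?qparam_neq0.
Qed.

Lemma XGE n s : XG n s = genX ^+ n * zpow geng gengV s.
Proof.
have Xn m : genX ^+ m = XG m 0.
  elim: m => // m IH; rewrite exprSr IH XG_mul mul0r oppr0 scale1r.
  by rewrite addn1 addr0.
have gs : zpow geng gengV s = XG 0 s.
  elim: s => // m IH.
    rewrite -addn1 PoszD (zpowS gVgE) IH XG_mul.
    by rewrite mulr0 oppr0 scale1r.
  rewrite -addn1 PoszD opprD (zpowD gVE gVgE) IH /= expr1 XG_mul.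
  by rewrite mulr0 oppr0 scale1r.
by rewrite Xn gs XG_mul mul0r oppr0 scale1r addn0 add0r.
Qed.

Lemma Cq_generated (C : algType F) (f : A -> C) (x y yV : C) :
  {morph f : a b / a + b} -> (forall c a, f (c *: a) = c *: f a) ->
  {morph f : a b / a * b} -> f 1 = 1 ->
  f genX = x -> f geng = y -> f gengV = yV -> f =1 alg_lift x y yV.
Proof.
move=> fD fZ fM f1 fX fg fgV; elim/pbw_ind=> [a b IH IH'|i c].
  by rewrite fD alg_liftD IH IH'.
have -> : mono i c = (c : F) *: XG i.1 i.2.
  by rewrite /XG monoZ -surjective_pairing; congr mono; rewrite -[LHS]mulr1.
rewrite fZ alg_liftZ; congr (_ *: _).
rewrite /XG alg_lift_mono scale1r -/(XG _ _) XGE fM.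
have fE a n : f (a ^+ n) = f a ^+ n by elim: n => // n IH; rewrite !exprS fM IH.
by case: i.2 => m /=; rewrite !fE fX ?fg ?fgV.
Qed.

End HopfAlgebra.

Section HopfStructure.
Variable K : qField.
Local Notation F := (qbase K).
Local Notation q := (qparam K).
Local Notation A := (Cq K).
Local Notation X := (genX K).
Local Notation g := (geng K).
Local Notation gV := (gengV K).

Definition tens (V : lmodType F) (a : A) (v : V) : pbw V :=
  mext (fun i (c : F^o) => mono i (c *: v)) a.

(* The linear map on A (x) V induced by a bilinear f : A x V -> W. *)
Definition tlift (V : lmodType F) (W : zmodType) (f : A -> V -> W) (t : pbw V) : W :=
  mext (fun i v => f (XG K i.1 i.2) v) t.

Definition Delta : A -> pbw A :=
  alg_lift (tens X 1 + tens g X) (tens g g) (tens gV gV).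

Definition counit : A -> F := alg_lift (C := F^o) 0 1 1.

(* S is antimultiplicative: S (X^n g^s) = (S g)^s (S X)^n. *)
Definition antipode : A -> A :=
  mext (fun i (c : F^o) => c *: (zpow gV g i.2 * (- (gV * X)) ^+ i.1)).

(* sweedler f a = f (a_(1), a_(2)) summed, for f bilinear. *)
Definition sweedler (W : zmodType) (f : A -> A -> W) (a : A) : W :=
  tlift f (Delta a).

Lemma tens_XG (V : lmodType F) n s (v : V) : tens (XG K n s) v = mono (n, s) v.
Proof.
by rewrite /tens /XG mext_mono ?scale1r // => i; rewrite scale0r mono0.
Qed.

Lemma tlift_tens (V : lmodType F) (W : lmodType F) (f : A -> V -> W) :
  (forall a c v w, f a (c *: v + w) = c *: f a v + f a w) ->
  (forall v c a b, f (c *: a + b) v = c *: f a v + f b v) ->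
  forall a v, tlift f (tens a v) = f a v.
Proof.
move=> fr fl a v.
have fDr b : {morph f b : u w / u + w} by move=> u w; rewrite -[u]scale1r fr !scale1r.
have fDl w : {morph f^~ w : b c / b + c}.
  by move=> b c; rewrite -[b]scale1r fl !scale1r.
have f0r b : f b 0 = 0 by apply: (addrI (f b 0)); rewrite -fDr !addr0.
have f0l w : f 0 w = 0 by apply: (addrI (f 0 w)); rewrite -fDl !addr0.
elim/pbw_ind: a => [a b IH IH'|i c].
  rewrite fDl -IH -IH' /tens mextD => [|j c d]; last by rewrite scalerDl monoD.
  by rewrite /tlift mextD // => j u w; exact: fDr.
rewrite /tens mext_mono => [|j]; last by rewrite scale0r mono0.
rewrite /tlift mext_mono //.
have -> : mono i c = (c : F) *: XG K i.1 i.2.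
  by rewrite /XG monoZ -surjective_pairing; congr mono; rewrite -[LHS]mulr1.
by rewrite -[c *: v]addr0 fr f0r addr0 -[_ *: XG _ _ _]addr0 fl f0l addr0.
Qed.

Lemma counit_morph : [/\ {morph counit : a b / a + b},
  forall c a, counit (c *: a) = c * counit a,
  {morph counit : a b / a * b} & counit 1 = 1].
Proof.
have E : [/\ 1 * 1 = 1 :> F^o & 0 * 1 = q *: (1 * 0) :> F^o].
  by split; rewrite ?mulr1 ?mulr0 ?scaler0.
case: E => E1 E2; split.
- exact: (@alg_liftD _ F^o 0 1 1).
- exact: (@alg_liftZ _ F^o 0 1 1).
- exact: (@alg_liftM _ F^o 0 1 1).
- by have [] := @alg_lift_gen _ F^o 0 1 1.
Qed.

Lemma tens_mul (a b c d : A) : tens a b * tens c d = tens (a * c) (b * d).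
Proof.
have tD (u : A) : {morph (@tens A)^~ u : x y / x + y}.
  by apply: mextD => i x y; rewrite scalerDl monoD.
elim/pbw_ind: a => [a a' IH IH'|i x]; first by rewrite mulrDl !tD mulrDl IH IH'.
elim/pbw_ind: c => [c c' IH IH'|j y]; first by rewrite mulrDr !tD mulrDr IH IH'.
rewrite mono_mul /tens !mext_mono => [|l|l|l]; do ?by rewrite scale0r mono0.
rewrite mono_mul -scalerAl -scalerAr !scalerA.
by congr mono; congr (_ *: _); rewrite -!mulrA.
Qed.

Lemma Delta_morph : [/\ {morph Delta : a b / a + b},
  forall c a, Delta (c *: a) = c *: Delta a,
  {morph Delta : a b / a * b} & Delta 1 = 1].
Proof.
have t1 : tens (1 : A) (1 : A) = 1 :> pbw A by exact: tens_XG.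
have E1 : tens g g * tens gV gV = 1 :> pbw A by rewrite tens_mul gVE t1.
have E2 : tens gV gV * tens g g = 1 :> pbw A by rewrite tens_mul gVgE t1.
have tZl c (a b : A) : tens (c *: a) b = c *: tens a b.
  elim/pbw_ind: a => [a a' IH IH'|i x].
    have tD : {morph (@tens A)^~ b : x y / x + y}.
      by apply: mextD => i x y; rewrite scalerDl monoD.
    by rewrite scalerDr !tD scalerDr IH IH'.
  rewrite /tens monoZ !mext_mono => [|l|l]; do ?by rewrite scale0r mono0.
  by rewrite monoZ scalerA.
have tZr c (a b : A) : tens a (c *: b) = c *: tens a b.
  rewrite -tZl; elim/pbw_ind: a => [a a' IH IH'|i x].
    have tD u : {morph (@tens A)^~ u : x y / x + y}.
      by apply: mextD => i x y; rewrite scalerDl monoD.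
    by rewrite scalerDr !tD IH IH'.
  rewrite /tens monoZ !mext_mono => [|l|l]; do ?by rewrite scale0r mono0.
  by rewrite scalerA mulrC.
have aux (C : algType F) (u v w : C) : u * w = q *: (w * u) ->
  v * w = q *: (w * v) -> (u + v) * w = q *: (w * (u + v)).
  by move=> uw vw; rewrite mulrDl mulrDr uw vw scalerDr.
have E3 : (tens X 1 + tens g X) * tens g g =
    q *: (tens g g * (tens X 1 + tens g X)) :> pbw A.
  apply: aux.
    rewrite (tens_mul X 1 g g) (tens_mul g g X 1) XgE (mul1r g) (mulr1 g).
    exact: tZl.
  rewrite (tens_mul g X g g) (tens_mul g g g X) XgE; exact: tZr.
split.
- exact: (@alg_liftD _ _ (tens X 1 + tens g X) (tens g g) (tens gV gV)).
- exact: (@alg_liftZ _ _ (tens X 1 + tens g X) (tens g g) (tens gV gV)).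
- exact: (@alg_liftM _ _ (tens X 1 + tens g X) (tens g g) (tens gV gV)).
by have [] := alg_lift_gen (tens X 1 + tens g X) (tens g g) (tens gV gV).
Qed.

Definition qint (n : nat) : F := \sum_(i < n) q ^+ i.
Definition qfact (n : nat) : F := \prod_(1 <= i < n.+1) qint i.

Definition pairing (x a : A) : F :=
  mext (fun i (c : F^o) => mext (fun j (d : F^o) =>
    if i.1 == j.1
    then c * d * (qfact i.1 * q ^- 'C(i.1, 2) * q ^ (- (i.2 * j.2)))
    else 0) a) x.

(* h |> x = h_(1) x S h_(2) *)
Definition adL (h x : A) : A :=
  sweedler (fun h1 h2 => h1 * x * antipode h2) h.

(* Ad_L (v) = v_(1) S v_(3) (x) v_(2) *)
Definition coadL (v : A) : pbw A :=
  sweedler (fun w v3 =>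
    sweedler (fun v1 v2 => tens (v1 * antipode v3) v2) w) v.

(* t lies in A (x) L *)
Definition in_tensor (L : subspace A) (t : pbw A) :=
  exists s : seq (A * A),
    (forall p, p \in s -> p.2 \in L) /\ t = \sum_(p <- s) tens p.1 p.2.

Definition ker_counit : {pred A} := fun a => counit a == 0.

Fact ker_counit_closed : submod_closed ker_counit.
Proof.
have [cD cZ _ _] := counit_morph; split=> [|c u v /eqP u0 /eqP v0].
  by apply/eqP; have := cZ 0 0; rewrite scale0r mul0r.
by rewrite unfold_in /= cD cZ u0 v0 mulr0 addr0.
Qed.

HB.instance Definition _ := GRing.isSubmodClosed.Build F A ker_counit
  (GRing.submod_closed_semi ker_counit_closed).

Record kerE := KerE { kerE_val : A; _ : kerE_val \in ker_counit }.

HB.instance Definition _ := [isSub for kerE_val].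
HB.instance Definition _ := [Choice of kerE by <:].
HB.instance Definition _ := [SubChoice_isSubLmodule of kerE by <:].

Fact ker_proj_subproof (a : A) : a - (counit a)%:A \in ker_counit.
Proof.
have [cD cZ _ c1] := counit_morph.
by rewrite unfold_in /= cD -scaleNr cZ c1 mulr1 subrr.
Qed.
Definition ker_proj (a : A) : kerE := KerE (ker_proj_subproof a).

Fact ker_mul_subproof (a : A) (v : kerE) : a * kerE_val v \in ker_counit.
Proof.
have [_ _ cM _] := counit_morph.
by case: v => v /eqP v0 /=; rewrite unfold_in /= cM v0 mulr0.
Qed.
Definition ker_mul (a : A) (v : kerE) : kerE := KerE (ker_mul_subproof a v).

End HopfStructure.

Section Calculi.
Variable K : qField.
Local Notation F := (qbase K).
Local Notation q := (qparam K).
Local Notation A := (Cq K).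

(* Raw data; the axioms of a bicovariant first order calculus are gathered in
   [is_calculus]. *)
Record calculus := Calculus {
  form :> lmodType F;
  lact : A -> form -> form;
  ract : form -> A -> form;
  dif : A -> form }.

Record is_bimodule (G : calculus) : Prop := IsBimodule {
  lactDl : forall c a b (w : G), lact (c *: a + b) w = c *: lact a w + lact b w;
  lactDr : forall c a (v w : G), lact a (c *: v + w) = c *: lact a v + lact a w;
  lact1 : forall w : G, lact 1 w = w;
  lactM : forall a b (w : G), lact (a * b) w = lact a (lact b w);
  ractDl : forall c (v w : G) a, ract (c *: v + w) a = c *: ract v a + ract w a;
  ractDr : forall c (w : G) a b, ract w (c *: a + b) = c *: ract w a + ract w b;
  ract1 : forall w : G, ract w 1 = w;
  ractM : forall (w : G) a b, ract w (a * b) = ract (ract w a) b;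
  lractA : forall a (w : G) b, ract (lact a w) b = lact a (ract w b) }.

(* The sum of a_k d b_k over s = [:: (a_k, b_k)]. *)
Definition adb (G : calculus) (s : seq (A * A)) : G :=
  \sum_(p <- s) lact p.1 (dif G p.2).

Record is_first_order (G : calculus) : Prop := IsFirstOrder {
  fo_bimodule : is_bimodule G;
  dif_linear : forall c a b, dif G (c *: a + b) = c *: dif G a + dif G b;
  dif_leibniz : forall a b, dif G (a * b) = ract (dif G a) b + lact a (dif G b);
  dif_generates : forall w : G, exists s, w = adb G s }.

(* Woronowicz' conditions: the coactions sum a_k db_k |->
   sum Delta a_k (id (x) d) Delta b_k in A (x) Gamma and
   sum Delta a_k (d (x) id) Delta b_k in Gamma (x) A are well defined. *)
Definition coactL (G : calculus) (s : seq (A * A)) : pbw G :=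
  \sum_(p <- s) sweedler (fun a1 a2 => sweedler (fun b1 b2 =>
    tens (a1 * b1) (lact a2 (dif G b2))) p.2) p.1.

Definition coactR (G : calculus) (s : seq (A * A)) : pbw G :=
  \sum_(p <- s) sweedler (fun a1 a2 => sweedler (fun b1 b2 =>
    tens (a2 * b2) (lact a1 (dif G b1))) p.2) p.1.

Definition left_covariant (G : calculus) :=
  forall s, adb G s = 0 -> coactL G s = 0.
Definition right_covariant (G : calculus) :=
  forall s, adb G s = 0 -> coactR G s = 0.

Definition is_calculus (G : calculus) :=
  [/\ is_first_order G, left_covariant G & right_covariant G].

Definition right_invariant (G : calculus) : {pred G} :=
  fun w => `[< exists2 s, w = adb G s & coactR G s = tens 1 w >].

(* The right invariant forms of the calculus of M are the v (x) 1, so that this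
   dimension is dim (ker eps / M) for that calculus. *)
Definition calculus_dim (G : calculus) (n : nat) := has_dim (right_invariant (G := G)) n.

Record calculus_morphism (G H : calculus) (f : G -> H) : Prop := CalcMorphism {
  cmor_linear : forall c v w, f (c *: v + w) = c *: f v + f w;
  cmor_lact : forall a w, f (lact a w) = lact a (f w);
  cmor_ract : forall w a, f (ract w a) = ract (f w) a;
  cmor_dif : forall a, f (dif G a) = dif H a }.

Definition calculus_iso (G H : calculus) :=
  exists2 f : G -> H, calculus_morphism f & bijective f.

(* Quotient calculi are the surjective morphisms onto calculi. *)
Definition coirreducible (G : calculus) :=
  (exists w : G, w != 0) /\
  (forall (H : calculus) (f : G -> H),
     is_calculus H -> calculus_morphism f -> (forall v : H, exists w, f w = v) ->
     (forall v : H, v = 0) \/ bijective f).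

(* G is the direct sum of the Gs n, n in J: the maps p n identify G, as a
   bimodule with d, with the product over n in J. *)
Definition calculus_sum (J : {fset nat}) (G : calculus) (Gs : nat -> calculus) :=
  exists p : forall n, G -> Gs n,
    (forall n, n \in J -> calculus_morphism (p n)) /\
    (forall w : forall n, Gs n,
       exists! v : G, forall n, n \in J -> p n v = w n).

Definition crossed_submodule (M : subspace A) :=
  [/\ {subset M <= ker_counit (K := K)},
      forall a v, v \in M -> a * v \in M &
      forall v, v \in M -> in_tensor M (coadL v)].

(* The calculus (ker eps / M) (x) A; it is a bicovariant calculus only when M
   is a crossed submodule. *)
Section CalculusOf.
Variable M : subspace A.

Definition kerM_pred : {pred kerE K} := fun v => kerE_val v \in M.
Fact kerM_closed : submod_closed kerM_pred.
Proof.
have [M0 ML] := subspace_closed M.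
by split=> [|c u v uM vM]; [exact: M0 | exact: ML].
Qed.
Definition kerM : subspace (kerE K) := Subspace kerM_closed.

Definition kerQ : Type := lquot kerM.
HB.instance Definition _ := GRing.Lmodule.copy kerQ (lquot kerM).

Definition ker_pi (v : kerE K) : kerQ := lpi kerM v.

(* Independent of the representative chosen by [lrepr] as soon as A M <= M. *)
Definition calc_lact (a : A) (w : pbw kerQ) : pbw kerQ :=
  tlift (fun b v => sweedler (fun a1 a2 =>
    tens (a2 * b) (ker_pi (ker_mul a1 (lrepr v)))) a) w.

Definition calc_ract (w : pbw kerQ) (c : A) : pbw kerQ :=
  tlift (fun b v => tens (b * c) v) w.

(* Delta a - 1 (x) a = (a_(1) - eps (a_(1)) 1) (x) a_(2). *)
Definition calc_dif (a : A) : pbw kerQ :=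
  sweedler (fun a1 a2 => tens a2 (ker_pi (ker_proj a1))) a.

Definition calculus_of : calculus := Calculus calc_lact calc_ract calc_dif.

(* v in ker eps / M viewed as v (x) 1. *)
Definition inv_form (v : kerQ) : calculus_of := tens 1 v.

Definition codim (n : nat) := has_dim (V := kerQ) predT n.

Definition dual_basis (n : nat) (phi : nat -> A) (eta : nat -> kerQ) :=
  forall i j, (i < n)%N -> (j < n)%N ->
    forall v : kerE K, ker_pi v = eta j -> pairing (phi i) (kerE_val v) = (i == j)%:R.

End CalculusOf.

Record tangent_space (L : subspace A) : Prop := TangentSpace {
  tangent_ker : {subset L <= ker_counit (K := K)};
  tangent_adL : forall h x, x \in L -> adL h x \in L;
  tangent_coideal : forall x, x \in L ->
    in_tensor L (sweedler (fun x1 x2 => tens x1 (x2 - (counit x2)%:A)) x) }.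

Definition tangent_irreducible (L : subspace A) :=
  (exists2 x, x \in L & x != 0) /\
  (forall L' : subspace A, tangent_space L' -> {subset L' <= L} ->
     (forall x, x \in L' -> x = 0) \/ L' =i L).

Definition tangent_of (M : subspace A) : {pred A} :=
  fun x => (x \in ker_counit (K := K)) && `[< forall m, m \in M -> pairing x m = 0 >].

Definition braided_der (x : A) (a : A) : A :=
  sweedler (fun a1 a2 => pairing x a1 *: a2) a.

(* K[g, g^-1] inside A. *)
Definition laurent (r : A) := exists c : seq (F * int), r = \sum_(p <- c) p.1 *: XG K 0 p.2.

Definition M_poly (I : {fset nat}) (k : nat) : A :=
  \prod_(n <- (1%N |` I)%fset | (k < n)%N) (1 - q ^ (1 - n%:Z) *: geng K).

Definition M_ (I : {fset nat}) : subspace A :=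
  span (fun v => exists k r, laurent r /\ v = genX K ^+ k * M_poly I k * r).

Definition L_ (I : {fset nat}) : subspace A :=
  span (fun x => exists2 n, n \in I &
    x = XG K 0 (1 - n%:Z) - 1 \/
    exists2 k, (1 <= k <= n.-1)%N & x = XG K k (1 - n%:Z)).

Definition Gamma_ (I : {fset nat}) : calculus := calculus_of (M_ I).

(* Commutative Laurent polynomials K[X, g, g^-1]; the index (m, s) stands for
   the monomial g^s X^m. *)
Definition lpoly : Type := {malg F[(nat * int)%type]}.
HB.instance Definition _ := GRing.Lmodule.copy lpoly {malg F[(nat * int)%type]}.

Definition lcoef (f : lpoly) (m : nat) (s : int) : F := f@_(m, s).
Definition lmono (m : nat) (s : int) : lpoly := << (m, s) >>.

Definition lext (W : lmodType F) (w : nat -> int -> W) (f : lpoly) : W :=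
  \sum_(i <- msupp f) lcoef f i.1 i.2 *: w i.1 i.2.

Definition QX (m : int) : lpoly -> lpoly :=
  lext (fun n s => q ^ (m * n%:Z) *: lmono n s).
Definition Qg (m : int) : lpoly -> lpoly :=
  lext (fun n s => q ^ (m * s) *: lmono n s).

(* Division by X; the terms of degree 0 in X, absent in f - QX 1 f, are
   dropped. *)
Definition divX : lpoly -> lpoly :=
  lext (fun n s => if n is n'.+1 then lmono n' s else 0).
Definition dqX (f : lpoly) : lpoly := (1 - q)^-1 *: divX (f - QX 1 f).

(* g stands to the left here, while the basis XG has it to the right. *)
Definition normal_ord : lpoly -> A :=
  lext (fun m s => XG K 0 s * genX K ^+ m).

Definition qcomm (G : calculus) (p : F) (a : A) (w : G) : G :=
  lact a w - p *: ract w a.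

End Calculi.

Definition admissible (I : {fset nat}) := forall n, n \in I -> (2 <= n)%N.

(* Main.v *)
Require Import Defs.
From HB Require Import structures.
From mathcomp Require Import all_boot all_order all_algebra.
From mathcomp Require Import finmap boolp monalg ring zify.

(** Both classifications come from two closed formulas, for Delta(X^m) and for
    Ad_L(X^m). Put [m;k] for the Gaussian binomials at q^-1. Then (sw_XG, coadL_Xm)

      Delta(X^m g^s) = sum_k [m;k] X^(m-k) g^(k+s) (x) X^k g^s,
      Ad_L(X^m g^s)  = sum_k [m;k] X^(m-k) g^k
                         (x) X^k (1 - q^(-k) g) ... (1 - q^(1-m) g) g^s.

    Crossed submodules. Let M be one that contains a power of X, as it does when it
    has finite codimension (codim_Xexp). The coefficient of Ad_L at the first leg g^l
    shows that M is the direct sum of the X^k M_k with M_k an ideal of the ring of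
    Laurent polynomials in g. Multiplication by X gives that M_k is contained in
    M_(k+1), and the coefficient at the first leg X g^k that M_k contains
    (1 - q^(-k) g) M_(k+1). Hence every step from M_(k+1) to M_k is either trivial or
    a division by 1 - q^(-k) g, that is, the condition of vanishing at q^k. Writing
    n = k+1 for the steps of the second kind, one gets M = M_I, the step n = 1 being
    imposed by the counit (crossed_classification). So v lies in M_I precisely when its
    components of degree k < n vanish at g = q^(n-1), for n = 1 and n in I
    (M_vanishP); that each M_I is a crossed submodule is visible from the formula for
    Ad_L (M_crossed). The values just mentioned are coordinates on ker eps / M_I, so
    the codimension is the sum of the elements of I (codim_M).

    Tangent spaces. In a finite dimensional tangent space L, the action of g separates
    the degrees in X, and the coideal condition separates the powers of g, so that L
    is spanned by elements X^k g^s, or g^s - 1 for k = 0. With X^k g^s it contains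
    g^s - 1. Finally X |> X^k g^s = (1 - q^(-k-s)) X^(k+1) g^s, so that one climbs in
    degree until k = -s; there is no infinite climb in a finite dimensional space,
    hence s = 1-n with n >= 2, and the string through g^s - 1 spans L_{n}
    (tangent_classification). Since pairing with X^k g^(1-n) is, up to a scalar,
    evaluation in degree k at q^(n-1) (pairing_XG), L_I is the annihilator of M_I
    (tangent_of_M).

    Calculi. The calculus of a crossed submodule is shown to be bicovariant
    (calc_of_is_calculus), and in an arbitrary bicovariant calculus the right invariant
    forms omega(a) = d(a_(1)) S(a_(2)) form a free basis of the right module with kernel
    a crossed submodule (woronowicz). This transfers the classification of the M to
    abstract calculi. Morphisms preserve omega, so that there is at most one between
    two calculi, and one from Gamma_I to Gamma_J exactly when J is contained in I. This
    yields injectivity and coirreducibility of the Gamma_{n}; Lagrange interpolation at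
    the points q^(n-1) splits Gamma_I into them (Gamma_sum).

    For a single n, let z = q^(n-1) and let e = (g - 1) / (z - 1), which vanishes at 1 and
    takes the value 1 at z. The classes eta_i of X^i e are the basis dual to the
    evaluations in degree i < n at z, and in these coordinates the commutation relations
    are immediate (explicit_relations). The dual basis consists of the normalised
    X^i g^(1-n), and g^(1-n) - 1 for i = 0. The derivation of index i picks one term
    from the formula for Delta, and the q-derivative appears through an identity between
    Gaussian binomials and q-factorials (qfalling_gbin, braided_der_inv_dual). *)

Set Implicit Arguments.
Unset Strict Implicit.
Unset Printing Implicit Defensive.

Import GRing.Theory.
Local Open Scope ring_scope.

(** * Linear maps and subspaces *)

Section Linear.
Variable F : fieldType.
Implicit Types U V W : lmodType F.

Lemma lin0 U V (f : U -> V) : linear f -> f 0 = 0.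
Proof. by move=> fl; have := fl (-1) 0 0; rewrite scaleN1r addr0 oppr0 scaleN1r addNr. Qed.
Lemma linD U V (f : U -> V) : linear f -> {morph f : x y / x + y}.
Proof. by move=> fl x y; rewrite -[x in LHS]scale1r fl scale1r. Qed.
Lemma linZ U V (f : U -> V) : linear f -> forall c x, f (c *: x) = c *: f x.
Proof. by move=> fl c x; rewrite -[c *: x]addr0 fl (lin0 fl) addr0. Qed.
Lemma linN U V (f : U -> V) : linear f -> {morph f : x / - x}.
Proof. by move=> fl x; rewrite -[in LHS]scaleN1r (linZ fl) scaleN1r. Qed.
Lemma linB U V (f : U -> V) : linear f -> {morph f : x y / x - y}.
Proof. by move=> fl x y; rewrite (linD fl) (linN fl). Qed.
Lemma lin_sum U V (f : U -> V) : linear f ->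
  forall I (r : seq I) (P : pred I) (E : I -> U),
  f (\sum_(i <- r | P i) E i) = \sum_(i <- r | P i) f (E i).
Proof. by move=> fl I r P E; exact: (big_morph f (linD fl) (lin0 fl)). Qed.

Lemma linP U V (f : U -> V) : {morph f : x y / x + y} ->
  (forall c x, f (c *: x) = c *: f x) -> linear f.
Proof. by move=> fD fZ c x y; rewrite fD fZ. Qed.

Lemma lin_id U : linear (fun x : U => x).
Proof. by []. Qed.
Lemma lin_addf U V (f h : U -> V) : linear f -> linear h -> linear (fun x => f x + h x).
Proof. by move=> fl hl c x y; rewrite fl hl scalerDr addrACA. Qed.
Lemma lin_oppf U V (f : U -> V) : linear f -> linear (fun x => - f x).
Proof. by move=> fl c x y; rewrite fl opprD scalerN. Qed.
Lemma lin_scalef U V (f : U -> V) a : linear f -> linear (fun x => a *: f x).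
Proof. by move=> fl c x y; rewrite fl scalerDr !scalerA mulrC. Qed.
Lemma lin_comp U V W (f : V -> W) (h : U -> V) : linear f -> linear h ->
  linear (fun x => f (h x)).
Proof. by move=> fl hl c x y; rewrite hl fl. Qed.
Lemma lin_scalel U V (f : U -> F) (v : V) :
  linear (f : U -> F^o) -> linear (fun x => f x *: v).
Proof. by move=> fl c x y; rewrite fl scalerDl -scalerA. Qed.
Lemma lin_mull U (C : algType F) (f : U -> C) a : linear f -> linear (fun x => a * f x).
Proof. by move=> fl c x y; rewrite fl mulrDr scalerAr. Qed.
Lemma lin_mulr U (C : algType F) (f : U -> C) a : linear f -> linear (fun x => f x * a).
Proof. by move=> fl c x y; rewrite fl mulrDl scalerAl. Qed.
Definition bilin U V W (f : U -> V -> W) :=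
  (forall v, linear (f^~ v)) /\ (forall u, linear (f u)).

Variable (V : lmodType F) (N : subspace V).
Lemma sub0 : 0 \in N. Proof. by case: (subspace_closed N). Qed.
Lemma subDZ c u v : u \in N -> v \in N -> c *: u + v \in N.
Proof. by case: (subspace_closed N) => _ h; exact: h. Qed.
Lemma subD u v : u \in N -> v \in N -> u + v \in N.
Proof. by move=> uN vN; rewrite -[u]scale1r subDZ. Qed.
Lemma subZ c u : u \in N -> c *: u \in N.
Proof. by move=> uN; rewrite -[_ *: _]addr0 subDZ // sub0. Qed.
Lemma subB u v : u \in N -> v \in N -> u - v \in N.
Proof. by move=> uN vN; rewrite -scaleN1r addrC subDZ. Qed.
Lemma sub_sum I (r : seq I) (P : pred I) (E : I -> V) :
  (forall i, P i -> E i \in N) -> \sum_(i <- r | P i) E i \in N.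
Proof.
by move=> h; elim/big_rec: _ => [|i x Pi xN]; [exact: sub0 | exact: subD (h i Pi) xN].
Qed.
Lemma subZK c u : c != 0 -> c *: u \in N -> u \in N.
Proof. by move=> c0 /(subZ c^-1); rewrite scalerA mulVf // scale1r. Qed.
End Linear.

(** * Tensor products A (x) V *)

Section Tens.
Variable K : qField.
Local Notation F := (qbase K).
Local Notation A := (Cq K).
Local Notation X := (genX K).
Local Notation XG := (XG K).
Implicit Types U V W : lmodType F.

Lemma monoE i (c : F^o) : mono i c = (c : F) *: XG i.1 i.2.
Proof. by rewrite /Defs.XG monoZ -surjective_pairing; congr mono; rewrite -[LHS]mulr1. Qed.

Lemma A_ext V (f h : A -> V) : linear f -> linear h ->
  (forall n s, f (XG n s) = h (XG n s)) -> f =1 h.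
Proof.
move=> fl hl E; elim/pbw_ind => [a b IH IH'|i c].
  by rewrite (linD fl) (linD hl) IH IH'.
by rewrite monoE (linZ fl) (linZ hl) E.
Qed.

Lemma A_lin_ind (P : A -> Prop) :
  (forall a b, P a -> P b -> P (a + b)) -> (forall c a, P a -> P (c *: a)) ->
  (forall n s, P (XG n s)) -> forall a, P a.
Proof.
move=> PD PZ PX; elim/pbw_ind => [a b|i c]; first exact: PD.
by rewrite monoE; exact/PZ/PX.
Qed.

Lemma XGS n s : XG n.+1 s = X * XG n s.
Proof. by rewrite /genX XG_mul mul0r oppr0 expr0z scale1r add0r add1n. Qed.
Lemma XG01 : XG 0 0 = 1. Proof. by []. Qed.
Lemma XG0D s t : XG 0 s * XG 0 t = XG 0 (s + t).
Proof. by rewrite XG_mul mulr0 oppr0 expr0z scale1r. Qed.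
Lemma XG0V s : XG 0 s * XG 0 (- s) = 1.
Proof. by rewrite XG0D subrr. Qed.
Lemma XG0Vl s : XG 0 (- s) * XG 0 s = 1.
Proof. by rewrite XG0D addNr. Qed.

(** Every X^n g^s is reached from 1 by left multiplications by the group-likes
    g^s and by X. This is the induction used for all identities whose two sides
    are determined by their behaviour under left multiplication. *)
Lemma A_gen_ind (P : A -> Prop) :
  (forall a b, P a -> P b -> P (a + b)) -> (forall c a, P a -> P (c *: a)) ->
  P 1 -> (forall a, P a -> P (X * a)) -> (forall s a, P a -> P (XG 0 s * a)) ->
  forall a, P a.
Proof.
move=> PD PZ P1 PX Pg; apply: A_lin_ind => // n s.
elim: n => [|n IH]; last by rewrite XGS; exact: PX.
by rewrite -[XG 0 s]mulr1; exact: Pg.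
Qed.

Lemma tens_linl V (v : V) : linear (fun a : A => tens a v).
Proof.
apply: linP => [|c]; first by apply: mextD => i x y; rewrite scalerDl monoD.
elim/pbw_ind => [a b IH IH'|i x].
  have tD : {morph (@tens K V)^~ v : x y / x + y}.
    by apply: mextD => j x y; rewrite scalerDl monoD.
  by rewrite scalerDr !tD scalerDr IH IH'.
rewrite /tens monoZ !mext_mono => [|l|l]; do ?by rewrite scale0r mono0.
by rewrite monoZ scalerA.
Qed.
Lemma tens_linr V (a : A) : linear (fun v : V => tens a v).
Proof.
move=> c u v; elim/A_lin_ind: a => [a b|k a|n s].
- by rewrite !(linD (tens_linl _)) => -> ->; rewrite scalerDr addrACA.
- by rewrite !(linZ (tens_linl _)) => ->; rewrite scalerDr !scalerA mulrC.
- by rewrite !tens_XG monoD monoZ.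
Qed.

Lemma lin_tensl U V (f : U -> A) (v : V) : linear f -> linear (fun x => tens (f x) v).
Proof. by move=> fl; apply: (lin_comp (tens_linl v)). Qed.
Lemma lin_tensr U V (f : U -> V) (a : A) : linear f -> linear (fun x => tens a (f x)).
Proof. by move=> fl; apply: (lin_comp (tens_linr a)). Qed.

Lemma pbw_tens_ind V (P : pbw V -> Prop) :
  (forall a b, P a -> P b -> P (a + b)) -> (forall n s v, P (tens (XG n s) v)) ->
  forall t, P t.
Proof.
by move=> PD PT; apply: pbw_ind => // -[n s] v; rewrite -tens_XG.
Qed.

Lemma pbw_ext V W (f h : pbw V -> W) : linear f -> linear h ->
  (forall a v, f (tens a v) = h (tens a v)) -> f =1 h.
Proof.
move=> fl hl E; elim/pbw_tens_ind => [a b IH IH'|n s v]; last exact: E.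
by rewrite (linD fl) (linD hl) IH IH'.
Qed.

Lemma tliftE V W (f : A -> V -> W) t :
  tlift f t = \sum_(i <- msupp (t : {malg V[(nat * int)%type]})) f (XG i.1 i.2) (coef t i).
Proof. by rewrite /tlift [@mext]unlock [@coef]unlock. Qed.

Lemma eq_tlift V W (f h : A -> V -> W) t :
  (forall a v, f a v = h a v) -> tlift f t = tlift h t.
Proof. by move=> E; rewrite !tliftE; apply: eq_bigr => i _. Qed.

Lemma lin_tlift V W W' (l : W -> W') (f : A -> V -> W) t : linear l ->
  l (tlift f t) = tlift (fun a v => l (f a v)) t.
Proof. by move=> ll; rewrite !tliftE (lin_sum ll). Qed.

Lemma lin_tliftf U V W (f : U -> A -> V -> W) t :
  (forall a v, linear (fun x => f x a v)) -> linear (fun x => tlift (f x) t).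
Proof. 
move=> fl c x y; rewrite !tliftE scaler_sumr -big_split; apply: eq_bigr => i _.
exact: fl.
Qed.

Lemma tlift_add V W (f h : A -> V -> W) t :
  tlift (fun a v => f a v + h a v) t = tlift f t + tlift h t.
Proof. by rewrite !tliftE big_split. Qed.

Lemma tlift_tensE V W (f : A -> V -> W) : bilin f -> forall a v, tlift f (tens a v) = f a v.
Proof. by case=> fl fr; apply: tlift_tens => [a|v] *; [exact: fr | exact: fl]. Qed.

Lemma tlift_lin V W (f : A -> V -> W) : bilin f -> linear (tlift f).
Proof.
case=> fl fr; have fD : {morph tlift f : t u / t + u}.
  by apply: mextD => i u v; exact: linD.
apply: linP => // c; elim/pbw_tens_ind => [t u IH IH'|n s v].
  by rewrite scalerDr !fD IH IH' scalerDr.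
rewrite -(linZ (tens_linr _)) !tlift_tensE //; exact: linZ.
Qed.

Lemma lin_tliftt U V W (f : A -> V -> W) (e : U -> pbw V) : bilin f ->
  linear e -> linear (fun x => tlift f (e x)).
Proof. by move=> fb el; apply: (lin_comp (tlift_lin fb)). Qed.

Lemma tlift_id V (t : pbw V) : tlift (@tens K V) t = t.
Proof.
have bt : bilin (@tens K V) by split=> *; [exact: tens_linl | exact: tens_linr].
by move: t; apply: pbw_ext => [| |a v]; [exact: tlift_lin | | rewrite tlift_tensE].
Qed.

Lemma coef_lin V i : linear (fun t : pbw V => coef t i).
Proof.
apply: linP => [a b|c]; first exact: Defs.coefD.
elim/pbw_ind=> [a b IH IH'|j v]; first by rewrite scalerDr !Defs.coefD scalerDr IH IH'.
by rewrite monoZ !coef_mono scalerMnr.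
Qed.
Lemma coef_tens V n s (v : V) i : coef (tens (XG n s) v) i = v *+ ((n, s) == i).
Proof. by rewrite tens_XG coef_mono. Qed.
Lemma coef_XG n s i : coef (XG n s) i = ((n, s) == i)%:R.
Proof. by rewrite /Defs.XG coef_mono. Qed.
Lemma pcoefZ V c (t : pbw V) i : coef (c *: t) i = c *: coef t i.
Proof. exact: (linZ (@coef_lin V i)). Qed.
Lemma pcoefB V (t u : pbw V) i : coef (t - u) i = coef t i - coef u i.
Proof. exact: (linB (@coef_lin V i)). Qed.
Lemma pcoef_sum V I (r : seq I) (P : pred I) (E : I -> pbw V) i :
  coef (\sum_(j <- r | P j) E j) i = \sum_(j <- r | P j) coef (E j) i.
Proof. exact: (lin_sum (@coef_lin V i)). Qed.

Lemma pbw_sumE V (t : pbw V) :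
  t = \sum_(i <- msupp (t : {malg V[(nat * int)%type]})) tens (XG i.1 i.2) (coef t i).
Proof. by rewrite -tliftE tlift_id. Qed.

Lemma A_sumE (a : A) :
  a = \sum_(i <- msupp (a : {malg F^o[(nat * int)%type]})) coef a i *: XG i.1 i.2.
Proof.
rewrite [LHS]pbw_sumE; apply: eq_bigr => i _.
by rewrite tens_XG monoE.
Qed.

(** The basis X^n g^s of the A-leg is independent, so that membership in A (x) L
    can be read off coefficient by coefficient. *)
Lemma in_tensorP (L : subspace A) (t : pbw A) :
  in_tensor L t <-> forall i, coef t i \in L.
Proof.
split=> [[s [sL ->]] i|tL].
  rewrite pcoef_sum big_seq; apply: sub_sum => p /sL pL.
  elim/A_lin_ind: p.1 => [a b aL bL|c a aL|n m].
  - by rewrite (linD (tens_linl _)) Defs.coefD subD.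
  - by rewrite (linZ (tens_linl _)) pcoefZ subZ.
  - by rewrite coef_tens; case: eqP => _; rewrite ?mulr1n // mulr0n sub0.
exists [seq (XG i.1 i.2, coef t i) | i <- msupp (t : {malg _[(nat * int)%type]})].
split; first by move=> p /mapP[i _ ->] /=.
by rewrite big_map [LHS]pbw_sumE.
Qed.
End Tens.

(** * Sweedler sums and coassociativity *)

Section Sweedler.
Variable K : qField.
Local Notation F := (qbase K).
Local Notation A := (Cq K).
Local Notation XG := (XG K).
Implicit Types U V W : lmodType F.

Lemma Delta_lin : linear (@Delta K).
Proof. by have [D Z _ _] := Delta_morph K; exact: linP. Qed.
Lemma counit_lin : linear (@counit K : A -> F^o).
Proof. by have [D Z _ _] := counit_morph K; exact: linP. Qed.

Lemma eq_sw V (f h : A -> A -> V) a :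
  (forall a1 a2, f a1 a2 = h a1 a2) -> sweedler f a = sweedler h a.
Proof. exact: eq_tlift. Qed.
Lemma lin_sw V W (l : V -> W) (f : A -> A -> V) a : linear l ->
  l (sweedler f a) = sweedler (fun a1 a2 => l (f a1 a2)) a.
Proof. exact: lin_tlift. Qed.
Lemma sw_add V (f h : A -> A -> V) a :
  sweedler (fun a1 a2 => f a1 a2 + h a1 a2) a = sweedler f a + sweedler h a.
Proof. exact: tlift_add. Qed.
Lemma sw_sum V (f : A -> A -> V) a : exists s : seq (A * A),
  forall W (h : A -> A -> W), sweedler h a = \sum_(p <- s) h p.1 p.2.
Proof.
exists [seq (XG i.1 i.2, coef (Delta a) i)
        | i <- msupp (Delta a : {malg _[(nat * int)%type]})] => W h.
by rewrite /sweedler tliftE big_map.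
Qed.
Lemma sw_lin V (f : A -> A -> V) : bilin f -> linear (sweedler f).
Proof. move=> fb; exact: (lin_comp (tlift_lin fb) Delta_lin). Qed.
Lemma lin_swt U V (f : A -> A -> V) (e : U -> A) : bilin f ->
  linear e -> linear (fun x => sweedler f (e x)).
Proof. by move=> fb el; apply: (lin_comp (sw_lin fb)). Qed.
Lemma lin_swf U V (f : U -> A -> A -> V) a :
  (forall a1 a2, linear (fun x => f x a1 a2)) -> linear (fun x => sweedler (f x) a).
Proof. exact: lin_tliftf. Qed.
Lemma antipode_lin : linear (@antipode K).
Proof.
have D : {morph @antipode K : x y / x + y} by apply: mextD => i u v; rewrite scalerDl.
apply: linP => // c; elim/pbw_ind=> [a b IH IH'|i u].
  by rewrite scalerDr !D IH IH' scalerDr.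
by rewrite monoZ /antipode !mext_mono => [|j|j]; rewrite ?scale0r // scalerA.
Qed.
End Sweedler.

(** Linearity side conditions are ubiquitous, and they are solved by structural
    descent on the body: lin proves linearity in one variable, bil bilinearity.
    Functions known to be linear from the context are used through lin_leaf, and
    lin_extra is extended when further linear maps appear. *)
Ltac lin_extra := fail.
Ltac lin_leaf := match goal with
  | H : GRing.linear_for _ _ |- _ => refine (lin_comp H _)
  | H : forall _ _ _, _ |- _ => refine (lin_comp (H _ _ _) _)
  | H : forall _ _, _ |- _ => refine (lin_comp (H _ _) _)
  | H : forall _, _ |- _ => refine (lin_comp (H _) _)
  | H : bilin _ |- _ => refine (lin_comp (proj1 H _) _)
  | H : bilin _ |- _ => refine (lin_comp (proj2 H _) _)
  end.
Ltac lin1 := match goal with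
  | |- GRing.linear_for _ (fun x => x) => exact (@lin_id _ _)
  | |- GRing.linear_for _ (fun x => @?a x + @?b x) => refine (@lin_addf _ _ _ a b _ _)
  | |- GRing.linear_for _ (fun x => - @?a x) => refine (@lin_oppf _ _ _ a _)
  | |- GRing.linear_for _ (fun x => ?a * @?b x) => refine (@lin_mull _ _ _ b a _)
  | |- GRing.linear_for _ (fun x => @?b x * ?a) => refine (@lin_mulr _ _ _ b a _)
  | |- GRing.linear_for _ (fun x => tens (@?a x) ?v) => refine (@lin_tensl _ _ _ a v _)
  | |- GRing.linear_for _ (fun x => tens ?a (@?v x)) => refine (@lin_tensr _ _ _ v a _)
  | |- GRing.linear_for _ (fun x => sweedler ?f (@?e x)) =>
      refine (@lin_swt _ _ _ f e _ _); [split=> ?|]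
  | |- GRing.linear_for _ (fun x => sweedler (@?f x) ?a) =>
      refine (@lin_swf _ _ _ f a _) => ? ?
  | |- GRing.linear_for _ (fun x => tlift ?f (@?e x)) =>
      refine (@lin_tliftt _ _ _ _ f e _ _); [split=> ?|]
  | |- GRing.linear_for _ (fun x => tlift (@?f x) ?a) =>
      refine (@lin_tliftf _ _ _ _ f a _) => ? ?
  | |- GRing.linear_for _ (fun x => ?a *: @?f x) => refine (@lin_scalef _ _ _ f a _)
  | |- GRing.linear_for _ (fun x => @?f x *: ?v) => refine (@lin_scalel _ _ _ f v _)
  | |- GRing.linear_for _ (fun x => antipode (@?f x)) => refine (@lin_comp _ _ _ _ _ f (@antipode_lin _) _)
  | |- GRing.linear_for _ (fun x => counit (@?f x)) => refine (@lin_comp _ _ _ _ _ f (@counit_lin _) _)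
  | |- GRing.linear_for _ (fun x => Delta (@?f x)) => refine (@lin_comp _ _ _ _ _ f (@Delta_lin _) _)
  | |- GRing.linear_for _ (fun x => _) => first [lin_leaf | lin_extra]
  | |- GRing.linear_for ?s ?f => change (GRing.linear_for s (fun x => f x))
  end.
Ltac lin := cbv beta; repeat (lin1; cbv beta).
Ltac bil := split=> ?; lin.

Section SweedlerGen.
Variable K : qField.
Local Notation F := (qbase K).
Local Notation A := (Cq K).
Local Notation X := (genX K).
Local Notation g := (geng K).
Local Notation gV := (gengV K).
Local Notation XG := (XG K).
Implicit Types U V W : lmodType F.

Lemma tens11 : tens (1 : A) (1 : A) = 1 :> pbw A.
Proof. exact: tens_XG. Qed.

Lemma tlift_mul V (f : A -> A -> V) (t u : pbw A) : bilin f ->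
  tlift f (t * u) = tlift (fun a1 a2 => tlift (fun b1 b2 => f (a1 * b1) (a2 * b2)) u) t.
Proof.
move=> fb; elim/pbw_tens_ind: t => [t t' IH IH'|n s v].
  rewrite mulrDl (linD (tlift_lin fb)) IH IH' -(linD (tlift_lin _)) //; bil.
rewrite (tlift_tensE (f := fun a1 a2 => _)); last bil.
elim/pbw_tens_ind: u => [u u' IH IH'|m r w].
  rewrite mulrDr (linD (tlift_lin fb)) IH IH' -(linD (tlift_lin _)) //; bil.
by rewrite tens_mul !tlift_tensE; try bil.
Qed.

Lemma sw_mul V (f : A -> A -> V) a b : bilin f -> sweedler f (a * b) =
  sweedler (fun a1 a2 => sweedler (fun b1 b2 => f (a1 * b1) (a2 * b2)) b) a.
Proof.
by move=> fb; rewrite /sweedler; have [_ _ -> _] := Delta_morph K; rewrite tlift_mul.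
Qed.
Lemma sw_1 V (f : A -> A -> V) : bilin f -> sweedler f 1 = f 1 1.
Proof.
by move=> fb; rewrite /sweedler; have [_ _ _ ->] := Delta_morph K; rewrite -tens11 tlift_tensE.
Qed.
Lemma DeltaX : Delta X = tens X 1 + tens g X.
Proof. by have [] := alg_lift_gen (tens X 1 + tens g X) (tens g g) (tens gV gV). Qed.
Lemma tens_zpow s : zpow (tens g g) (tens gV gV) s = tens (XG 0 s) (XG 0 s).
Proof.
have E (a : A) n : (tens a a) ^+ n = tens (a ^+ n) (a ^+ n) :> pbw A.
  by elim: n => [|n IH]; rewrite ?expr0 ?tens11 // !exprS IH tens_mul.
by rewrite XGE mul1r; case: s => n; rewrite /= E.
Qed.
Lemma sw_XG0 V (f : A -> A -> V) s : bilin f -> sweedler f (XG 0 s) = f (XG 0 s) (XG 0 s).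
Proof.
move=> fb; rewrite /sweedler /Delta {1}/Defs.XG alg_lift_mono scale1r /= mul1r tens_zpow.
exact: tlift_tensE.
Qed.
Lemma sw_grp V (f : A -> A -> V) s a : bilin f ->
  sweedler f (XG 0 s * a) = sweedler (fun a1 a2 => f (XG 0 s * a1) (XG 0 s * a2)) a.
Proof. by move=> fb; rewrite sw_mul // sw_XG0 //; bil. Qed.
Lemma sw_g V (f : A -> A -> V) a : bilin f ->
  sweedler f (g * a) = sweedler (fun a1 a2 => f (g * a1) (g * a2)) a.
Proof. exact: sw_grp. Qed.
Lemma sw_X V (f : A -> A -> V) a : bilin f ->
  sweedler f (X * a) = sweedler (fun a1 a2 => f (X * a1) a2 + f (g * a1) (X * a2)) a.
Proof.
move=> fb; rewrite sw_mul // {1}/sweedler; rewrite DeltaX (linD (tlift_lin _)) //; last bil.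
rewrite !tlift_tensE; try bil.
by rewrite sw_add; congr (_ + _); apply: eq_sw => *; rewrite mul1r.
Qed.

(** Induction on v through A_gen_ind. Letting f vary is essential: multiplying v by X
    or by a group-like turns the statement for f into the one for a translate of f.
    The same scheme proves the counit and antipode axioms. *)
Lemma sw_coassoc V (f : A -> A -> A -> V) v :
    (forall b c, linear (fun a => f a b c)) -> (forall a c, linear (fun b => f a b c)) ->
    (forall a b, linear (fun c => f a b c)) ->
  sweedler (fun x c => sweedler (fun a b => f a b c) x) v =
  sweedler (fun a y => sweedler (fun b c => f a b c) y) v.
Proof.
elim/A_gen_ind: v f => [v v' IH IH'|k v IH||v IH|t v IH] f f1 f2 f3.
- rewrite !(linD (sw_lin _)) ?IH ?IH' //; bil.
- rewrite !(linZ (sw_lin _)) ?IH //; bil.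
- rewrite !sw_1 //; bil.
- rewrite !sw_X; try bil.
  transitivity (sweedler (fun x c => sweedler (fun a b => f (X * a) b c
      + f (g * a) (X * b) c + f (g * a) (g * b) (X * c)) x) v).
    by apply: eq_sw => x c; rewrite sw_X ?sw_g ?sw_add //; bil.
  rewrite IH; try by move=> *; lin.
  apply: eq_sw => a y; rewrite sw_X; last bil.
  by rewrite -sw_add; apply: eq_sw => b c; rewrite addrA.
- rewrite !sw_grp; try bil.
  transitivity (sweedler (fun x c => sweedler (fun a b =>
    f (XG 0 t * a) (XG 0 t * b) (XG 0 t * c)) x) v).
    by apply: eq_sw => x c; rewrite sw_grp //; bil.
  rewrite IH; try by move=> *; lin.
  by apply: eq_sw => a y; rewrite sw_grp //; bil.
Qed.

Lemma counitM (a b : A) : counit (a * b) = counit a * counit b.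
Proof. by have [_ _ M _] := counit_morph K; exact: M. Qed.
Lemma counit1 : counit (1 : A) = 1.
Proof. by have [_ _ _ M] := counit_morph K; exact: M. Qed.
Lemma counitZ c (a : A) : counit (c *: a) = c * counit a.
Proof. by have [_ Z _ _] := counit_morph K; exact: Z. Qed.
Lemma counitD (a b : A) : counit (a + b) = counit a + counit b.
Proof. by have [D _ _ _] := counit_morph K; exact: D. Qed.
Lemma counitB (a b : A) : counit (a - b) = counit a - counit b.
Proof. exact: (linB (@counit_lin K)). Qed.
Lemma counitX : counit X = 0.
Proof. by have [] := @alg_lift_gen K (F^o : algType F) 0 1 1. Qed.
Lemma counit_XG0 s : counit (XG 0 s) = 1.
Proof.
rewrite /counit /Defs.XG alg_lift_mono scale1r /= mul1r.
by case: s => n; rewrite /= expr1n.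
Qed.
Lemma counitg : counit g = 1. Proof. exact: counit_XG0. Qed.

Lemma sw_counitl V (f : A -> V) a : linear f ->
  sweedler (fun a1 a2 => counit a1 *: f a2) a = f a.
Proof.
move=> fl; elim/A_gen_ind: a f fl => [v v' IH IH'|k v IH||v IH|t v IH] f fl.
- rewrite !(linD (sw_lin _)) ?IH ?IH' // ?(linD fl) //; bil.
- rewrite !(linZ (sw_lin _)) ?IH // ?(linZ fl) //; bil.
- rewrite sw_1 ?counit1 ?scale1r //; bil.
- rewrite sw_X; last bil.
  rewrite -(IH (fun x => f (X * x))); last by lin.
  by apply: eq_sw => *; rewrite !counitM counitX counitg mul0r scale0r add0r mul1r.
- rewrite sw_grp; last bil.
  rewrite -(IH (fun x => f (XG 0 t * x))); last by lin.
  by apply: eq_sw => *; rewrite !counitM counit_XG0 mul1r.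
Qed.
Lemma sw_counitr V (f : A -> V) a : linear f ->
  sweedler (fun a1 a2 => counit a2 *: f a1) a = f a.
Proof.
move=> fl; elim/A_gen_ind: a f fl => [v v' IH IH'|k v IH||v IH|t v IH] f fl.
- rewrite !(linD (sw_lin _)) ?IH ?IH' // ?(linD fl) //; bil.
- rewrite !(linZ (sw_lin _)) ?IH // ?(linZ fl) //; bil.
- rewrite sw_1 ?counit1 ?scale1r //; bil.
- rewrite sw_X; last bil.
  rewrite -(IH (fun x => f (X * x))); last by lin.
  by apply: eq_sw => *; rewrite !counitM counitX mul0r scale0r addr0.
- rewrite sw_grp; last bil.
  rewrite -(IH (fun x => f (XG 0 t * x))); last by lin.
  by apply: eq_sw => *; rewrite !counitM counit_XG0 mul1r.
Qed.

End SweedlerGen.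

Section Exchange.
Variable K : qField.
Local Notation A := (Cq K).
Local Notation F := (qbase K).
Implicit Types U V W : lmodType F.
Lemma tlift_sw V W (f : A -> V -> A -> A -> W) t a :
  tlift (fun x v => sweedler (f x v) a) t = sweedler (fun a1 a2 => tlift (fun x v => f x v a1 a2) t) a.
Proof.
have [s sE] := sw_sum (fun a b : A => a) a; rewrite sE tliftE.
under eq_bigr do rewrite sE.
by rewrite exchange_big; apply: eq_bigr => p _; rewrite tliftE.
Qed.
Lemma sw_exchange W (f : A -> A -> A -> A -> W) a b :
  sweedler (fun a1 a2 => sweedler (f a1 a2) b) a =
  sweedler (fun b1 b2 => sweedler (fun a1 a2 => f a1 a2 b1 b2) a) b.
Proof. exact: tlift_sw. Qed.
Lemma tlift_opp V W (f : A -> V -> W) t : tlift (fun a v => - f a v) t = - tlift f t.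
Proof. by rewrite !tliftE sumrN. Qed.
Lemma sw_opp V (f : A -> A -> V) a : sweedler (fun a v => - f a v) a = - sweedler f a.
Proof. exact: tlift_opp. Qed.
Lemma coef_tlift_scale (h : A -> F) (t : pbw A) i : linear (h : A -> F^o) ->
  coef (tlift (fun u c => h c *: u) t) i = h (coef t i).
Proof.
move=> hl.
elim/pbw_tens_ind: t => [t u IH IH'|n s w].
  rewrite (linD (tlift_lin _)); last bil.
  by rewrite !Defs.coefD (linD hl) IH IH'.
rewrite tlift_tensE; last bil.
rewrite coef_tens pcoefZ coef_XG; case: eqP => _; first by rewrite mulr1n; exact: mulr1.
by rewrite !mulr0n (lin0 hl); exact: mulr0.
Qed.
End Exchange.

(** * The antipode *)

Section Antipode.
Variable K : qField.
Local Notation F := (qbase K).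
Local Notation q := (qparam K).
Local Notation A := (Cq K).
Local Notation X := (genX K).
Local Notation g := (geng K).
Local Notation gV := (gengV K).
Local Notation XG := (XG K).
Implicit Types U V W : lmodType F.

(** This is S X; it q-commutes with g, which yields antipodeM. *)
Definition antX : A := - (gV * X).
Local Notation Y := antX.

Lemma antipode_XG n s : antipode (XG n s) = zpow gV g s * Y ^+ n.
Proof. by rewrite /antipode /Defs.XG mext_mono ?scale1r // => i; rewrite scale0r. Qed.

Lemma zpow_antipode s : zpow gV g s = XG 0 (- s).
Proof.
elim: s => [|n IH|n IH] //.
  rewrite -addn1 PoszD (zpowS (gVE K)) IH opprD /gengV XG_mul.
  by rewrite mulr0 oppr0 scale1r add0n.
rewrite -addn1 PoszD opprD (zpowD (gVgE K) (gVE K)) IH /= expr1.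
by rewrite /geng XG_mul mulr0 oppr0 scale1r add0n !opprD !opprK.
Qed.

Lemma qV (s t : int) : q ^ s * q ^ t = q ^ (s + t).
Proof. by rewrite expfzDr ?qparam_neq0. Qed.

Lemma antX_XG : Y = - q *: XG 1 (-1).
Proof. by rewrite /antX /gengV /genX XG_mul /= scaleNr mulr1 opprK expr1z. Qed.

Lemma antX_comm s : Y * XG 0 s = q ^ s *: (XG 0 s * Y).
Proof.
rewrite antX_XG -scalerAl -scalerAr !XG_mul !scalerA addnC addrC; congr (_ *: _).
by rewrite ?mulr0 ?mulr1 ?oppr0 ?expr0z ?mulr1 mulrAC qV subrr expr0z mul1r.
Qed.

Lemma antipode1 : antipode 1 = 1 :> A.
Proof. by rewrite -(XG01 K) antipode_XG mulr1. Qed.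
Lemma antX_expcomm n s : Y ^+ n * XG 0 s = q ^ (s * n%:Z) *: (XG 0 s * Y ^+ n).
Proof.
elim: n => [|n IH]; first by rewrite mulr0 scale1r mul1r mulr1.
rewrite exprSr -mulrA antX_comm -scalerAr [in LHS]mulrA IH -scalerAl scalerA -mulrA.
by congr (_ *: _); rewrite qV; congr (q ^ _); lia.
Qed.
Lemma antipode_X a : antipode (X * a) = antipode a * Y.
Proof.
apply: (A_ext (f := fun a => antipode (X * a)) (h := fun a => antipode a * Y)) a; try lin.
by move=> n s; rewrite -XGS !antipode_XG exprSr mulrA.
Qed.
Lemma antipode_grp a s : antipode (XG 0 s * a) = antipode a * XG 0 (- s).
Proof.
apply: (A_ext (f := fun a => antipode (_ * a)) (h := fun a => antipode a * _)) a; try lin.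
move=> n t; rewrite XG_mul (linZ (@antipode_lin K)) !antipode_XG !zpow_antipode -mulrA.
rewrite antX_expcomm -scalerAr mulNr mulrA XG_mul mulr0 oppr0 expr0z scale1r.
by rewrite add0n opprD addrC.
Qed.
Lemma antipode_g a : antipode (g * a) = antipode a * gV.
Proof. exact: antipode_grp. Qed.
Lemma antipodeM a b : antipode (a * b) = antipode b * antipode a :> A.
Proof.
elim/A_gen_ind: a => [v v' IH IH'|k v IH||v IH|t v IH].
- by rewrite mulrDl !(linD (@antipode_lin K)) IH IH' mulrDr.
- by rewrite -scalerAl !(linZ (@antipode_lin K)) IH scalerAr.
- by rewrite mul1r antipode1 mulr1.
- by rewrite -mulrA !antipode_X IH mulrA.
- by rewrite -mulrA !antipode_grp IH mulrA.
Qed.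

Lemma gY : g * Y = - X.
Proof. by rewrite /antX mulrN mulrA gVE mul1r. Qed.

Lemma sw_antipoder V (f : A -> V) a : linear f ->
  sweedler (fun a1 a2 => f (a1 * antipode a2)) a = counit a *: f 1.
Proof.
move=> fl; elim/A_gen_ind: a f fl => [v v' IH IH'|k v IH||v IH|t v IH] f fl.
- rewrite !(linD (sw_lin _)) ?IH ?IH' // ?counitD ?scalerDl //; bil.
- rewrite !(linZ (sw_lin _)) ?IH // ?counitZ ?scalerA //; bil.
- rewrite sw_1 ?antipode1 ?counit1 ?mulr1 ?scale1r //; bil.
- rewrite sw_X; last bil.
  rewrite sw_add (eq_sw (h := fun a1 a2 => f (X * (a1 * antipode a2)))); last first.
    by move=> *; rewrite mulrA.
  rewrite (IH (fun x => f (X * x))); last by lin.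
  rewrite (eq_sw (h := fun a1 a2 => f (g * (a1 * antipode a2) * Y))); last first.
    by move=> *; rewrite antipode_X !mulrA.
  rewrite (IH (fun x => f (g * x * Y))); last by lin.
  by rewrite !mulr1 -scalerDr -(linD fl) gY subrr (lin0 fl) counitM counitX mul0r scaler0 scale0r.
- rewrite sw_grp; last bil.
  rewrite (eq_sw (h := fun a1 a2 => f (XG 0 t * (a1 * antipode a2) * XG 0 (- t)))); last first.
    by move=> *; rewrite antipode_grp !mulrA.
  rewrite (IH (fun x => f (XG 0 t * x * XG 0 (- t)))); last by lin.
  by rewrite mulr1 XG0V counitM counit_XG0 mul1r.
Qed.

Lemma sw_antipodel V (f : A -> V) a : linear f ->
  sweedler (fun a1 a2 => f (antipode a1 * a2)) a = counit a *: f 1.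
Proof.
move=> fl; elim/A_gen_ind: a => [v v' IH IH'|k v IH||v IH|t v IH].
- rewrite !(linD (sw_lin _)) ?IH ?IH' // ?counitD ?scalerDl //; bil.
- rewrite !(linZ (sw_lin _)) ?IH // ?counitZ ?scalerA //; bil.
- rewrite sw_1 ?antipode1 ?counit1 ?mulr1 ?scale1r //; bil.
- rewrite sw_X; last bil.
  rewrite counitM counitX mul0r scale0r.
  have [s sE] := sw_sum (fun a b : A => a) v; rewrite sE big1 // => p _.
  rewrite -(linD fl) antipode_X antipode_g -(mulrA _ gV) (mulrA gV).
  by rewrite /antX mulrN mulNr !mulrA addNr (lin0 fl).
- rewrite sw_grp; last bil.
  rewrite counitM counit_XG0 mul1r -IH; apply: eq_sw => a1 a2.
  by rewrite antipode_grp -(mulrA _ (XG 0 (- t))) (mulrA (XG 0 (- t))) XG0Vl mul1r.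
Qed.

Lemma sw_antipode V (f : A -> A -> V) a : bilin f ->
  sweedler f (antipode a) = sweedler (fun a1 a2 => f (antipode a2) (antipode a1)) a.
Proof.
move=> fb; elim/A_gen_ind: a f fb => [v v' IH IH'|k v IH||v IH|t v IH] f fb.
- rewrite (linD (@antipode_lin K)) !(linD (sw_lin _)) ?IH ?IH' //; bil.
- rewrite (linZ (@antipode_lin K)) !(linZ (sw_lin _)) ?IH //; bil.
- rewrite antipode1 !sw_1 ?antipode1 //; bil.
- rewrite antipode_X sw_mul // sw_X; last bil.
  transitivity (sweedler (fun a1 a2 => f (a1 * Y) (a2 * gV) + f a1 (a2 * Y)) (antipode v)).
    apply: eq_sw => a1 a2; rewrite /antX -mulrN -[- X]scaleN1r -scalerAr.
    rewrite (linZ (sw_lin _)); last bil.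
    rewrite sw_grp; last bil.
    rewrite -[X]mulr1 sw_X; last bil.
    rewrite sw_1; last bil.
    rewrite !mulr1 scaleN1r opprD gVgE mulr1 !scaleN1r !mulrN.
    by rewrite (linN (proj1 fb _)) (linN (proj2 fb _)).
  rewrite IH; last bil.
  apply: eq_sw => a1 a2; rewrite !antipode_X antipode_g; exact: addrC.
- rewrite antipode_grp sw_mul // sw_grp; last bil.
  transitivity (sweedler (fun a1 a2 => f (a1 * XG 0 (- t)) (a2 * XG 0 (- t))) (antipode v)).
    by apply: eq_sw => a1 a2; rewrite sw_XG0 //; bil.
  rewrite IH; last bil.
  by apply: eq_sw => a1 a2; rewrite !antipode_grp.
Qed.
End Antipode.

(** * The coadjoint coaction *)

Section Coad.
Variable K : qField.
Local Notation F := (qbase K).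
Local Notation A := (Cq K).
Local Notation X := (genX K).
Local Notation g := (geng K).
Local Notation gV := (gengV K).
Local Notation XG := (XG K).
Implicit Types U V W : lmodType F.

Lemma coadL_lin : linear (@coadL K).
Proof. rewrite /coadL; lin. Qed.

Lemma tlift_coadL V (f : A -> A -> V) v : bilin f -> tlift f (coadL v) =
  sweedler (fun w v3 => sweedler (fun v1 v2 => f (v1 * antipode v3) v2) w) v.
Proof.
move=> fb; rewrite /coadL (lin_sw _ _ (tlift_lin fb)); apply: eq_sw => w v3.
rewrite (lin_sw _ _ (tlift_lin fb)); apply: eq_sw => v1 v2.
by rewrite tlift_tensE.
Qed.

(** The three terms of Delta^2 X = X (x) 1 (x) 1 + g (x) X (x) 1 + g (x) g (x) X, the
    last one with S X = - g^-1 X. *)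
Lemma coadL_X V (f : A -> A -> V) v : bilin f -> tlift f (coadL (X * v)) =
  tlift (fun u c => f (X * u) c + f (g * u) (X * c) - f (g * u * gV * X) (g * c)) (coadL v).
Proof.
move=> fb; rewrite !tlift_coadL //; last bil.
rewrite sw_X; last bil.
apply: eq_sw => w v3; rewrite sw_X; last bil.
rewrite sw_g; last bil.
rewrite -sw_add; apply: eq_sw => v1 v2; rewrite antipode_X !mulrA.
by congr (_ + _); rewrite /antX mulrN mulrA (linN (proj1 fb _)).
Qed.

Lemma coadL_grp V (f : A -> A -> V) s v : bilin f -> tlift f (coadL (XG 0 s * v)) =
  tlift (fun u c => f (XG 0 s * u * XG 0 (- s)) (XG 0 s * c)) (coadL v).
Proof.
move=> fb; rewrite !tlift_coadL //; last bil.
rewrite sw_grp; last bil.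
apply: eq_sw => w v3; rewrite sw_grp; last bil.
by apply: eq_sw => v1 v2; rewrite antipode_grp !mulrA.
Qed.
Lemma coadL_g V (f : A -> A -> V) v : bilin f -> tlift f (coadL (g * v)) =
  tlift (fun u c => f (g * u * gV) (g * c)) (coadL v).
Proof. exact: coadL_grp. Qed.
Lemma coadL_1 V (f : A -> A -> V) : bilin f -> tlift f (coadL 1) = f 1 1.
Proof.
move=> fb; rewrite !tlift_coadL // sw_1; last bil.
by rewrite sw_1 ?antipode1 ?mulr1 //; bil.
Qed.

(** v_(1) g^s S(v_(3) g^s) = v_(1) S v_(3). *)
Lemma coadL_r V (f : A -> A -> V) v s : bilin f -> tlift f (coadL (v * XG 0 s)) =
  tlift (fun u c => f u (c * XG 0 s)) (coadL v).
Proof.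
move=> fb; rewrite !tlift_coadL //; last bil.
rewrite sw_mul; last bil.
apply: eq_sw => w v3; rewrite sw_XG0; last bil.
rewrite sw_mul; last bil.
apply: eq_sw => v1 v2; rewrite sw_XG0; last bil.
have E : antipode (XG 0 s) = XG 0 (- s) by rewrite antipode_XG zpow_antipode mulr1.
rewrite antipodeM E.
by rewrite mulrA -(mulrA v1) XG_mul mulr0 oppr0 expr0z scale1r subrr XG01 mulr1.
Qed.

(** Needed for the left coaction, where the left action on classes brings in corrections
    by multiples of eps of the second leg of Ad_L. *)
Lemma coadL_counit V (f : A -> V) v : linear f ->
  tlift (fun u c => counit c *: f u) (coadL v) = counit v *: f 1.
Proof.
elim/A_gen_ind: v f => [v v' IH IH'|k v IH||v IH|t v IH] f fl.
- rewrite (linD coadL_lin) !(linD (tlift_lin _)) ?IH ?IH' // ?counitD ?scalerDl //; bil.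
- rewrite (linZ coadL_lin) !(linZ (tlift_lin _)) ?IH // ?counitZ ?scalerA //; bil.
- rewrite coadL_1 //; bil.
- rewrite coadL_X; last bil.
  rewrite (eq_tlift (h := fun u c => counit c *: (f (X * u) - f (g * u * gV * X)))); last first.
    by move=> u c; rewrite !counitM counitX counitg !mul0r scale0r addr0 mul1r scalerBr.
  rewrite (IH (fun u => f (X * u) - f (g * u * gV * X))); last by lin.
  by rewrite !mulr1 gVE mul1r subrr scaler0 counitM counitX mul0r scale0r.
- rewrite coadL_grp; last bil.
  rewrite (eq_tlift (h := fun u c => counit c *: (f (XG 0 t * u * XG 0 (- t))))); last first.
    by move=> u c; rewrite !counitM counit_XG0 mul1r.
  rewrite (IH (fun u => f (XG 0 t * u * XG 0 (- t)))); last by lin.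
  by rewrite !mulr1 XG0V counitM counit_XG0 mul1r.
Qed.

(** The antipode in Ad_L is undone by the next Sweedler leg:
    b_(1) S b_(3) b_(4) (x) b_(2) (x) b_(5) = b_(1) (x) b_(2) (x) b_(3). This is
    what makes the coaction deltaL below send db to b_(1) (x) db_(2). *)
Lemma coadL_sw V (f : A -> A -> A -> V) b :
    (forall b c, linear (fun a => f a b c)) -> (forall a c, linear (fun b => f a b c)) ->
    (forall a b, linear (fun c => f a b c)) ->
  sweedler (fun b1 b2 => tlift (fun u c =>
    sweedler (fun b3 b4 => f (u * b3) c b4) b2) (coadL b1)) b =
  sweedler (fun b1 y => sweedler (fun b2 b3 => f b1 b2 b3) y) b.
Proof.
have cl := coadL_lin.
elim/A_gen_ind: b f => [v v' IH IH'|k v IH||v IH|t v IH] f f1 f2 f3.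
- rewrite !(linD (sw_lin _)) ?IH ?IH' //; bil.
- rewrite !(linZ (sw_lin _)) ?IH //; bil.
- rewrite !sw_1; try bil.
  by rewrite coadL_1 ?sw_1 ?mulr1 //; bil.
- rewrite !sw_X; try bil.
  transitivity (sweedler (fun b1 y => sweedler (fun b2 b3 => f (X * b1) b2 b3
     + f (g * b1) (X * b2) b3 + f (g * b1) (g * b2) (X * b3)) y) v); last first.
    apply: eq_sw => a y; rewrite sw_X; last bil.
    by rewrite -sw_add; apply: eq_sw => b c; rewrite addrA.
  rewrite -IH; try by move=> *; lin.
  apply: eq_sw => b1 b2; rewrite coadL_X; last bil.
  rewrite coadL_g; last bil.
  rewrite -tlift_add; apply: eq_tlift => u c; rewrite sw_X; last bil.
  rewrite -sw_opp -!sw_add; apply: eq_sw => b3 b4.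
  rewrite !mulrA -[g * u * gV * g]mulrA gVgE mulr1.
  by rewrite !addrA addrNK.
- rewrite !sw_grp; try bil.
  transitivity (sweedler (fun b1 y => sweedler (fun b2 b3 =>
    f (XG 0 t * b1) (XG 0 t * b2) (XG 0 t * b3)) y) v); last first.
    by apply: eq_sw => a y; rewrite sw_grp; last bil.
  rewrite -IH; try by move=> *; lin.
  apply: eq_sw => b1 b2; rewrite coadL_grp; last bil.
  apply: eq_tlift => u c; rewrite sw_grp; last bil.
  by apply: eq_sw => b3 b4; rewrite mulrA -(mulrA _ (XG 0 (- t))) XG0Vl mulr1 mulrA.
Qed.
End Coad.

(** * The quotient ker eps / M *)

Section Rho.
Variable K : qField.
Local Notation F := (qbase K).
Local Notation A := (Cq K).
Variable M : subspace A.

(** Extending the projection of ker eps by a |-> [a - eps a] to all of A spares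
    the subtype: rho is linear on A, and d a = rho a_(1) (x) a_(2). *)
Definition rho (a : A) : kerQ M := ker_pi M (ker_proj a).
Definition kval (v : kerQ M) : A := kerE_val (lrepr v).

Lemma ker_pi_lin : linear (@ker_pi K M).
Proof.
move=> c u v; rewrite /ker_pi lpiD; congr (_ + _); exact: lpiZ.
Qed.
Lemma kerE_counit (v : kerE K) : counit (kerE_val v) = 0.
Proof. by case: v => a /= /eqP. Qed.
Lemma ker_pi_rho (v : kerE K) : ker_pi M v = rho (kerE_val v).
Proof.
rewrite /rho; congr ker_pi; apply: val_inj => /=.
by rewrite kerE_counit scale0r subr0.
Qed.
Lemma rho_lin : linear rho.
Proof.
apply: (lin_comp ker_pi_lin) => c u v; apply: val_inj => /=.
change (c *: u + v - (counit (c *: u + v))%:A =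
  c *: (u - (counit u)%:A) + (v - (counit v)%:A)).
by rewrite counitD counitZ scalerDl -scalerA opprD scalerBr addrACA.
Qed.
Lemma rhoE a : (rho a == 0) = (a - (counit a)%:A \in M).
Proof.
have -> : 0 = ker_pi M 0 by rewrite (lin0 ker_pi_lin).
by rewrite /rho /ker_pi lpi_eq subr0.
Qed.
Lemma rho_eq0 a : counit a = 0 -> (rho a == 0) = (a \in M).
Proof. by move=> a0; rewrite rhoE a0 scale0r subr0. Qed.
Lemma rho_eqB a b : counit a = counit b -> (rho a == rho b) = (a - b \in M).
Proof.
move=> ab; rewrite -subr_eq0 -(linB rho_lin) rho_eq0 //.
by rewrite counitB ab subrr.
Qed.
Lemma rho_kval v : rho (kval v) = v.
Proof. by rewrite /kval -ker_pi_rho; exact: lreprK. Qed.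
Lemma counit_kval v : counit (kval v) = 0.
Proof. exact: kerE_counit. Qed.
Lemma rho1 : rho 1 = 0.
Proof. by apply/eqP; rewrite rhoE counit1 scale1r subrr sub0. Qed.
Lemma rho_counit a : rho a = rho (a - (counit a)%:A).
Proof. by rewrite (linB rho_lin) (linZ rho_lin) rho1 scaler0 subr0. Qed.
Lemma rho_kvalB c : counit c = 0 -> kval (rho c) - c \in M.
Proof. by move=> c0; rewrite -rho_eqB ?rho_kval // counit_kval c0. Qed.
Lemma rhoP v : exists2 c, counit c = 0 & v = rho c.
Proof. by exists (kval v); rewrite ?rho_kval ?counit_kval. Qed.

Lemma kerQ_tens_ind (P : pbw (kerQ M) -> Prop) :
  (forall a b, P a -> P b -> P (a + b)) ->
  (forall b c, counit c = 0 -> P (tens b (rho c))) -> forall t, P t.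
Proof.
move=> PD PT; elim/pbw_tens_ind => // n s v.
by have [c c0 ->] := rhoP v; exact: PT.
Qed.
Lemma kerQ_ext (W : lmodType F) (f h : pbw (kerQ M) -> W) : linear f -> linear h ->
  (forall b c, counit c = 0 -> f (tens b (rho c)) = h (tens b (rho c))) -> f =1 h.
Proof.
move=> fl hl E; elim/kerQ_tens_ind => [a b IH IH'|]; last exact: E.
by rewrite (linD fl) (linD hl) IH IH'.
Qed.
End Rho.

Ltac lin_extra ::= match goal with
  | |- GRing.linear_for _ (fun x => rho ?M (@?f x)) =>
     refine (@lin_comp _ _ _ _ _ f (@rho_lin _ M) _)
  end.

(** * The first order calculus of a crossed submodule *)

Section Generated.
Variable K : qField.
Local Notation A := (Cq K).
Variable G : calculus K.
Definition generated (w : G) := exists s, w = adb G s.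
Lemma generated0 : generated 0.
Proof. by exists [::]; rewrite /adb big_nil. Qed.
Lemma generatedD v w : generated v -> generated w -> generated (v + w).
Proof. by move=> [s ->] [t ->]; exists (s ++ t); rewrite /adb big_cat. Qed.
Lemma generated1 a b : generated (lact a (dif G b)).
Proof. by exists [:: (a, b)]; rewrite /adb big_seq1. Qed.
Lemma generated_sum I (r : seq I) (P : pred I) (E : I -> G) :
  (forall i, P i -> generated (E i)) -> generated (\sum_(i <- r | P i) E i).
Proof.
move=> h; elim/big_rec: _ => [|i x Pi xN]; first exact: generated0.
exact: generatedD (h i Pi) xN.
Qed.
Lemma generated_sw (f : A -> A -> G) a :
  (forall a1 a2, generated (f a1 a2)) -> generated (sweedler f a).
Proof. by move=> h; have [s ->] := sw_sum f a; apply: generated_sum. Qed.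
End Generated.

Section CalculusOfM.
Variable K : qField.
Local Notation A := (Cq K).
Variable M : subspace A.
Hypothesis crM : crossed_submodule M.
Local Notation Q := (kerQ M).
Local Notation rho := (rho M).
Local Notation G := (calculus_of M).

Let idM a v : v \in M -> a * v \in M.
Proof. by case: crM => _ + _; apply. Qed.

Lemma ker_pi_mul a (v : Q) : ker_pi M (ker_mul a (lrepr v)) = rho (a * kval v).
Proof. exact: ker_pi_rho. Qed.

(** The action of A on ker eps / M is defined through chosen representatives; M being
    a left ideal makes it independent of the choice. *)
Lemma rho_mul a c : counit c = 0 -> rho (a * kval (rho c)) = rho (a * c).
Proof.
move=> c0; apply/eqP; rewrite rho_eqB; last by rewrite !counitM counit_kval c0.
by rewrite -mulrBr; apply: idM; exact: rho_kvalB.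
Qed.

Lemma kmul_lin a : linear (fun v : Q => rho (a * kval v)).
Proof.
move=> k v w; have [c c0 ->] := rhoP v; have [d d0 ->] := rhoP w.
rewrite -[k *: rho c + rho d](rho_lin M) !rho_mul // ?counitD ?counitZ ?c0 ?d0 ?mulr0 ?addr0 //.
by rewrite mulrDr -scalerAr rho_lin.
Qed.

Lemma lact_def a (w : G) : lact a w = tlift (fun b v => sweedler (fun a1 a2 =>
    tens (a2 * b) (rho (a1 * kval v))) a) w.
Proof. by apply: eq_tlift => b' v; apply: eq_sw => *; rewrite ker_pi_mul. Qed.

Lemma lactE a b c : counit c = 0 ->
  lact (c := G) a (tens b (rho c)) = sweedler (fun a1 a2 => tens (a2 * b) (rho (a1 * c))) a.
Proof.
move=> c0; rewrite lact_def tlift_tensE; first by apply: eq_sw => *; rewrite rho_mul.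
have kl := kmul_lin; bil.
Qed.
Lemma lactE' a b c :
  lact (c := G) a (tens b (rho c)) =
  sweedler (fun a1 a2 => tens (a2 * b) (rho (a1 * (c - (counit c)%:A)))) a.
Proof. by rewrite rho_counit lactE // counitB counitZ counit1 mulr1 subrr. Qed.

Lemma lact_linl (w : G) : linear (fun a => lact a w : pbw Q).
Proof.
move=> k a b; rewrite !lact_def.
pose f a b (v : Q) := sweedler (fun a1 a2 => tens (a2 * b) (rho (a1 * kval v))) a.
by apply: (@lin_tliftf _ _ _ _ f w) => c v; rewrite /f; lin.
Qed.
Lemma lact_linr a : linear (fun w : pbw Q => lact (c := G) a w : pbw Q).
Proof.
by move=> k v w; rewrite !lact_def; apply: tlift_lin; have kl := kmul_lin; bil.
Qed.
Lemma ractE b c (v : Q) : ract (c := G) (tens b v) c = tens (b * c) v.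
Proof. by rewrite /= /calc_ract tlift_tensE //; bil. Qed.
Lemma ract_linl c : linear (fun w : pbw Q => ract (c := G) w c : pbw Q).
Proof. rewrite /= /calc_ract; lin. Qed.
Lemma ract_linr (w : G) : linear (fun c => ract w c : pbw Q).
Proof. rewrite /= /calc_ract; lin. Qed.
Lemma difE a : dif G a = sweedler (fun a1 a2 => tens a2 (rho a1)) a.
Proof. by []. Qed.
Lemma dif_lin : linear (fun a => dif G a : pbw Q).
Proof. apply: (sw_lin (f := fun a1 a2 => tens a2 (rho a1))); bil. Qed.

Lemma calc_of_bimodule : is_bimodule G.
Proof.
split.
- by move=> c a b w; exact: lact_linl.
- by move=> c a v w; exact: lact_linr.
- apply: kerQ_ext => [| |b c c0]; [exact: lact_linr | exact: lin_id |].
  by rewrite lactE // sw_1 ?mul1r //; bil.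
- move=> a b; apply: kerQ_ext => [| |d c c0]; [exact: lact_linr | |].
    exact: (lin_comp (lact_linr a) (lact_linr b)).
  rewrite !lactE // (lin_sw _ _ (lact_linr a)) sw_mul; last bil.
  have [s sE] := sw_sum (fun a b : A => a) b; rewrite sE.
  rewrite (eq_sw (h := fun a1 a2 => \sum_(p <- s) tens (a2 * p.2 * d) (rho (a1 * p.1 * c)))).
    have [t tE] := sw_sum (fun a b : A => a) a; rewrite tE exchange_big.
    apply: eq_bigr => p _; cbv beta; rewrite lactE ?counitM ?c0 ?mulr0 //.
    by rewrite tE; apply: eq_bigr => r _; rewrite !mulrA.
  by move=> a1 a2; rewrite sE.
- by move=> c v w a; exact: ract_linl.
- by move=> c w a b; exact: ract_linr.
- apply: pbw_ext => [| |b v]; [exact: ract_linl | exact: lin_id |].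
  by rewrite ractE mulr1.
- move=> w a b; move: w; apply: pbw_ext => [| |c v]; first exact: ract_linl.
    exact: (lin_comp (ract_linl b) (ract_linl a)).
  by rewrite !ractE mulrA.
- move=> a w b; move: w; apply: kerQ_ext => [| |d c c0].
  + exact: (lin_comp (ract_linl b) (lact_linr a)).
  + exact: (lin_comp (lact_linr a) (ract_linl b)).
  rewrite ractE !lactE // (lin_sw _ _ (ract_linl b)); apply: eq_sw => a1 a2.
  by rewrite ractE mulrA.
Qed.

Lemma calc_of_leibniz a b : dif G (a * b) = ract (dif G a) b + lact a (dif G b).
Proof.
rewrite !difE sw_mul; last bil.
rewrite (lin_sw _ _ (ract_linl b)) (lin_sw _ _ (lact_linr a)).
transitivity (sweedler (fun a1 a2 => tens (a2 * b) (rho a1)) a +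
  sweedler (fun a1 a2 => sweedler (fun b1 b2 =>
     tens (a2 * b2) (rho (a1 * (b1 - (counit b1)%:A)))) b) a); last first.
  congr (_ + _); first by apply: eq_sw => a1 a2; rewrite ractE.
  have [s sE] := sw_sum (fun a b : A => a) b; rewrite sE.
  rewrite (eq_sw (h := fun a1 a2 => \sum_(p <- s)
     tens (a2 * p.2) (rho (a1 * (p.1 - (counit p.1)%:A))))); last by move=> *; rewrite sE.
  have [t tE] := sw_sum (fun a b : A => a) a; rewrite tE exchange_big.
  by apply: eq_bigr => p _; cbv beta; rewrite lactE' tE.
rewrite -sw_add; apply: eq_sw => a1 a2.
have E : tens (a2 * b) (rho a1) =
    sweedler (fun b1 b2 => counit b1 *: tens (a2 * b2) (rho a1)) b.
  by rewrite (sw_counitl (f := fun b2 => tens (a2 * b2) (rho a1))) //; lin.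
rewrite E -sw_add; apply: eq_sw => b1 b2.
rewrite mulrBr (linB (@rho_lin _ M)) (linB (tens_linr _)) -scalerAr mulr1.
by rewrite (linZ (@rho_lin _ M)) (linZ (tens_linr _)) addrC subrK.
Qed.

(** The generators are explicit:
    rho c (x) b = eps(c) db - c_(1) d(S(c_(2)) b), by the Leibniz rule applied to
    c_(1) (S(c_(2)) b). *)
Lemma calc_of_generates (w : G) : exists s, w = adb G s.
Proof.
elim/kerQ_tens_ind: w => [v w|b c c0]; first exact: generatedD.
suff -> : tens b (rho c) = sweedler (fun c1 c2 => lact (- c1) (dif G (antipode c2 * b))) c.
  by apply: generated_sw => c1 c2; exact: generated1.
have ll := lact_linl; have lr := lact_linr.
transitivity (- sweedler (fun c1 c2 => lact (c := G) c1 (dif G (antipode c2 * b))) c); last first.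
  have [s sE] := sw_sum (fun a b : A => a) c; rewrite !sE -sumrN.
  by apply: eq_bigr => p _; rewrite (linN (ll _)).
have [_ _ _ _ _ _ _ rM _] := calc_of_bimodule.
have rl := ract_linl; have rr := ract_linr; have dl := dif_lin.
transitivity (sweedler (fun c1 c2 => ract (dif G c1) (antipode c2 * b)) c).
  transitivity (sweedler (fun c1 y => sweedler (fun c2 c3 => tens (c2 * antipode c3 * b) (rho c1)) y) c).
    rewrite (eq_sw (h := fun c1 y => counit y *: (tens b (rho c1)))); last first.
      move=> c1 y; rewrite (sw_antipoder _ (f := fun x => tens (x * b) (rho c1))) ?mul1r //; lin.
    by rewrite (sw_counitr (f := fun c1 => tens b (rho c1))) //; lin.
  rewrite -sw_coassoc; try by move=> *; lin.
  apply: eq_sw => x c3; rewrite difE (lin_sw _ _ (rl _)).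
  by apply: eq_sw => *; rewrite ractE mulrA.
apply: subr0_eq; rewrite opprK -sw_add.
rewrite (eq_sw (h := fun c1 c2 => dif G (c1 * antipode c2 * b))); last first.
  by move=> c1 c2; rewrite -calc_of_leibniz mulrA.
rewrite (sw_antipoder _ (f := fun x => dif G (x * b) : pbw Q)) ?c0 ?scale0r //; lin.
Qed.
End CalculusOfM.

(** * Bicovariance of the calculus of a crossed submodule *)

Section CovarianceOfM.
Variable K : qField.
Local Notation A := (Cq K).
Local Notation X := (genX K).
Local Notation g := (geng K).
Local Notation gV := (gengV K).
Local Notation XG := (XG K).
Variable M : subspace A.
Hypothesis crM : crossed_submodule M.
Local Notation Q := (kerQ M).
Local Notation rho := (rho M).
Local Notation G := (calculus_of M).

Let ll := @lact_linl K M.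
Let lr := @lact_linr K M crM.
Let dl := @dif_lin K M.

Definition coadQ (v : Q) : pbw Q := tlift (fun u c => tens u (rho c)) (coadL (kval v)).

(** Well defined on ker eps / M since Ad_L(M) lies in A (x) M. *)
Lemma coadQE c : counit c = 0 -> coadQ (rho c) = tlift (fun u c => tens u (rho c)) (coadL c).
Proof.
move=> c0; apply: subr0_eq; rewrite /coadQ.
have tl := tlift_lin (_ : bilin (fun u c => tens u (rho c))).
rewrite -(linB (tl _)); last bil.
rewrite -(linB (@coadL_lin K)); have := @rho_kvalB K M c c0.
move: (kval _ - _) => m mM; case: crM => kM _ /(_ m mM)/in_tensorP iM.
rewrite tliftE big1 // => i _.
have /eqP E := kM _ (iM i).
have /eqP -> : rho (coef (coadL m) i) == 0 by rewrite rho_eq0 ?iM.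
by rewrite (lin0 (tens_linr _)).
Qed.

Lemma coadQ_lin : linear coadQ.
Proof.
move=> k v w; have [c c0 ->] := rhoP v; have [d d0 ->] := rhoP w.
rewrite -[k *: rho c + rho d](rho_lin M) !coadQE //; last first.
  by rewrite counitD counitZ c0 d0 mulr0 addr0.
by rewrite (@coadL_lin K); apply: tlift_lin; bil.
Qed.

(** The left coaction sends v (x) b to Ad_L(v) Delta b, the first legs being
    multiplied. It is built by hand on the tensor product; left covariance then says
    that it agrees with a db |-> Delta a (id (x) d) Delta b, which follows from its
    values on db and its compatibility with the left action, for which it suffices to
    treat X and the group-likes. *)
Definition deltaL (w : pbw Q) : pbw (pbw Q) :=
  tlift (fun b v => tlift (fun u v' => sweedler (fun b1 b2 => tens (u * b1) (tens b2 v')) b)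
     (coadQ v)) w.
Let cl := coadQ_lin.

Lemma deltaL_lin : linear deltaL.
Proof. apply: tlift_lin; bil. Qed.

Lemma deltaLE b c : deltaL (tens b (rho c)) =
  tlift (fun u c' => sweedler (fun b1 b2 => tens (u * b1) (tens b2 (rho c'))) b) (coadL c).
Proof.
have key d : counit d = 0 -> deltaL (tens b (rho d)) =
  tlift (fun u c' => sweedler (fun b1 b2 => tens (u * b1) (tens b2 (rho c'))) b) (coadL d).
  move=> d0; rewrite /deltaL tlift_tensE; last bil.
  rewrite coadQE // (lin_tlift _ _ (tlift_lin _)); last bil.
  by apply: eq_tlift => u c'; rewrite tlift_tensE //; bil.
rewrite rho_counit key; last by rewrite counitB counitZ counit1 mulr1 subrr.
rewrite (linB (@coadL_lin K)) (linB (tlift_lin _)); last bil.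
rewrite (linZ (@coadL_lin K)) (linZ (tlift_lin _)); last bil.
rewrite coadL_1; last bil.
have [s ->] := sw_sum (fun a b : A => a) b; rewrite big1 ?scaler0 ?subr0 // => p _.
by rewrite rho1 (lin0 (tens_linr _)) (lin0 (tens_linr _)).
Qed.

Lemma deltaL_dif b : deltaL (dif G b) = sweedler (fun b1 b2 => tens b1 (dif G b2 : pbw Q)) b.
Proof.
rewrite difE (lin_sw _ _ deltaL_lin).
under eq_sw do rewrite deltaLE.
rewrite (coadL_sw (f := fun u c b => tens u (tens b (rho c)))); try by move=> *; lin.
by apply: eq_sw => b1 b2; rewrite difE (lin_sw _ _ (tens_linr _)).
Qed.

Lemma deltaL_X w : deltaL (lact (c := G) X w) =
  tlift (fun b (w' : pbw Q) => tens (X * b) w' + tens (g * b) (lact (c := G) X w' : pbw Q)) (deltaL w).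
Proof.
have dL := deltaL_lin; move: w; apply: kerQ_ext => [||b c c0]; [by lin | by lin |].
have lX b' d : sweedler (fun a1 a2 => tens (a2 * b') (rho (a1 * d))) X =
   tens b' (rho (X * d)) + tens (X * b') (rho (g * d)).
  rewrite -[X in sweedler _ X]mulr1 sw_X; last bil.
  by rewrite sw_1 ?mulr1 ?mul1r //; bil.
rewrite (lactE crM) // lX (linD dL) !deltaLE.
rewrite coadL_X; last bil.
rewrite coadL_g; last bil.
rewrite -tlift_add [RHS](lin_tlift _ _ (tlift_lin _)); last bil.
(* The left action on rho c' involves c' - eps(c') rather than c'; by
   coadL_counit the corrections add up to a multiple of eps(c) = 0. *)
pose e b1 b2 : pbw (pbw Q) := tens b1 (tens b2 (rho X) + tens (X * b2) (rho g)).
have z : tlift (fun u c' => counit c' *: sweedler (fun b1 b2 => e (g * u * b1) b2) b) (coadL c) = 0.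
  by rewrite (coadL_counit _ (f := fun u => sweedler (fun b1 b2 => e (g * u * b1) b2) b))
    ?c0 ?scale0r // /e; lin.
rewrite -[RHS]addr0 -z -tlift_add; apply: eq_tlift => u c'.
rewrite [in LHS]sw_X; last bil.
rewrite (lin_sw _ _ (tlift_lin _)); last bil.
rewrite (lin_sw _ _ (lin_scalef _ (@lin_id _ _))).
rewrite -sw_opp -!sw_add; apply: eq_sw => b1 b2.
rewrite tlift_tensE; last bil.
have -> : lact (c := G) X (tens b2 (rho c')) =
    (tens b2 (rho (X * c')) + tens (X * b2) (rho (g * c'))) -
    counit c' *: (tens b2 (rho X) + tens (X * b2) (rho g)) :> pbw Q.
  rewrite (lactE' crM); apply: etrans (lX _ _) _.
  rewrite !mulrBr -!scalerAr !mulr1 !(linB (@rho_lin _ M)) !(linZ (@rho_lin _ M)).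
  by rewrite !(linB (tens_linr _)) !(linZ (tens_linr _)) addrACA -opprD -scalerDr.
rewrite (linB (tens_linr _)) (linZ (tens_linr _)) /e !mulrA [_ + (_ - _)]addrA subrK.
by rewrite (linD (tens_linr _)) -[g * u * gV * g]mulrA gVgE mulr1 !addrA subrK.
Qed.

Lemma deltaL_grp t w : deltaL (lact (c := G) (XG 0 t) w) =
  tlift (fun b (w' : pbw Q) => tens (XG 0 t * b) (lact (c := G) (XG 0 t) w' : pbw Q)) (deltaL w).
Proof.
have dL := deltaL_lin; move: w; apply: kerQ_ext => [||b c c0]; [by lin | by lin |].
have lX b' d : sweedler (fun a1 a2 => tens (a2 * b') (rho (a1 * d))) (XG 0 t) =
   tens (XG 0 t * b') (rho (XG 0 t * d)) by rewrite sw_XG0 //; bil.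
rewrite (lactE crM) // lX !deltaLE coadL_grp; last bil.
rewrite [RHS](lin_tlift _ _ (tlift_lin _)); last bil.
pose e b1 b2 : pbw (pbw Q) := tens b1 (tens (XG 0 t * b2) (rho (XG 0 t))).
have z : tlift (fun u c' => counit c' *:
    sweedler (fun b1 b2 => e (XG 0 t * u * b1) b2) b) (coadL c) = 0.
  by rewrite (coadL_counit _ (f := fun u => sweedler (fun b1 b2 => e (XG 0 t * u * b1) b2) b))
    ?c0 ?scale0r // /e; lin.
rewrite -[RHS]addr0 -z -tlift_add; apply: eq_tlift => u c'.
rewrite [in LHS]sw_grp; last bil.
rewrite (lin_sw _ _ (tlift_lin _)); last bil.
rewrite (lin_sw _ _ (lin_scalef _ (@lin_id _ _))).
rewrite -!sw_add; apply: eq_sw => b1 b2.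
rewrite tlift_tensE; last bil.
have -> : lact (c := G) (XG 0 t) (tens b2 (rho c')) = tens (XG 0 t * b2) (rho (XG 0 t * c')) -
    counit c' *: (tens (XG 0 t * b2) (rho (XG 0 t))) :> pbw Q.
  rewrite (lactE' crM); apply: etrans (lX _ _) _.
  rewrite mulrBr -scalerAr mulr1 (linB (@rho_lin _ M)) (linZ (@rho_lin _ M)).
  by rewrite (linB (tens_linr _)) (linZ (tens_linr _)).
rewrite (linB (tens_linr _)) (linZ (tens_linr _)) /e !mulrA subrK.
by rewrite -[XG 0 t * u * _ * XG 0 t]mulrA XG0Vl mulr1.
Qed.

Lemma deltaL_lact a w : deltaL (lact (c := G) a w) =
  sweedler (fun a1 a2 => tlift (fun b (w' : pbw Q) =>
    tens (a1 * b) (lact (c := G) a2 w' : pbw Q)) (deltaL w)) a.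
Proof.
have dL := deltaL_lin; have bm := calc_of_bimodule crM.
elim/A_gen_ind: a => [v v' IH IH'|k v IH||v IH|t v IH].
- rewrite (linD (ll _)) (linD dL) (linD (sw_lin _)) ?IH ?IH' //; bil.
- rewrite (linZ (ll _)) (linZ dL) (linZ (sw_lin _)) ?IH //; bil.
- rewrite (lact1 bm) sw_1; last bil.
  rewrite (eq_tlift (h := @tens K (pbw Q))) ?tlift_id // => b w'.
  by rewrite mul1r (lact1 bm).
- rewrite (lactM bm) deltaL_X IH (lin_sw _ _ (tlift_lin _)); last bil.
  rewrite sw_X; last bil.
  apply: eq_sw => a1 a2; rewrite (lin_tlift _ _ (tlift_lin _)); last bil.
  rewrite -tlift_add; apply: eq_tlift => b w'; rewrite tlift_tensE; last bil.
  by rewrite (lactM bm) !mulrA.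
- rewrite (lactM bm) deltaL_grp IH (lin_sw _ _ (tlift_lin _)); last bil.
  rewrite sw_grp; last bil.
  apply: eq_sw => a1 a2; rewrite (lin_tlift _ _ (tlift_lin _)); last bil.
  apply: eq_tlift => b w'; rewrite tlift_tensE; last bil.
  by rewrite (lactM bm) !mulrA.
Qed.

Lemma calc_of_left_covariant : left_covariant G.
Proof.
move=> s s0; suff -> : coactL G s = deltaL (adb G s) by rewrite s0 (lin0 deltaL_lin).
rewrite /coactL /adb (lin_sum deltaL_lin); apply: eq_bigr => -[a b] _ /=.
rewrite deltaL_lact deltaL_dif; apply: eq_sw => a1 a2.
rewrite (lin_sw _ _ (tlift_lin _)); last bil.
by apply: eq_sw => b1 b2; rewrite tlift_tensE //; bil.
Qed.

(** The right coaction only sees A: v (x) b |-> (v (x) b_(1)) (x) b_(2). *)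
Definition deltaR (w : pbw Q) : pbw (pbw Q) :=
  tlift (fun b v => sweedler (fun b1 b2 => tens b2 (tens b1 v)) b) w.
Lemma deltaR_lin : linear deltaR.
Proof. apply: tlift_lin; bil. Qed.
Lemma deltaRE b v : deltaR (tens b v) = sweedler (fun b1 b2 => tens b2 (tens b1 v)) b.
Proof. by rewrite /deltaR tlift_tensE //; bil. Qed.
Lemma deltaR_dif b : deltaR (dif G b) = sweedler (fun b1 b2 => tens b2 (dif G b1 : pbw Q)) b.
Proof.
rewrite difE (lin_sw _ _ deltaR_lin).
under eq_sw do rewrite deltaRE.
rewrite -(sw_coassoc (f := fun a b c => tens c (tens b (rho a)))); try by move=> *; lin.
by apply: eq_sw => b1 b2; rewrite difE (lin_sw _ _ (tens_linr _)).
Qed.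

Lemma deltaR_lact a w : deltaR (lact (c := G) a w) =
  sweedler (fun a1 a2 => tlift (fun b (w' : pbw Q) =>
    tens (a2 * b) (lact (c := G) a1 w' : pbw Q)) (deltaR w)) a.
Proof.
have dL := deltaR_lin; move: w; apply: kerQ_ext => [||b c c0]; [by lin | by lin |].
rewrite (lactE crM) // (lin_sw _ _ dL) deltaRE.
transitivity (sweedler (fun a1 y => sweedler (fun a2 a3 => sweedler (fun b1 b2 =>
   tens (a3 * b2) (tens (a2 * b1) (rho (a1 * c)))) b) y) a).
  by apply: eq_sw => a1 y; rewrite deltaRE sw_mul //; bil.
rewrite -sw_coassoc; try by move=> *; lin.
apply: eq_sw => x a3; rewrite (lin_sw _ _ (tlift_lin _)); last bil.
rewrite sw_exchange; apply: eq_sw => b1 b2; rewrite tlift_tensE; last bil.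
by rewrite (lactE crM) // (lin_sw _ _ (tens_linr _)).
Qed.

Lemma calc_of_right_coact s : coactR G s = deltaR (adb G s).
Proof.
rewrite /coactR /adb (lin_sum deltaR_lin); apply: eq_bigr => -[a b] _ /=.
rewrite deltaR_lact deltaR_dif; apply: eq_sw => a1 a2.
rewrite (lin_sw _ _ (tlift_lin _)); last bil.
by apply: eq_sw => b1 b2; rewrite tlift_tensE //; bil.
Qed.

Lemma calc_of_is_calculus : is_calculus G.
Proof.
split; last by move=> s s0; rewrite calc_of_right_coact s0 (lin0 deltaR_lin).
  split; [exact: calc_of_bimodule | exact: dl | exact: calc_of_leibniz | exact: calc_of_generates].
exact: calc_of_left_covariant.
Qed.

(** The right coaction is w (x) b |-> (w (x) b_(1)) (x) b_(2), so that a right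
    invariant t is recovered as (id (x) eps) t in ker eps / M, tensored with 1. *)
Lemma calc_of_right_invariant (w : G) :
  reflect (exists v, w = inv_form v) (w \in right_invariant (G := G)).
Proof.
apply: (iffP (asboolP _)) => [[s -> ]|[v ->]].
  rewrite calc_of_right_coact; move: (adb G s) => t E.
  exists (tlift (fun b v => counit b *: v) t).
  (* h applies eps to the inner algebra leg, which deltaR then gives back. *)
  pose h (x : pbw (pbw Q)) : pbw Q := tlift (fun b (w : pbw Q) => tlift (fun b' v => counit b' *: tens b v) w) x.
  have E1 : h (deltaR t) = t.
    have dR := deltaR_lin.
    move: {E} t; apply: pbw_ext => [||b v]; [by rewrite /h; lin | by lin |].
    rewrite deltaRE /h (lin_sw _ _ (tlift_lin _)); last bil.
    rewrite (eq_sw (h := fun b1 b2 => counit b1 *: tens b2 v)); last first.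
      by move=> b1 b2; rewrite !tlift_tensE //; bil.
    by rewrite (sw_counitl _ (f := fun b => tens b v)) //; lin.
  rewrite -[LHS]E1 E /h tlift_tensE; last bil.
  by rewrite /inv_form (lin_tlift _ _ (tens_linr _)); apply: eq_tlift => b v; rewrite (linZ (tens_linr _)).
have [s sE] := calc_of_generates crM (inv_form v); exists s => //.
rewrite calc_of_right_coact -sE /inv_form deltaRE sw_1 //; bil.
Qed.
End CovarianceOfM.

(** * Right invariant forms and the correspondence of Woronowicz *)

Section Omega.
Variable K : qField.
Local Notation A := (Cq K).
Implicit Types G H J : calculus K.

(** In every bicovariant calculus this is the right invariant form attached to
    a; in the calculus of M it is rho a (x) 1 (lemma omega_calc_of), and this is
    how M is recovered from an abstract calculus. *)
Definition omega G (a : A) : G := sweedler (fun a1 a2 => ract (dif G a1) (antipode a2)) a.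

Lemma omega_morph G H (f : G -> H) a : calculus_morphism f -> f (omega G a) = omega H a.
Proof.
case=> fl fL fR fd; rewrite /omega (lin_sw _ _ fl); apply: eq_sw => a1 a2.
by rewrite fR fd.
Qed.

Lemma omega_calc_of (M : subspace A) a : omega (calculus_of M) a = inv_form (rho M a).
Proof.
have rl := @ract_linl K M.
rewrite /omega.
transitivity (sweedler (fun x a3 => sweedler (fun a1 a2 => tens (a2 * antipode a3) (rho M a1)) x) a).
  apply: eq_sw => x a3; rewrite difE (lin_sw _ _ (rl _)).
  by apply: eq_sw => a1 a2; rewrite ractE.
rewrite sw_coassoc; try by move=> *; lin.
rewrite /inv_form -(sw_counitr _ (f := fun a => tens 1 (rho M a))); last by lin.
apply: eq_sw => a1 a2.
by rewrite (sw_antipoder _ (f := fun b => tens b (rho M a1))) //; lin.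
Qed.

Lemma inv_form_inj (M : subspace A) : injective (@inv_form K M).
Proof.
move=> u v /(congr1 (fun t : pbw (kerQ M) => coef t (0%N, 0))).
by rewrite /inv_form -(XG01 K) !coef_tens.
Qed.

(** A morphism maps omega m = 0 to omega m, so m also lies in M'. Calculi of the form
    calculus_of M are therefore isomorphic only when the M coincide. *)
Lemma calc_of_morph_sub (M M' : subspace A) (f : calculus_of M -> calculus_of M') :
  crossed_submodule M -> calculus_morphism f -> {subset M <= M'}.
Proof.
move=> [kM _ _] fm m mM; have /eqP m0 := kM _ mM.
have fl := cmor_linear fm.
have := omega_morph m fm; rewrite !omega_calc_of.
have /eqP -> : rho M m == 0 by rewrite rho_eq0.
rewrite {1}/inv_form (lin0 (tens_linr _)).
rewrite (lin0 (fl : linear (f : pbw (kerQ M) -> pbw (kerQ M')))).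
move=> E; rewrite -rho_eq0 //; apply/eqP; apply: inv_form_inj.
by rewrite -E /inv_form (lin0 (tens_linr _)).
Qed.

Lemma inj_surj_bij (U V : Type) (f : U -> V) :
  injective f -> (forall v, exists u, f u = v) -> bijective f.
Proof.
move=> fi fs; exists (fun v => projT1 (cid (fs v))) => [u|v].
  by apply: fi; exact: (projT2 (cid (fs (f u)))).
exact: (projT2 (cid (fs v))).
Qed.

Lemma iso_sym G H : calculus_iso G H -> calculus_iso H G.
Proof.
case=> f [fl fL fR fd] [h fK hK]; exists h; last by exists f.
split=> [c v w|a w|w a|a]; apply: (can_inj fK); rewrite ?fl ?fL ?fR ?fd !hK //.
Qed.
Lemma morph_comp G H J (f : G -> H) (h : H -> J) :
  calculus_morphism f -> calculus_morphism h -> calculus_morphism (h \o f).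
Proof.
move=> [fl fL fR fd] [hl hL hR hd]; split=> * /=.
- by rewrite fl hl. - by rewrite fL hL. - by rewrite fR hR. - by rewrite fd hd.
Qed.
Lemma iso_trans G H J : calculus_iso G H -> calculus_iso H J -> calculus_iso G J.
Proof.
case=> f fm fb [h hm hb]; exists (h \o f); first exact: morph_comp.
exact: bij_comp.
Qed.
End Omega.

Section Woronowicz.
Variable K : qField.
Local Notation F := (qbase K).
Local Notation A := (Cq K).
Variable G : calculus K.
Hypothesis hG : is_calculus G.
Local Notation omega := (omega G).

Let fo : is_first_order G. Proof. by case: hG. Qed.
Let bm : is_bimodule G. Proof. by case: fo. Qed.
Let ll (w : G) : linear (fun a => lact a w). Proof. by move=> c a b; exact: lactDl. Qed.
Let lr a : linear (fun w : G => lact a w). Proof. by move=> c v w; exact: lactDr. Qed.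
Let rl c : linear (fun w : G => ract w c). Proof. by move=> a v w; exact: ractDl. Qed.
Let rr (w : G) : linear (fun c => ract w c). Proof. by move=> a v c; exact: ractDr. Qed.
Let dl : linear (dif G). Proof. by move=> a v c; exact: dif_linear. Qed.

Lemma dif1 : dif G 1 = 0.
Proof.
have := dif_leibniz fo 1 1; rewrite mulr1 (ract1 bm) (lact1 bm).
by move/(congr1 (fun x => x - dif G 1)); rewrite subrr addrK.
Qed.

Lemma omega_lin : linear omega.
Proof. by apply: sw_lin; bil. Qed.
Let ol := omega_lin.

Lemma omega1 : omega 1 = 0.
Proof. by rewrite /omega sw_1 ?dif1 ?(lin0 (rl _)) //; bil. Qed.

Lemma omega_counit a : omega (a - (counit a)%:A) = omega a.
Proof. by rewrite (linB ol) (linZ ol) omega1 scaler0 subr0. Qed.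

(** With the Leibniz rule and S(ab) = S(b) S(a). *)
Lemma omega_mul a b : omega (a * b) = counit b *: omega a +
  sweedler (fun a1 a2 => ract (lact a1 (omega b)) (antipode a2)) a.
Proof.
rewrite {1}/omega sw_mul; last bil.
rewrite (lin_sw _ _ (lin_scalef _ (@lin_id _ _))) -sw_add; apply: eq_sw => a1 a2.
rewrite -[X in X + _](linZ (rl _)).
have -> : counit b *: dif G a1 = counit b *: ract (dif G a1) 1 by rewrite (ract1 bm).
rewrite -(sw_antipoder b (f := fun x => ract (dif G a1) x)); last by lin.
rewrite (lin_sw _ _ (lr a1)) -(linD (rl _)) -sw_add (lin_sw _ _ (rl _)).
apply: eq_sw => b1 b2; rewrite antipodeM (ractM bm); congr ract.
by rewrite (dif_leibniz fo) (linD (rl _)) (lractA bm) (ractM bm).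
Qed.

Lemma dif_omega b : dif G b = sweedler (fun b1 b2 => ract (omega b1) b2) b.
Proof.
transitivity (sweedler (fun x b3 => sweedler (fun b1 b2 =>
   ract (dif G b1) (antipode b2 * b3)) x) b); last first.
  apply: eq_sw => x b3; rewrite /omega (lin_sw _ _ (rl _)).
  by apply: eq_sw => b1 b2; rewrite (ractM bm).
rewrite sw_coassoc; try by move=> *; lin.
rewrite -[LHS](sw_counitr _ (f := dif G)) //; apply: eq_sw => b1 y.
rewrite (sw_antipodel _ (f := fun x => ract (dif G b1) x)); last by lin.
by rewrite (ract1 bm).
Qed.

Lemma lact_omega a b : counit b = 0 ->
  lact a (omega b) = sweedler (fun a1 a2 => ract (omega (a1 * b)) a2) a.
Proof.
move=> b0.
transitivity (sweedler (fun x a3 => sweedler (fun a1 a2 =>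
   ract (lact a1 (omega b)) (antipode a2 * a3)) x) a); last first.
  apply: eq_sw => x b3; rewrite omega_mul b0 scale0r add0r (lin_sw _ _ (rl _)).
  by apply: eq_sw => b1 b2; rewrite (ractM bm).
rewrite sw_coassoc; try by move=> *; lin.
rewrite -[LHS](sw_counitr _ (f := fun a => lact a (omega b))) //; apply: eq_sw => b1 y.
rewrite (sw_antipodel _ (f := fun x => ract (lact b1 (omega b)) x)); last by lin.
by rewrite (ract1 bm).
Qed.

(** Leibniz for c_(1) (S(c_(2)) b): this rewrites the right structure by forms a db,
    on which the coactions are given. *)
Lemma ract_omega c b : ract (omega c) b =
  counit c *: dif G b - sweedler (fun c1 c2 => lact c1 (dif G (antipode c2 * b))) c.
Proof.
have -> : dif G b = dif G (1 * b) by rewrite mul1r.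
rewrite -(sw_antipoder c (f := fun x => dif G (x * b))); last by lin.
rewrite -sw_opp -sw_add (lin_sw _ _ (rl _)); apply: eq_sw => c1 c2.
by rewrite -mulrA (dif_leibniz fo) addrK (ractM bm).
Qed.

Lemma omega_gen c : omega c = - sweedler (fun c1 c2 => lact c1 (dif G (antipode c2))) c.
Proof.
rewrite -[LHS](ract1 bm) ract_omega dif1 scaler0 add0r; congr (- _).
by apply: eq_sw => c1 c2; rewrite mulr1.
Qed.

(** The covariance axioms speak of vanishing sums only; since the a db span the
    calculus, this is what is needed for a db |-> E a b to extend to a linear map. *)
Lemma coaction_exists (W : lmodType F) (E : A -> A -> W) :
  (forall b, linear (fun a => E a b)) ->
  (forall s, adb G s = 0 -> \sum_(p <- s) E p.1 p.2 = 0) ->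
  exists2 delta : G -> W, linear delta & forall a b, delta (lact a (dif G b)) = E a b.
Proof.
move=> El E0; pose rep w := projT1 (cid (dif_generates fo w)).
have repE w : adb G (rep w) = w by rewrite -(projT2 (cid (dif_generates fo w))).
pose delta w := \sum_(p <- rep w) E p.1 p.2.
have adb_cat s t : adb G (s ++ t) = adb G s + adb G t by rewrite /adb big_cat.
have adb_scale c s : adb G [seq (c *: p.1, p.2) | p <- s] = c *: adb G s.
  by rewrite /adb big_map scaler_sumr; apply: eq_bigr => p _; rewrite (linZ (ll _)).
have dE s : delta (adb G s) = \sum_(p <- s) E p.1 p.2.
  apply: subr0_eq; have := E0 (rep (adb G s) ++ [seq (- 1 *: p.1, p.2) | p <- s]).
  rewrite adb_cat adb_scale repE scaleN1r subrr => /(_ erefl).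
  rewrite big_cat big_map /= => H; rewrite -[RHS]H; congr (_ + _).
  by rewrite -sumrN; apply: eq_bigr => p _; rewrite (linZ (El _)) scaleN1r.
exists delta => [c v w|a b]; last first.
  by have := dE [:: (a, b)]; rewrite /adb !big_seq1.
rewrite -{1}(repE v) -{1}(repE w) -adb_scale -adb_cat.
rewrite dE big_cat big_map /= scaler_sumr; congr (_ + _).
by apply: eq_bigr => p _; rewrite (linZ (El _)).
Qed.

Lemma coef_tlift (V W : lmodType F) (f : V -> W) (t : pbw V) i : linear f ->
  coef (tlift (fun u v => tens u (f v)) t) i = f (coef t i).
Proof.
move=> fl; have cV := @coef_lin K V i; have cW := @coef_lin K W i.
elim/pbw_tens_ind: t => [t u IH IH'|n s v].
  rewrite (linD (tlift_lin _)); last bil.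
  by rewrite !Defs.coefD (linD fl) IH IH'.
rewrite tlift_tensE; last bil.
by rewrite !coef_tens; case: eqP => _; rewrite ?mulr1n // !mulr0n (lin0 fl).
Qed.

(** Left covariance in terms of omega: the left coaction restricts to Ad_L. The
    kernel of omega is thus stable under Ad_L. *)
Lemma coad_omega : exists2 delta : G -> pbw G, linear delta &
  forall c, tlift (fun u c' => tens u (omega c')) (coadL c) = delta (omega c).
Proof.
pose E a b := sweedler (fun a1 a2 => sweedler (fun b1 b2 =>
    tens (a1 * b1) (lact a2 (dif G b2))) b) a.
have [| |d dlin dE] := @coaction_exists _ E.
- by rewrite /E => b; lin.
- by move=> s; case: hG => _ + _; apply.
exists d => // c.
rewrite [in RHS]omega_gen (linN dlin) (lin_sw _ _ dlin).
rewrite tlift_coadL; last bil.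
rewrite -sw_opp.
pose f a b d e := - tens (a * antipode e) (lact b (dif G (antipode d))) : pbw G.
transitivity (sweedler (fun w e => sweedler (fun x d => sweedler (fun a b => f a b d e) x) w) c).
  apply: eq_sw => w e; rewrite sw_coassoc; try by move=> *; rewrite /f; lin.
  apply: eq_sw => a v2; rewrite omega_gen (linN (tens_linr _)) (lin_sw _ _ (tens_linr _)).
  by rewrite -sw_opp.
rewrite sw_coassoc; try by move=> *; rewrite /f; lin.
apply: eq_sw => x y; rewrite dE /E -sw_opp sw_exchange; apply: eq_sw => a b.
rewrite sw_antipode; last bil.
by rewrite -sw_opp.
Qed.

(** Right covariance: the omega c are right invariant. *)
Lemma right_coaction : exists2 delta : G -> pbw G, linear delta &
  forall c b, delta (ract (omega c) b) = sweedler (fun b1 b2 => tens b2 (ract (omega c) b1)) b.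
Proof.
pose E a b := sweedler (fun a1 a2 => sweedler (fun b1 b2 =>
    tens (a2 * b2) (lact a1 (dif G b1))) b) a.
have [| |d dlin dE] := @coaction_exists _ E.
- by rewrite /E => b; lin.
- by move=> s; case: hG => _ _; apply.
exists d => // c b.
rewrite ract_omega (linB dlin) (linZ dlin) (lin_sw _ _ dlin).
have -> : d (dif G b) = sweedler (fun b1 b2 => tens b2 (dif G b1)) b.
  rewrite -[dif G b](lact1 bm) dE /E sw_1; last bil.
  by apply: eq_sw => b1 b2; rewrite mul1r (lact1 bm).
under [RHS]eq_sw do rewrite ract_omega (linB (tens_linr _)) (linZ (tens_linr _)).
rewrite sw_add sw_opp (lin_sw _ _ (lin_scalef _ (@lin_id _ _))); congr (_ - _).
pose f a1 a2 d e := sweedler (fun b1 b2 =>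
  tens (a2 * antipode d * b2) (lact a1 (dif G (antipode e * b1)))) b.
transitivity (sweedler (fun x y => sweedler (fun a1 a2 => sweedler (fun d e => f a1 a2 d e) y) x) c).
  apply: eq_sw => x y; rewrite dE /E; apply: eq_sw => a1 a2.
  rewrite sw_mul; last bil.
  rewrite sw_antipode; last bil.
  by apply: eq_sw => d' e; apply: eq_sw => b1 b2; rewrite mulrA.
rewrite sw_coassoc; try by move=> *; rewrite /f; lin.
transitivity (sweedler (fun a1 y => sweedler (fun b1 b2 =>
  tens b2 (lact a1 (dif G (antipode y * b1)))) b) c); last first.
  rewrite sw_exchange; apply: eq_sw => b1 b2.
  by rewrite (lin_sw _ _ (tens_linr _)).
apply: eq_sw => a1 y; rewrite -sw_coassoc; try by move=> *; rewrite /f; lin.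
rewrite -[RHS](sw_counitl _ (f := fun y => sweedler (fun b1 b2 =>
  tens b2 (lact a1 (dif G (antipode y * b1)))) b)); last by lin.
apply: eq_sw => x e; rewrite /f.
rewrite (sw_antipoder x (f := fun z => sweedler (fun b1 b2 =>
  tens (z * b2) (lact a1 (dif G (antipode e * b1)))) b)); last by lin.
by congr (_ *: _); apply: eq_sw => b1 b2; rewrite mul1r.
Qed.

Definition omega_ker_pred : {pred A} := fun a => (counit a == 0) && (omega a == 0).
Fact omega_ker_closed : submod_closed omega_ker_pred.
Proof.
split=> [|c u v /andP[/eqP u0 /eqP ou] /andP[/eqP v0 /eqP ov]]; apply/andP.
  by rewrite (lin0 ol) (lin0 (@counit_lin K)).
by rewrite counitD counitZ u0 v0 mulr0 addr0 ol ou ov scaler0 addr0.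
Qed.
Definition omega_ker : subspace A := Subspace omega_ker_closed.

Lemma omega_kerP a : reflect (counit a = 0 /\ omega a = 0) (a \in omega_ker).
Proof. by apply: (iffP andP) => -[/eqP ? /eqP]. Qed.

(** A left ideal by omega_mul, stable under Ad_L by coad_omega. *)
Lemma omega_ker_crossed : crossed_submodule omega_ker.
Proof.
split=> [a /omega_kerP[a0 _]|a v /omega_kerP[v0 ov]|v /omega_kerP[v0 ov]].
- exact/eqP.
- apply/omega_kerP; rewrite counitM v0 mulr0 omega_mul v0 scale0r ov add0r; split=> //.
  have [s ->] := sw_sum (fun a b : A => a) a; rewrite big1 // => p _.
  by rewrite (lin0 (lr _)) (lin0 (rl _)).
apply/in_tensorP => i; apply/omega_kerP; split; last first.
  have [d dlin dE] := coad_omega; rewrite -(coef_tlift _ _ ol) dE ov (lin0 dlin).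
  exact: Defs.coef0.
by rewrite -(coef_tlift_scale _ _ (@counit_lin K)) (coadL_counit v (f := id)) ?v0 ?scale0r ?Defs.coef0.
Qed.

Local Notation Q := (kerQ omega_ker).
Local Notation rho := (rho omega_ker).

Lemma omega_kval a : omega (kval (rho a)) = omega a.
Proof.
rewrite rho_counit -[RHS]omega_counit.
have a0 : counit (a - (counit a)%:A) = 0 by rewrite counitB counitZ counit1 mulr1 subrr.
move: (a - _) a0 => c c0; apply: subr0_eq; rewrite -(linB ol).
by have /omega_kerP[] := rho_kvalB omega_ker c0.
Qed.

Lemma omega_kval_lin : linear (fun v : Q => omega (kval v)).
Proof.
move=> c u v; have [a _ ->] := rhoP u; have [b _ ->] := rhoP v.
by rewrite -[c *: rho a + rho b](rho_lin omega_ker) !omega_kval ol.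
Qed.
Let okl := omega_kval_lin.

Definition of_calc (w : calculus_of omega_ker) : G :=
  tlift (fun b (v : Q) => ract (omega (kval v)) b) w.

Lemma of_calc_lin : linear (of_calc : pbw Q -> G).
Proof. by apply: tlift_lin; bil. Qed.
Lemma of_calcE b a : of_calc (tens b (rho a)) = ract (omega a) b.
Proof. by rewrite /of_calc tlift_tensE ?omega_kval //; bil. Qed.

Lemma of_calc_morphism : calculus_morphism of_calc.
Proof.
have cr := omega_ker_crossed; have pl := of_calc_lin.
have cl := lact_linr cr; have crl := @ract_linl K omega_ker.
split; first exact: pl.
- move=> a; apply: kerQ_ext => [| |b c c0]; [by lin | by lin |].
  rewrite (lactE cr) // (lin_sw _ _ pl) of_calcE -(lractA bm) lact_omega //.
  rewrite (lin_sw _ _ (rl _)); apply: eq_sw => a1 a2.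
  by rewrite of_calcE (ractM bm).
- move=> w a; move: w; apply: kerQ_ext => [| |b c c0]; [by lin | by lin |].
  by rewrite ractE !of_calcE (ractM bm).
- move=> a; rewrite difE (lin_sw _ _ pl) dif_omega; apply: eq_sw => a1 a2.
  exact: of_calcE.
Qed.

Lemma of_calc_surj w : exists v, of_calc v = w.
Proof.
have [s ->] := dif_generates fo w; exists (adb _ s).
have [_ fL _ fd] := of_calc_morphism.
rewrite /adb (lin_sum of_calc_lin); apply: eq_bigr => p _.
by rewrite fL fd.
Qed.

(** The right invariant forms are free generators of the right module: if
    the omega(c_i) b_i sum to 0, then applying the right coaction, and then S to one leg,
    recovers the sum of the b_i (x) omega(c_i) in A (x) G, which therefore vanishes.
    Taking the b_i independent, all c_i lie in the kernel of omega. *)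
Lemma of_calc_inj : injective of_calc.
Proof.
move=> v w vw; apply: subr0_eq.
have {vw} : of_calc (v - w : pbw Q) = 0 by rewrite (linB of_calc_lin) vw subrr.
move: (v - w : pbw Q) => t t0 {v w}.
have [d dlin dE] := right_coaction.
(* kappa (w (x) b) = w S(b_(1)) (x) b_(2) takes (omega c b_(1)) (x) b_(2) to
   omega c (x) b. *)
pose kappa (x : pbw G) : pbw G :=
  tlift (fun b w => sweedler (fun b1 b2 => tens b2 (ract w (antipode b1))) b) x.
have kE (x : pbw Q) : kappa (d (of_calc x)) = tlift (fun b (v : Q) => tens b (omega (kval v))) x.
  have pl := of_calc_lin.
  move: x; apply: kerQ_ext => [| |b c c0]; [by rewrite /kappa; lin | by lin |].
  rewrite of_calcE dE /kappa (lin_sw _ _ (tlift_lin _)); last bil.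
  rewrite tlift_tensE; last bil.
  rewrite omega_kval -(sw_counitl _ (f := fun b => tens b (omega c))); last by lin.
  transitivity (sweedler (fun b1 y => sweedler (fun b3 b4 =>
     tens b4 (ract (omega c) (b1 * antipode b3))) y) b).
    apply: eq_sw => b1 b2; rewrite tlift_tensE; last bil.
    by apply: eq_sw => b3 b4; rewrite (ractM bm).
  rewrite -sw_coassoc; try by move=> *; lin.
  apply: eq_sw => x b4.
  rewrite (sw_antipoder x (f := fun z => tens b4 (ract (omega c) z))); last by lin.
  by rewrite (ract1 bm).
have := kE t; rewrite t0 (lin0 dlin) => E.
apply: pbwP => i; rewrite Defs.coef0 -[LHS]rho_kval; apply/eqP.
rewrite rho_eq0 ?counit_kval //; apply/omega_kerP; split; first exact: counit_kval.
rewrite -(coef_tlift (f := fun v : Q => omega (kval v))); last by lin.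
rewrite -E /kappa (lin0 (tlift_lin _)) ?Defs.coef0 //; bil.
Qed.

(** The crossed submodule of a calculus is the kernel of omega on ker eps, and the
    isomorphism is v (x) b |-> omega(v) b. *)
Theorem woronowicz : exists2 M : subspace A,
  crossed_submodule M & calculus_iso G (calculus_of M).
Proof.
exists omega_ker; first exact: omega_ker_crossed.
apply: iso_sym; exists of_calc; first exact: of_calc_morphism.
by apply: inj_surj_bij; [exact: of_calc_inj | exact: of_calc_surj].
Qed.
End Woronowicz.

(** * Dimensions *)

Section Dimension.
Variable F : fieldType.
Implicit Types U V : lmodType F.

(** The kernel of the coordinate matrix. *)
Lemma basis_dependent V (P : {pred V}) n (e : nat -> V) m (u : 'I_m -> V) :
  is_basis P n e -> (forall j, u j \in P) -> (n < m)%N ->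
  exists2 c : 'I_m -> F, exists j, c j != 0 & \sum_j c j *: u j = 0.
Proof.
move=> [_ eP] uP nm; pose co j := projT1 (cid (eP _ (uP j))).
have coE j : u j = \sum_(i < n) co j i *: e i.
  by have [+ _] := projT2 (cid (eP _ (uP j))).
pose B := \matrix_(j < m, i < n) co j i.
have kB : kermx B != 0.
  rewrite kermx_eq0 /row_free; apply: contraL nm => /eqP <-.
  by rewrite -leqNgt; exact: rank_leq_col.
have /matrix0Pn[r [j rj]] := kB.
exists (fun j => kermx B r j); first by exists j.
transitivity (\sum_(i < n) (\sum_j kermx B r j * B j i) *: e i).
  under eq_bigr => i _ do rewrite coE scaler_sumr.
  rewrite exchange_big; apply: eq_bigr => i _; rewrite scaler_suml.
  by apply: eq_bigr => l _; rewrite scalerA [B l i]mxE.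
apply: big1 => i _; have := mulmx_ker B => /matrixP/(_ r i).
by rewrite [LHS]mxE [RHS]mxE => ->; rewrite scale0r.
Qed.

(** A relation among the members of the second basis gives two expansions of one
    of them. *)
Lemma has_dim_leq V (P : {pred V}) n m : has_dim P n -> has_dim P m -> (m <= n)%N.
Proof.
move=> [e eb] [e' [eP' eu']]; rewrite leqNgt; apply/negP => nm.
have [c [j cj] c0] := basis_dependent (u := fun j : 'I_m => e' j) eb (fun j => eP' j (ltn_ord j)) nm.
have [d [dE dU]] := eu' _ (eP' _ (ltn_ord j)).
have /dU dc : e' j = \sum_(i < m) [ffun i => d i + c i] i *: e' i.
  rewrite -[LHS]addr0 -[X in _ + X]c0 [in LHS]dE -big_split; apply: eq_bigr => i _ /=.
  by rewrite ffunE scalerDl.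
have : d j = d j + c j by rewrite [in LHS]dc ffunE.
by move/(congr1 (fun x => x - d j)); rewrite subrr addrC addKr => cj0; rewrite -cj0 eqxx in cj.
Qed.
Lemma has_dim_uniq V (P : {pred V}) n m : has_dim P n -> has_dim P m -> n = m.
Proof. by move=> hn hm; apply/eqP; rewrite eqn_leq !(@has_dim_leq V P). Qed.

(** All bases below come with explicit coordinate functionals: values at points
    q^(n-1) on one side, coefficients of X^k g^(1-n) on the other. *)
Lemma basis_of_dual V (P : {pred V}) (T : eqType) (x0 : T) (s : seq T) (E : T -> V)
    (f : T -> V -> F) :
  uniq s -> {in s, forall p, E p \in P} ->
  {in s, forall p, linear (f p : V -> F^o)} ->
  {in s &, forall p p', f p (E p') = (p == p')%:R} ->
  (forall v, v \in P -> v = \sum_(p <- s) f p v *: E p) ->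
  is_basis P (size s) (fun i => E (nth x0 s i)).
Proof.
move=> us EP fl fE vE; split=> [i si|v vP]; first exact/EP/mem_nth.
exists [ffun i : 'I_(size s) => f (nth x0 s i) v]; split.
  rewrite {1}(vE _ vP) (big_nth x0) big_mkord; apply: eq_bigr => i _.
  by rewrite ffunE.
move=> c cE; apply/ffunP => j; have fj := fl _ (mem_nth x0 (ltn_ord j)).
rewrite ffunE cE (lin_sum fj) (bigD1 j) //=.
rewrite (linZ fj) fE ?mem_nth // eqxx big1 ?addr0; first exact: mulr1.
move=> i ij; rewrite (linZ fj) fE ?mem_nth // nth_uniq // eq_sym.
by rewrite (negPf (_ : i != j :> nat)) //; exact: mulr0.
Qed.

Lemma has_dim_image U V (P : {pred U}) (Q : {pred V}) (f : U -> V) n :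
  linear f -> injective f -> (forall u, u \in P -> f u \in Q) ->
  (forall v, v \in Q -> exists2 u, u \in P & f u = v) -> has_dim P n -> has_dim Q n.
Proof.
move=> fl fi fP fQ [e [eP eu]]; exists (f \o e); split=> [i ni|v /fQ[u uP <-]].
  exact/fP/eP.
have E (c : {ffun 'I_n -> F}) : \sum_(i < n) c i *: (f \o e) i = f (\sum_(i < n) c i *: e i).
  by rewrite (lin_sum fl); apply: eq_bigr => i _; rewrite (linZ fl).
have [c [cE cU]] := eu _ uP; exists c; split; first by rewrite E -cE.
by move=> d; rewrite E => /fi; exact: cU.
Qed.
Lemma eq_has_dim V (P Q : {pred V}) n : P =i Q -> has_dim P n -> has_dim Q n.
Proof.
move=> PQ; apply: (has_dim_image (f := id)) => // [u|v]; first by rewrite PQ.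
by move=> vQ; exists v; rewrite ?PQ.
Qed.
End Dimension.

Section CalculusDim.
Variable K : qField.
Local Notation A := (Cq K).
Implicit Types (G H : calculus K) (M : subspace A).

Lemma morph_adb G H (f : G -> H) s : calculus_morphism f -> f (adb G s) = adb H s.
Proof.
case=> fl fL fR fd; rewrite /adb (lin_sum fl); apply: eq_bigr => p _.
by rewrite fL fd.
Qed.

Lemma tens_map_lin (V W : lmodType (qbase K)) (f : V -> W) : linear f ->
  linear (fun t : pbw V => tlift (fun u v => tens u (f v)) t).
Proof. by move=> fl; lin. Qed.

Lemma morph_coactR G H (f : G -> H) s : calculus_morphism f ->
  tlift (fun u v => tens u (f v)) (coactR G s) = coactR H s.
Proof.
case=> fl fL fR fd; have tl := tens_map_lin fl.
rewrite /coactR (lin_sum tl); apply: eq_bigr => p _.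
rewrite (lin_sw _ _ tl); apply: eq_sw => a1 a2.
rewrite (lin_sw _ _ tl); apply: eq_sw => b1 b2.
by rewrite tlift_tensE ?fL ?fd //; bil.
Qed.

Lemma morph_right_invariant G H (f : G -> H) w : calculus_morphism f ->
  w \in right_invariant (G := G) -> f w \in right_invariant (G := H).
Proof.
move=> fm /asboolP[s wE cE]; apply/asboolP; exists s; first by rewrite wE (morph_adb _ fm).
have fl := cmor_linear fm.
by rewrite -(morph_coactR s fm) cE tlift_tensE //; bil.
Qed.

Lemma calculus_dim_iso G H n : calculus_iso G H -> calculus_dim G n -> calculus_dim H n.
Proof.
move=> [f fm fb]; have [h fK hK] := fb.
have hm' : calculus_morphism h.
  case: (fm) => fl fL fR fd.
  by split=> *; apply: (can_inj fK); rewrite ?fl ?fL ?fR ?fd !hK.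
apply: (has_dim_image (f := f)); first exact: cmor_linear.
- exact: can_inj fK.
- by move=> u; exact: morph_right_invariant.
- by move=> v vR; exists (h v) => //; exact: morph_right_invariant vR.
Qed.

(** Through the isomorphism v |-> v (x) 1 onto the right invariant forms. *)
Lemma calculus_dim_codim M n : crossed_submodule M ->
  calculus_dim (calculus_of M) n <-> codim M n.
Proof.
move=> cM; have invP := calc_of_right_invariant cM.
have il : linear (@inv_form K M : kerQ M -> pbw (kerQ M)) by exact: tens_linr.
pose ev (w : pbw (kerQ M)) := coef w (0%N, 0).
have evK v : ev (inv_form v) = v by rewrite /ev /inv_form -(XG01 K) coef_tens.
split; last first.
  apply: (has_dim_image (f := @inv_form K M)) => // [|u _|w /invP[v ->]].
  - exact: inv_form_inj.
  - by apply/invP; exists u.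
  - by exists v.
case=> e [eR eu]; exists (fun i => ev (e i)); split=> // v _.
have vR : inv_form v \in right_invariant (G := calculus_of M) by apply/invP; exists v.
have [c [cE cU]] := eu _ vR; exists c; split.
  rewrite -[LHS]evK cE /ev (lin_sum (@coef_lin _ _ _)); apply: eq_bigr => i _.
  by rewrite pcoefZ.
move=> d dE; apply: cU; rewrite dE (lin_sum il); apply: eq_bigr => i _.
rewrite (linZ il); congr (_ *: _).
have /invP[u ->] := eR _ (ltn_ord i).
by rewrite evK.
Qed.
End CalculusDim.

(** * Gaussian binomials, closed formulas for Delta and Ad_L *)

Section GaussBinomial.
Variable R : comNzRingType.
Variable p : R.
Fixpoint gbin (m k : nat) : R := match m, k with
  | _, 0 => 1
  | 0, _.+1 => 0
  | m.+1, k'.+1 => p ^+ k * gbin m k + gbin m k'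
  end.

Arguments gbin : simpl never.

Lemma gbin0 m : gbin m 0 = 1. Proof. by case: m. Qed.
Lemma gbinS m k : gbin m.+1 k.+1 = p ^+ k.+1 * gbin m k.+1 + gbin m k.
Proof. by []. Qed.
Lemma gbin_small m k : (m < k)%N -> gbin m k = 0.
Proof.
elim: m k => [|m IH] [|k] //; rewrite ltnS => mk.
by rewrite gbinS !IH ?mulr0 ?addr0 // ltnW.
Qed.
Lemma gbinn m : gbin m m = 1.
Proof. by elim: m => // m IH; rewrite gbinS gbin_small // mulr0 add0r. Qed.
(** The second Pascal rule. It is the one produced by Delta(X^(m+1)) =
    Delta(X) Delta(X^m); for Ad_L both rules are used together. *)
Lemma gbinS' m k : (k <= m)%N -> gbin m.+1 k.+1 = gbin m k.+1 + p ^+ (m - k) * gbin m k.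
Proof.
elim: m k => [|m IH] [|k] // km.
- by rewrite gbinS /= expr0 !mulr0 mulr1.
- rewrite [LHS]gbinS [in LHS]IH // [gbin m.+1 1]gbinS !gbin0 subn0 !exprS; ring.
move: km; rewrite ltnS leq_eqVlt => /predU1P[->|km].
  by rewrite !gbinn gbin_small // subnn mul1r add0r.
rewrite [LHS]gbinS [in LHS]IH // [in LHS]IH ?(ltnW km) // [gbin m.+1 k.+2]gbinS [gbin m.+1 k.+1]gbinS.
have -> : (m - k = (m - k.+1).+1)%N by lia.
have -> : (m.+1 - k.+1 = (m - k.+1).+1)%N by lia.
rewrite !exprS; ring.
Qed.
(** So [l+1;l] is nonzero when p is not a root of unity. *)
Lemma gbin_pred l : gbin l.+1 l * (1 - p) = 1 - p ^+ l.+1.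
Proof.
elim: l => [|l IH]; first by rewrite gbin0 mul1r expr1.
by rewrite gbinS gbinn mulrDl IH !exprS; ring.
Qed.
End GaussBinomial.
Arguments gbin : simpl never.

Section ClosedForms.
Variable K : qField.
Local Notation F := (qbase K).
Local Notation q := (qparam K).
Local Notation A := (Cq K).
Local Notation X := (genX K).
Local Notation g := (geng K).
Local Notation gV := (gengV K).
Local Notation XG := (XG K).
Local Notation p := (q^-1).
Local Notation gb := (gbin p).
Implicit Types U V W : lmodType F.

Lemma Xexp m : X ^+ m = XG m 0.
Proof. by elim: m => [|m IH]; rewrite // exprS IH XGS. Qed.
Lemma XG_split m s : XG m s = X ^+ m * XG 0 s.
Proof. by rewrite Xexp XG_mul mul0r oppr0 expr0z scale1r addn0 add0r. Qed.
Lemma gmulXG m s : g * XG m s = p ^+ m *: XG m (s + 1).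
Proof. by rewrite /geng XG_mul mul1r add0n addrC -exprnN exprVn. Qed.
Lemma XGmulX m s : XG m s * X = q ^ (- s) *: XG m.+1 s.
Proof. by rewrite /genX XG_mul mulr1 addn1 addr0. Qed.

(** The q-binomial formula for (X (x) 1 + g (x) X)^m: the two summands q-commute. *)
Lemma sw_Xm V (f : A -> A -> V) m : bilin f ->
  sweedler f (X ^+ m) = \sum_(k < m.+1) gb m k *: f (XG (m - k)%N k%:Z) (XG k 0).
Proof.
elim: m f => [|m IH] f fb.
  by rewrite big_ord1 sw_1 // gbin0 scale1r.
rewrite exprS sw_X // IH; last bil.
pose a k := gb m k *: f (XG (m.+1 - k)%N k%:Z) (XG k 0).
pose b k := p ^+ (m - k)%N *: (gb m k *: f (XG (m - k)%N k.+1%:Z) (XG k.+1 0)).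
transitivity (\sum_(k < m.+1) a k + \sum_(k < m.+1) b k).
  rewrite -big_split; apply: eq_bigr => -[k km] _ /=; rewrite /a /b scalerDr.
  rewrite -!XGS subSn //; congr (_ + _).
  by rewrite gmulXG (linZ (proj1 fb _)) !scalerA mulrC -PoszD addn1.
have -> : \sum_(k < m.+1) a k = \sum_(k < m.+2) a k.
  by rewrite [RHS]big_ord_recr /= /a gbin_small // scale0r addr0.
rewrite big_ord_recl [RHS]big_ord_recl /= -addrA; congr (_ + _).
  by rewrite /a !gbin0.
rewrite -big_split; apply: eq_bigr => -[k km] _ /=; rewrite /a /b /bump /= add1n subSS.
by rewrite scalerA -scalerDl [gb m.+1 _]gbinS'.
Qed.

Lemma sw_XG V (f : A -> A -> V) m s : bilin f -> sweedler f (XG m s) =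
  \sum_(k < m.+1) gb m k *: f (XG (m - k)%N (k%:Z + s)) (XG k s).
Proof.
move=> fb; rewrite XG_split sw_mul // sw_Xm; last bil.
apply: eq_bigr => k _; rewrite sw_XG0; last bil.
by rewrite !XG_mul !mulr0 oppr0 expr0z !scale1r !addn0 add0r.
Qed.

Definition gprod (k m : nat) : A := \prod_(k <= i < m) (1 - p ^+ i *: g).

Lemma gprod_small k m : (m <= k)%N -> gprod k m = 1.
Proof. by move=> mk; rewrite /gprod big_geq. Qed.
Lemma gprodS k m : (k <= m)%N -> gprod k m.+1 = gprod k m * (1 - p ^+ m *: g).
Proof. by move=> km; rewrite /gprod big_nat_recr. Qed.
Lemma gprod_comm k m : g * gprod k m = gprod k m * g.
Proof.
rewrite /gprod; elim/big_ind: _ => [|x y gx gy|i _]; first by rewrite mulr1 mul1r.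
  by rewrite mulrA gx -mulrA gy mulrA.
by rewrite mulrBr mulrBl mulr1 mul1r -scalerAl -scalerAr.
Qed.
Lemma gprod_comm' c k m : (1 - c *: g) * gprod k m = gprod k m * (1 - c *: g).
Proof.
by rewrite mulrBr mulrBl mulr1 mul1r -scalerAl -scalerAr gprod_comm.
Qed.
Lemma gprodSl k m : (k < m)%N -> gprod k m = gprod k.+1 m * (1 - p ^+ k *: g).
Proof. by move=> km; rewrite -gprod_comm' /gprod big_ltn. Qed.

Lemma gXexp k : g * X ^+ k = p ^+ k *: (X ^+ k * g).
Proof. by rewrite Xexp gmulXG add0r /geng XG_mul mul0r oppr0 expr0z scale1r addn0 add0r. Qed.

(** Closed form of Ad_L(X^m). The second legs acquire the factors 1 - q^(-i) g, whose
    roots g = q^i are the points that govern the classification. *)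
Lemma coadL_Xm V (f : A -> A -> V) m : bilin f -> tlift f (coadL (X ^+ m)) =
  \sum_(k < m.+1) gb m k *: f (XG (m - k)%N k%:Z) (X ^+ k * gprod k m).
Proof.
elim: m f => [|m IH] f fb.
  by rewrite big_ord1 coadL_1 // gbin0 scale1r gprod_small // mulr1.
rewrite exprS coadL_X // IH; last bil.
(* Of the three terms of coadL_X, the first and the third keep the first leg
   X^(m+1-k) g^k and combine into the factor 1 - q^(-m-k) g; the middle one moves
   k to k+1. *)
pose U k := XG (m.+1 - k)%N k%:Z.
pose a k := gb m k *: f (U k) (X ^+ k * (gprod k m * (1 - p ^+ (m + k) *: g))).
pose b k := gb m k *: (p ^+ (m - k) *: f (U k.+1) (X ^+ k.+1 * gprod k m)).
transitivity (\sum_(k < m.+1) a k + \sum_(k < m.+1) b k).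
  rewrite -big_split; apply: eq_bigr => -[k km] _ /=; rewrite /a /b -scalerDr; congr (_ *: _).
  have E1 : X * XG (m - k)%N k%:Z = U k by rewrite -XGS /U subSn.
  have E2 : g * XG (m - k)%N k%:Z = p ^+ (m - k) *: U k.+1.
    by rewrite gmulXG /U subSS -PoszD addn1.
  have E3 : g * XG (m - k)%N k%:Z * gV * X = p ^+ m *: U k.
    rewrite E2 -!scalerAl /U subSS /gengV XG_mul mulr0 oppr0 expr0z scale1r addn0.
    have -> : k.+1%:Z + - 1%:Z = k%:Z by lia.
    by rewrite XGmulX scalerA -exprnN -exprVn -exprD subnK // subSn.
  rewrite E1 E3 E2 (linZ (proj1 fb _)) (linZ (proj1 fb _)).
  rewrite addrAC; congr (_ + _); last by rewrite exprS mulrA.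
  rewrite mulrA gXexp -scalerAl -mulrA gprod_comm (linZ (proj2 fb _)) scalerA -exprD.
  by rewrite -(linZ (proj2 fb _)) -(linB (proj2 fb _)) !mulrBr !mulr1 -!scalerAr !mulrA.
have -> : \sum_(k < m.+1) a k = \sum_(k < m.+2) a k.
  by rewrite [RHS]big_ord_recr /= /a gbin_small // scale0r addr0.
rewrite big_ord_recl [RHS]big_ord_recl /= -addrA; congr (_ + _).
  by rewrite /a /U !gbin0 addn0 gprodS.
rewrite -big_split; apply: eq_bigr => -[k km] _ /=; rewrite /a /b /bump /= add1n /U.
rewrite scalerA -!(linZ (proj2 fb _)) -(linD (proj2 fb _)); congr (f _ _).
rewrite !scalerAr -mulrDr; congr (_ * _).
move: km; rewrite ltnS leq_eqVlt => /predU1P[->|km].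
  by rewrite gbin_small // scale0r mulr0 add0r subnn !gbinn !gprod_small // mulr1.
rewrite gprodS // (gprodSl km) !scalerAr -mulrDr; congr (_ * _).
rewrite !scalerBr addrACA -opprD !scalerA -!scalerDl; congr (_ *: _ - _ *: _).
  by rewrite (gbinS' _ (ltnW km)) [p ^+ _ * _]mulrC.
rewrite gbinS addnS exprS exprD.
have -> : p ^+ m = p ^+ (m - k) * p ^+ k by rewrite -exprD subnK // ltnW.
rewrite exprS; ring.
Qed.

Lemma coadL_XG V (f : A -> A -> V) m s : bilin f -> tlift f (coadL (XG m s)) =
  \sum_(k < m.+1) gb m k *: f (XG (m - k)%N k%:Z) (X ^+ k * gprod k m * XG 0 s).
Proof. by move=> fb; rewrite XG_split coadL_r // coadL_Xm //; bil. Qed.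
End ClosedForms.

(** * Evaluation of Laurent polynomials *)

HB.lock Definition lin_ext (K : qField) (V : lmodType (qbase K)) (w : nat -> int -> V)
    (a : Cq K) : V :=
  mext (fun i (c : (qbase K)^o) => (c : qbase K) *: w i.1 i.2) a.
Arguments lin_ext {K V} w a.

Section Evaluation.
Variable K : qField.
Local Notation F := (qbase K).
Local Notation q := (qparam K).
Local Notation A := (Cq K).
Local Notation X := (genX K).
Local Notation g := (geng K).
Local Notation gV := (gengV K).
Local Notation XG := (XG K).
Implicit Types U V W : lmodType F.

Lemma lin_extP V (w : nat -> int -> V) : linear (lin_ext w).
Proof.
have D : {morph lin_ext w : x y / x + y}.
  by rewrite [@lin_ext]unlock; apply: mextD => i u v; rewrite scalerDl.
apply: linP => // c; elim/pbw_ind => [a b IH IH'|i u].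
  by rewrite scalerDr !D IH IH' scalerDr.
by rewrite [@lin_ext]unlock monoZ !mext_mono => [|j|j]; rewrite ?scale0r // scalerA.
Qed.
Lemma lin_ext_XG V (w : nat -> int -> V) n s : lin_ext w (XG n s) = w n s.
Proof. by rewrite [@lin_ext]unlock /Defs.XG mext_mono ?scale1r // => i; rewrite scale0r. Qed.

(** Writing v as the sum of the X^k r_k(g), this is r_k(z). These functionals
    carry the whole analysis of crossed submodules, and they are, up to a scalar,
    the pairings with the X^k g^s (lemma pairing_XG). *)
Definition ev (k : nat) (z : F) : A -> F^o :=
  lin_ext (V := F^o) (fun n s => (n == k)%:R * z ^ s).
Lemma ev_lin k z : linear (ev k z).
Proof. exact: lin_extP. Qed.
Lemma evXG k z n s : ev k z (XG n s) = (n == k)%:R * z ^ s.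
Proof. exact: lin_ext_XG. Qed.

(** The coefficient r_k(g) itself, with v the sum of the X^k r_k(g). *)
Definition lcomp (k : nat) : A -> A := lin_ext (fun n s => (n == k)%:R *: XG 0 s).
Lemma lcomp_lin k : linear (lcomp k).
Proof. exact: lin_extP. Qed.
Lemma lcompXG k n s : lcomp k (XG n s) = (n == k)%:R *: XG 0 s.
Proof. exact: lin_ext_XG. Qed.

Lemma lcomp_sum v : exists N, forall N', (N <= N')%N ->
  v = \sum_(k < N') X ^+ k * lcomp k v.
Proof.
have ll := lcomp_lin; elim/A_lin_ind: v => [v w [N vN] [N' wN]|c v [N vN]|n s].
- exists (maxn N N') => M; rewrite geq_max => /andP[/vN vM /wN wM].
  rewrite {1}vM {1}wM -big_split; apply: eq_bigr => k _.
  by rewrite (linD (ll _)) mulrDr.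
- exists N => M /vN vM; rewrite {1}vM scaler_sumr; apply: eq_bigr => k _.
  by rewrite (linZ (ll _)) scalerAr.
exists n.+1 => M nM; rewrite (bigD1 (Ordinal nM)) //= lcompXG eqxx scale1r -XG_split.
rewrite big1 ?addr0 // => i; rewrite -val_eqE /= lcompXG eq_sym => /negPf ->.
by rewrite scale0r mulr0.
Qed.

Lemma laurent_ind (P : A -> Prop) : P 0 ->
  (forall c s a, laurent a -> P a -> P (c *: XG 0 s + a)) -> forall a, laurent a -> P a.
Proof.
move=> P0 PD a [c ->] {a}; elim: c => [|x c IH]; first by rewrite big_nil.
by rewrite big_cons; apply: PD => //; exists c.
Qed.
Lemma laurent0 : laurent (0 : A). Proof. by exists [::]; rewrite big_nil. Qed.
Lemma laurentZXG c s : laurent (c *: XG 0 s).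
Proof. by exists [:: (c, s)]; rewrite big_seq1. Qed.
Lemma laurentXG s : laurent (XG 0 s).
Proof. by rewrite -[XG 0 s]scale1r; exact: laurentZXG. Qed.
Lemma laurent1 : laurent (1 : A). Proof. exact: laurentXG. Qed.
Lemma laurentD (a b : A) : laurent a -> laurent b -> laurent (a + b).
Proof. by move=> [c ->] [d ->]; exists (c ++ d); rewrite big_cat. Qed.
Lemma laurentZ c (a : A) : laurent a -> laurent (c *: a).
Proof.
move=> [s ->]; exists [seq (c * x.1, x.2) | x <- s].
by rewrite big_map scaler_sumr; apply: eq_bigr => i _; rewrite scalerA.
Qed.
Lemma laurentB (a b : A) : laurent a -> laurent b -> laurent (a - b).
Proof. by move=> la lb; rewrite -scaleN1r; apply: laurentD => //; exact: laurentZ. Qed.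
Lemma laurentM (a b : A) : laurent a -> laurent b -> laurent (a * b).
Proof.
move=> + lb; elim/laurent_ind => {a}[|c s a _ IH]; first by rewrite mul0r; exact: laurent0.
rewrite mulrDl; apply: laurentD => //; rewrite -scalerAl; apply: laurentZ.
elim/laurent_ind: lb {IH} => {b}[|d t b _ IH]; first by rewrite mulr0; exact: laurent0.
by rewrite mulrDr -scalerAr XG0D; apply: laurentD => //; exact: laurentZXG.
Qed.
Lemma laurent_prod I (r : seq I) (P : pred I) (E : I -> A) :
  (forall i, P i -> laurent (E i)) -> laurent (\prod_(i <- r | P i) E i).
Proof.
by move=> h; elim/big_rec: _ => [|i x /h Ei xl]; [exact: laurent1 | exact: laurentM].
Qed.
Lemma laurent_lin c : laurent (1 - c *: g).
Proof. by apply: laurentB; [exact: laurent1 | exact: laurentZXG]. Qed.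
Lemma laurent_lcomp k v : laurent (lcomp k v).
Proof.
elim/A_lin_ind: v => [v w lv lw|c v lv|n s].
- by rewrite (linD (lcomp_lin _)); exact: laurentD.
- by rewrite (linZ (lcomp_lin _)); exact: laurentZ.
- by rewrite lcompXG; exact: laurentZXG.
Qed.
Lemma laurentC (a b : A) : laurent a -> laurent b -> a * b = b * a.
Proof.
move=> + lb; elim/laurent_ind => {a}[|c s a _ IH]; first by rewrite mul0r mulr0.
rewrite mulrDl mulrDr IH -scalerAl -scalerAr; congr (_ *: _ + _).
elim/laurent_ind: lb {IH} => {b}[|d t b _ IH]; first by rewrite mul0r mulr0.
by rewrite mulrDl mulrDr IH -scalerAl -scalerAr !XG0D [s + t]addrC.
Qed.

Lemma ev_lcomp k z v : ev k z v = ev 0 z (lcomp k v).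
Proof.
have el := ev_lin; have ll := lcomp_lin.
apply: (A_ext (f := ev k z) (h := fun v => ev 0 z (lcomp k v))) => [||n s]; try lin.
by rewrite lcompXG (linZ (el _ _)) !evXG mul1r.
Qed.

Lemma ev_XS k z v : ev k.+1 z (X * v) = ev k z v.
Proof.
have el := ev_lin.
apply: (A_ext (f := fun v => ev k.+1 z (X * v)) (h := ev k z)) => [||n s]; try lin.
by rewrite -XGS !evXG eqSS.
Qed.
Lemma ev_X0 z v : ev 0 z (X * v) = 0.
Proof.
have el := ev_lin.
apply: (A_ext (f := fun v => ev 0 z (X * v)) (h := fun=> 0)) => [||n s]; first by lin.
  by move=> c u w; rewrite scaler0 addr0.
by rewrite -XGS evXG mul0r.
Qed.

Variable z : F.
Hypothesis z0 : z != 0.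
Let zD s t : z ^ (s + t) = z ^ s * z ^ t. Proof. exact: expfzDr. Qed.

Lemma ev_XGl k t v : ev k z (XG 0 t * v) = q ^ (- (t * k%:Z)) * z ^ t * ev k z v.
Proof.
have el := ev_lin.
apply: (A_ext (f := fun v => ev k z (XG 0 t * v))
  (h := fun v => (q ^ (- (t * k%:Z)) * z ^ t) *: ev k z v)) => [||n s]; try lin.
rewrite XG_mul (linZ (el _ _)) !evXG add0n zD.
have [->|_] := eqVneq n k; last by rewrite !mul0r !scaler0.
by rewrite !mul1r; change (?a *: ?b = ?c) with (a * b = c); exact: mulrA.
Qed.

Lemma ev_XGr k t v : ev k z (v * XG 0 t) = ev k z v * z ^ t.
Proof.
have el := ev_lin.
apply: (A_ext (f := fun v => ev k z (v * XG 0 t))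
  (h := fun v => ev k z v * z ^ t)) => [||n s]; try lin.
by rewrite XG_mul mulr0 oppr0 expr0z scale1r !evXG addn0 zD mulrA.
Qed.
Lemma ev_laurent k v r : laurent r -> ev k z (v * r) = ev k z v * ev 0 z r.
Proof.
have el := ev_lin.
elim/laurent_ind => {r}[|c s a _ IH]; first by rewrite mulr0 !(lin0 (el _ _)) mulr0.
rewrite mulrDr !(linD (el _ _)) IH -scalerAr !(linZ (el _ _)) ev_XGr evXG mulrDr mul1r.
by congr (_ + _); rewrite mulrCA.
Qed.
Lemma ev1 : ev 0 z 1 = 1.
Proof. by rewrite -(XG01 K) evXG mulr1. Qed.
Lemma ev_Xexp k l r : laurent r -> ev k z (X ^+ l * r) = (l == k)%:R * ev 0 z r.
Proof. by move=> lr; rewrite ev_laurent // Xexp evXG expr0z mulr1. Qed.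
Lemma ev_lin1 c : ev 0 z (1 - c *: g) = 1 - c * z.
Proof.
rewrite (linB (@ev_lin _ _)) (linZ (@ev_lin _ _)) ev1 /geng evXG mul1r expr1z //.
Qed.
Lemma ev_prod I (r : seq I) (P : pred I) (E : I -> A) : (forall i, P i -> laurent (E i)) ->
  ev 0 z (\prod_(i <- r | P i) E i) = \prod_(i <- r | P i) (ev 0 z (E i) : F).
Proof.
move=> lE; elim: r => [|i r IH]; first by rewrite !big_nil ev1.
rewrite !big_cons; case: ifP => // /lE Ei; rewrite ev_laurent ?IH //.
exact: laurent_prod.
Qed.

(** Division of r(g) - r(z) by g - z; the divisor is normalised as 1 - g/z, which
    is the shape of the factors 1 - q^(1-n) g. *)
Lemma laurent_div r : laurent r ->
  exists2 r', laurent r' & r = (ev 0 z r : F)%:A + (1 - z^-1 *: g) * r'.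
Proof.
have el := ev_lin.
elim/laurent_ind => {r}[|c s a _ [b lb aE]].
  by exists 0; [exact: laurent0 | rewrite (lin0 (el _ _)) scale0r mulr0 addr0].
suff [d ld sE] : exists2 d, laurent d & XG 0 s = (z ^ s)%:A + (1 - z^-1 *: g) * d.
  exists (c *: d + b); first by apply: laurentD => //; exact: laurentZ.
  rewrite {1}aE {1}sE (linD (el _ _)) (linZ (el _ _)) evXG mul1r mulrDr -scalerAr.
  by rewrite scalerDr scalerA scalerDl addrACA.
have gE : g = z%:A + (1 - z^-1 *: g) * (- z)%:A.
  rewrite -scalerAr mulr1 scalerBr !scaleNr opprK scalerA mulfV // scale1r.
  by rewrite addrA subrr add0r.
have gVE' : gV = (z^-1)%:A + (1 - z^-1 *: g) * gV.
  by rewrite mulrBl -scalerAl gVE mul1r addrC subrK.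
have step (h e d : A) (w y : F) : laurent h -> h = w%:A + (1 - z^-1 *: g) * e ->
    h * (y%:A + (1 - z^-1 *: g) * d) = (y * w)%:A + (1 - z^-1 *: g) * (y *: e + h * d).
  move=> lh hE; rewrite mulrDr -scalerAr mulr1 {1}hE scalerDr scalerA mulrDr -scalerAr -addrA.
  by rewrite !mulrA (laurentC lh (laurent_lin _)).
elim: s => [|s [d ld IH]|s [d ld IH]].
- by exists 0; [exact: laurent0 | rewrite expr0z scale1r mulr0 addr0].
- exists ((z ^ s) *: (- z)%:A + g * d).
    apply: laurentD; last by apply: laurentM => //; exact: laurentXG.
    by do 2 apply: laurentZ; exact: laurent1.
  have -> : XG 0 s.+1%:Z = g * XG 0 s by rewrite XG0D.
  rewrite -[s.+1]addn1 PoszD IH (step _ _ _ _ _ _ gE); last exact: laurentXG.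
  by rewrite zD.
- exists ((z ^ (- s%:Z)) *: gV + gV * d).
    apply: laurentD; last by apply: laurentM => //; exact: laurentXG.
    by apply: laurentZ; exact: laurentXG.
  have -> : XG 0 (- s.+1%:Z) = gV * XG 0 (- s%:Z) by rewrite XG0D -opprD.
  rewrite -[s.+1]addn1 PoszD opprD IH (step _ _ _ _ _ _ gVE'); last exact: laurentXG.
  by rewrite zD exprN1.
Qed.
End Evaluation.

(** * Crossed submodules *)

Section CrossedSubmodules.
Variable K : qField.
Local Notation F := (qbase K).
Local Notation q := (qparam K).
Local Notation A := (Cq K).
Local Notation X := (genX K).
Local Notation g := (geng K).
Local Notation XG := (XG K).
Local Notation p := (q^-1).
Local Notation gb := (gbin p).
Implicit Types U V W : lmodType F.
Implicit Types (I : {fset nat}) (M : subspace A).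

(** The root of 1 - q^(1-n) g. *)
Definition zpt (n : nat) : F := q ^ (n%:Z - 1).
Lemma zptE n : zpt n = q ^ (n%:Z - 1). Proof. by []. Qed.
Lemma zpt_neq0 n : zpt n != 0.
Proof. by rewrite /zpt expfz_neq0 // qparam_neq0. Qed.
Lemma zpt1 : zpt 1 = 1. Proof. by rewrite /zpt subrr. Qed.
Lemma zptV n : (zpt n)^-1 = q ^ (1 - n%:Z).
Proof. by rewrite /zpt invr_expz opprB. Qed.
Lemma zptS k : zpt k.+1 = q ^+ k.
Proof. by rewrite /zpt -addn1 PoszD addrK. Qed.
Lemma zptVS k : (zpt k.+1)^-1 = p ^+ k.
Proof. by rewrite zptS exprVn. Qed.

Lemma counit_ev (a : A) : counit a = ev 0 1 a.
Proof.
have el := @ev_lin K.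
apply: (A_ext (f := @counit K : A -> F^o) (h := ev 0 1)) => [||n s]; try lin.
rewrite evXG exp1rz mulr1; case: n => [|n]; last by rewrite XGS counitM counitX mul0r.
exact: counit_XG0.
Qed.

Definition vanish I (v : A) := forall n, n \in (1%N |` I)%fset ->
  forall k, (k < n)%N -> ev k (zpt n) v = 0.

Lemma vanish_counit I v : vanish I v -> counit v = 0.
Proof. by move=> /(_ 1%N (fset1U1 _ _) 0%N isT); rewrite zpt1 counit_ev. Qed.

Hypothesis hq : forall n, (0 < n)%N -> q ^+ n != 1.

Lemma qexpz_inj (s t : int) : q ^ s = q ^ t -> s = t.
Proof.
have q0 := qparam_neq0 K.
have key (u : int) : q ^ u = 1 -> u = 0.
  case: u => [[|n]|n] // /eqP; first by rewrite (negPf (hq _)).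
  by rewrite NegzE -invr_expz invr_eq1 (negPf (hq _)).
move=> st; apply: subr0_eq; apply: key.
by rewrite expfzDr // st -expfzDr // subrr.
Qed.
Lemma zpt_inj : injective zpt.
Proof. by move=> m n /qexpz_inj; lia. Qed.

(** The points q^(n-1) are distinct, so that the divisions can be iterated. *)
Lemma laurent_divs (s : seq nat) r : uniq s -> laurent r ->
  (forall n, n \in s -> ev 0 (zpt n) r = 0) ->
  exists2 r', laurent r' & r = (\prod_(n <- s) (1 - q ^ (1 - n%:Z) *: g)) * r'.
Proof.
elim: s r => [|n s IH] r /=; first by exists r; rewrite ?big_nil ?mul1r.
case/andP=> ns us lr r0.
have [r1 lr1] := laurent_div (zpt_neq0 n) lr.
rewrite r0 ?mem_head // scale0r add0r zptV => rE.
have [|r' lr' r1E] := IH r1 us lr1; last first.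
  by exists r'; rewrite // rE r1E big_cons mulrA.
move=> m ms; have := r0 m; rewrite inE ms orbT rE => /(_ isT)/eqP.
rewrite ev_laurent ?zpt_neq0 // ev_lin1 ?zpt_neq0 // mulf_eq0 => /orP[|/eqP //].
rewrite subr_eq0 -zptV eq_sym => /eqP/(congr1 (fun x => zpt n * x)).
rewrite mulr1 mulrA mulfV ?zpt_neq0 // mul1r => /zpt_inj mn.
by rewrite -mn ms in ns.
Qed.

(** The degree k part of M_I is the ideal of Laurent polynomials vanishing at the
    points q^(n-1) with n in I or n = 1, and n > k. In this form membership in M_I
    becomes a family of linear equations. *)
Lemma M_vanishP I v : reflect (vanish I v) (v \in M_ K I).
Proof.
apply: (iffP (asboolP _)) => [[s [sP ->]] n nI k kn|vI].
  rewrite (lin_sum (@ev_lin _ _ _)) big1_seq // => x /sP[j [r [lr ->]]].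
  rewrite (linZ (@ev_lin _ _ _)) -mulrA.
  have lP : laurent (M_poly K I j) by apply: laurent_prod => i _; exact: laurent_lin.
  rewrite ev_Xexp ?zpt_neq0 //; last exact: laurentM.
  rewrite ev_laurent ?zpt_neq0 //.
  have [jk|_] := eqVneq j k; last by rewrite mul0r scaler0.
  rewrite /M_poly ev_prod ?zpt_neq0 //; last by move=> i _; exact: laurent_lin.
  rewrite (big_rem n) //= jk kn ev_lin1 ?zpt_neq0 // -zptV mulVf ?zpt_neq0 //.
  by rewrite subrr !mul0r mulr0 scaler0.
have [N /(_ N (leqnn N)) ->] := lcomp_sum v.
suff: \sum_(k < N) X ^+ k * lcomp k v \in M_ K I by move/asboolP.
apply: sub_sum => k _; apply/asboolP.
have [||r lr rE] := @laurent_divs [seq n <- (1%N |` I)%fset | (k < n)%N] (lcomp k v) _ (laurent_lcomp k v).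
- exact: filter_uniq (fset_uniq _).
- by move=> n; rewrite mem_filter => /andP[kn nI]; rewrite -ev_lcomp; exact: vI.
exists [:: (1, X ^+ k * lcomp k v)]; rewrite big_seq1 scale1r; split=> // x.
rewrite inE => /eqP -> /=; exists k, r; split=> //.
by rewrite rE big_filter mulrA.
Qed.

Lemma M_lideal I a v : v \in M_ K I -> a * v \in M_ K I.
Proof.
move=> vM; elim/A_gen_ind: a v vM => [a b IH IH'|c a IH||a IH|t a IH] v vM.
- by rewrite mulrDl subD ?IH ?IH'.
- by rewrite -scalerAl subZ ?IH.
- by rewrite mul1r.
- rewrite -mulrA; apply/M_vanishP => n nI [_|k kn]; first by rewrite ev_X0.
  by rewrite ev_XS; have /M_vanishP := IH _ vM; apply => //; exact: ltnW.
- rewrite -mulrA; apply/M_vanishP => n nI k kn; rewrite ev_XGl ?zpt_neq0 //.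
  by have /M_vanishP -> := IH _ vM; rewrite ?mulr0.
Qed.

Lemma ev_gprod k l m z : z != 0 -> ev k z (X ^+ l * gprod K l m) =
  (l == k)%:R * \prod_(l <= i < m) (1 - p ^+ i * z).
Proof.
move=> z0; have lP i : laurent (1 - p ^+ i *: g : A) by exact: laurent_lin.
rewrite ev_Xexp //; last by apply: laurent_prod.
by rewrite /gprod ev_prod //; congr (_ * _); apply: eq_bigr => i _; rewrite ev_lin1.
Qed.

(** A right factor r(g) passes untouched to the second leg of Ad_L (lemma
    coadL_r), where ev k z multiplies it out as r(z). *)
Lemma coadL_ev k z m r : z != 0 -> laurent r ->
  tlift (fun u c => ev k z c *: u) (coadL (X ^+ m * r)) =
  ev 0 z r *: tlift (fun u c => ev k z c *: u) (coadL (X ^+ m)).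
Proof.
move=> z0; have el := @ev_lin K.
have cl := @coadL_lin K.
elim/laurent_ind => {r}[|c s a _ IH].
  rewrite mulr0 (lin0 cl) (lin0 (el _ _)) scale0r (lin0 (tlift_lin _)) //; bil.
rewrite mulrDr -scalerAr (linD cl) (linZ cl) (linD (tlift_lin _)); last bil.
rewrite IH (linZ (tlift_lin _)); last bil.
rewrite coadL_r; last bil.
have -> : ev 0 z (c *: XG 0 s + a) = c * z ^ s + ev 0 z a :> F by rewrite el evXG mul1r.
rewrite [RHS]scalerDl.
apply: (congr2 +%R) => //.
rewrite -scalerA; apply: (congr1 ( *:%R c)); rewrite (lin_tlift _ _ (lin_scalef _ (@lin_id _ _))).
by apply: eq_tlift => u v; rewrite ev_XGr // scalerA mulrC.
Qed.

(** Stability under Ad_L is checked on the functionals ev k (q^(n-1)), k < n, applied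
    to the second leg of Ad_L(X^m r). If m < n then r(q^(n-1)) = 0 already; if m >= n
    then the closed form contains the factor 1 - q^(1-n) g since k <= n-1 < m. *)
Lemma M_crossed I : crossed_submodule (M_ K I).
Proof.
split=> [v /M_vanishP/vanish_counit v0|a v|v /M_vanishP vI]; first exact/eqP.
  exact: M_lideal.
apply/in_tensorP => i; apply/M_vanishP => n nI k kn.
have el := @ev_lin K.
rewrite -(coef_tlift_scale _ _ (el k (zpt n))).
have [N /(_ N (leqnn N)) ->] := lcomp_sum v.
rewrite (lin_sum (@coadL_lin K)) (lin_sum (tlift_lin _)); last bil.
rewrite big1 ?Defs.coef0 // => m _.
rewrite coadL_ev ?zpt_neq0 //; last exact: laurent_lcomp.
rewrite -ev_lcomp; have [mn|nm] := ltnP m n; first by rewrite vI ?scale0r.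
rewrite coadL_Xm; last bil.
rewrite big1 ?scaler0 // => -[l lm] _ /=.
rewrite ev_gprod ?zpt_neq0 //; have [lk|_] := eqVneq l k; last by rewrite mul0r scale0r scaler0.
case: n nI kn nm => // n nI kn nm.
rewrite (@big_cat_nat _ _ _ n) /= ?lk //; last exact: ltnW.
by rewrite [X in _ * (_ * X)]big_ltn // -zptVS mulVf ?zpt_neq0 // subrr mul0r !mulr0 scale0r scaler0.
Qed.

Section Invariant.
Variable M : subspace A.
Hypothesis crM : crossed_submodule M.
Let idM a v : v \in M -> a * v \in M.
Proof. by case: crM => _ + _; apply. Qed.
Let coM v : v \in M -> forall i, coef (coadL v) i \in M.
Proof. by case: crM => _ _ /[apply] /in_tensorP. Qed.

(** The coefficients of this at the first legs g^l and X g^l give the next two lemmas: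
    the first shows that M is graded by the degree in X, the second relates the parts
    of degree l and l+1. *)
Lemma coadL_XGE m s : coadL (XG m s) =
  \sum_(k < m.+1) gb m k *: tens (XG (m - k)%N k%:Z) (X ^+ k * gprod K k m * XG 0 s).
Proof. by rewrite -[LHS]tlift_id coadL_XG //; bil. Qed.

Lemma coadL_coef0 v l : coef (coadL v) (0%N, l%:Z) = X ^+ l * lcomp l v.
Proof.
have ll := @lcomp_lin K; have cl := @coadL_lin K.
have kl := @coef_lin K A (0%N, l%:Z).
apply: (A_ext (f := fun v => coef (coadL v) _) (h := fun v => X ^+ l * lcomp l v)) => [||m s].
- exact: (lin_comp kl cl).
- by lin.
rewrite coadL_XGE pcoef_sum lcompXG big_ord_recr /= subnn pcoefZ coef_tens.
rewrite big1 ?add0r => [|[k km] _ /=].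
  rewrite xpair_eqE eqxx /= eqz_nat gbinn scale1r gprod_small // mulr1.
  by case: eqP => [->|_]; rewrite ?mulr1n ?scale1r // mulr0n scale0r mulr0.
rewrite pcoefZ coef_tens xpair_eqE (negPf (_ : (m - k)%N != 0%N)) ?mulr0n ?scaler0 //.
by rewrite subn_eq0 -ltnNge.
Qed.

Lemma lcomp_in v l : v \in M -> X ^+ l * lcomp l v \in M.
Proof. by move=> vM; rewrite -coadL_coef0; exact: coM. Qed.

Lemma coadL_coef1 r l : laurent r -> coef (coadL (X ^+ l.+1 * r)) (1%N, l%:Z) =
  gb l.+1 l *: (X ^+ l * (1 - p ^+ l *: g) * r).
Proof.
have cl := @coadL_lin K; have kl := @coef_lin K A (1%N, l%:Z).
have <- : gprod K l l.+1 = 1 - p ^+ l *: g by rewrite gprodS // gprod_small // mul1r.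
elim/laurent_ind => {r}[|c s a _ IH].
  by rewrite !mulr0 (lin0 cl) (lin0 kl) scaler0.
rewrite !mulrDr (linD cl) Defs.coefD IH scalerDr; congr (_ + _).
rewrite -!scalerAr (linZ cl) pcoefZ scalerA mulrC -scalerA; congr (_ *: _).
rewrite -XG_split coadL_XGE pcoef_sum (bigD1 (inord l)) //= inordK ?leqnSn //.
rewrite pcoefZ coef_tens subSn // subnn eqxx mulr1n big1 ?addr0 //.
move=> [k km]; rewrite -val_eqE /= inordK ?leqnSn // => kl'.
by rewrite pcoefZ coef_tens xpair_eqE eqz_nat (negPf kl') andbF mulr0n scaler0.
Qed.

Lemma gbin_pred_neq0 l : gb l.+1 l != 0.
Proof.
apply/eqP => g0; have := gbin_pred p l; rewrite g0 mul0r => /esym/eqP.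
by rewrite subr_eq0 eq_sym exprVn invr_eq1 (negPf (hq _)).
Qed.

(** The key constraint on M. *)
Lemma coad_in r l : laurent r -> X ^+ l.+1 * r \in M -> X ^+ l * (1 - p ^+ l *: g) * r \in M.
Proof.
move=> lr rM; apply: (subZK (gbin_pred_neq0 l)).
by rewrite -coadL_coef1 //; exact: coM.
Qed.

(** Right multiplication by g^s is left multiplication up to a power of q. *)
Lemma mulr_in l r t : laurent r -> laurent t -> X ^+ l * r \in M -> X ^+ l * (r * t) \in M.
Proof.
move=> lr + rM; elim/laurent_ind => {t}[|c s a la IH]; first by rewrite !mulr0 sub0.
rewrite !mulrDr subD // -!scalerAr subZ // (laurentC lr (laurentXG _ _)).
have -> : X ^+ l * (XG 0 s * r) = q ^ (s * l%:Z) *: (XG 0 s * (X ^+ l * r)).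
  rewrite !mulrA Xexp !XG_mul -!scalerAl scalerA -expfzDr ?qparam_neq0 // subrr.
  by rewrite mul0r oppr0 expr0z addn0 add0n add0r addr0.
by rewrite subZ // idM.
Qed.

Lemma ev_Xexpl j k z v : ev (j + k) z (X ^+ j * v) = ev k z v.
Proof. by elim: j => [|j IH]; rewrite ?mul1r // exprS -mulrA addSn ev_XS. Qed.

(** Let M_k be the ideal of Laurent polynomials r with X^k r in M. Multiplication
    by X gives that M_k is contained in M_(k+1), and coad_in that it contains
    (1 - q^(-k) g) M_(k+1), which has codimension one in M_(k+1) when M_(k+1) is
    not 0. So M_k is one or the other, according to whether all its elements vanish
    at q^k = q^(n-1), n = k+1; the n for which it is the smaller one are 1
    and the elements of I. As M_k is everything for k >= N, this determines M. *)
Lemma crossed_classification N : X ^+ N \in M ->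
  exists I, admissible I /\ M =i M_ K I.
Proof.
move=> XN; pose jm n := `[< forall v, v \in M -> ev n.-1 (zpt n) v = 0 >].
pose I := [fset n in iota 2 N | jm n]%fset.
have inI n : n \in I = (2 <= n < 2 + N)%N && jm n by rewrite !inE mem_iota.
have XNr r : laurent r -> X ^+ N * r \in M.
  move=> lr; rewrite -[r]mul1r; apply: mulr_in => //; first exact: laurent1.
  by rewrite mulr1.
exists I; split=> [n|]; first by rewrite inI => /andP[/andP[]].
have J1 n : n \in (1%N |` I)%fset -> jm n.
  rewrite !inE /= => /orP[/eqP ->|/andP[_ //]]; apply/asboolP => v vM.
  by case: crM => + _ _ => /(_ v vM)/eqP; rewrite zpt1 counit_ev.
(* Downward induction on k, from N. *)
have C d k r : (N <= k + d)%N -> laurent r ->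
    (forall n, n \in (1%N |` I)%fset -> (k < n)%N -> ev 0 (zpt n) r = 0) -> X ^+ k * r \in M.
  elim: d k r => [|d IH] k r.
    by rewrite addn0 => Nk lr _; rewrite -(subnK Nk) exprD -mulrA; apply/idM/XNr.
  have [Nk _ lr _|kN] := leqP N k.
    by rewrite -(subnK Nk) exprD -mulrA; apply/idM/XNr.
  rewrite addnS -addSn => {}/IH IH lr r0.
  have zn0 := zpt_neq0; have zk0 := zn0 k.+1.
  have [kI|kI] := boolP (k.+1 \in (1%N |` I)%fset).
    have [r' lr' rE] := laurent_div zk0 lr.
    rewrite r0 // scale0r add0r in rE; rewrite rE zptVS mulrA.
    apply: coad_in => //; apply: IH => // n nI kn; have := r0 n nI (ltnW kn).
    rewrite rE ev_laurent // ev_lin1 // => /eqP; rewrite mulf_eq0 => /orP[|/eqP //].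
    rewrite subr_eq0 eq_sym => /eqP/(congr1 (fun x => zpt k.+1 * x)).
    rewrite mulr1 mulrA mulfV // mul1r => /zpt_inj nk.
    by rewrite nk ltnn in kn.
  have /asboolPn : ~~ jm k.+1.
    apply: contra kI => jk; rewrite in_fset1U inI jk andbT eqSS.
    by have [//|k0] := eqVneq k 0%N; lia.
  (* Some h in M_k has h(q^k) <> 0. Write h = h(q^k) + (1 - q^(-k) g) b; both h r and
     (1 - q^(-k) g) b r lie in M_k, hence so does their difference h(q^k) r. *)
  move=> /existsNP[v /not_implyP[vM /= vk]].
  have [b lb hE] := laurent_div zk0 (laurent_lcomp k v).
  rewrite -ev_lcomp zptVS in hE.
  have hM := lcomp_in k vM.
  have /(mulr_in (laurent_lcomp k v) lr) := hM.
  have bM : X ^+ k.+1 * (b * r) \in M.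
    apply: IH => [|n nI kn]; first exact: laurentM.
    by rewrite ev_laurent // r0 ?mulr0 // ltnW.
  have := coad_in (laurentM lb lr) bM.
  rewrite {1}hE => M1 M2; have := subB M2 M1.
  rewrite mulrDl mulrDr !mulrA addrK -scalerAr -scalerAl mulr1.
  by apply: subZK; apply/eqP.
move=> v; apply/idP/M_vanishP => [vM n nI k kn|vI].
  (* For k < n the value of the degree k part of v is that of the degree n-1 part of
     X^(n-1-k) v, which also lies in M. *)
  have [j nE] : exists j, n.-1 = (j + k)%N by exists (n.-1 - k)%N; lia.
  by have /asboolP/(_ _ (idM (X ^+ j) vM)) := J1 n nI; rewrite nE ev_Xexpl.
have [m /(_ m (leqnn m)) ->] := lcomp_sum v.
apply: sub_sum => k _; apply: (C N); first exact: leq_addl.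
  exact: laurent_lcomp.
by move=> n nI kn; rewrite -ev_lcomp vI.
Qed.
End Invariant.
End CrossedSubmodules.

(** * Interpolation at the points q^(n-1) *)

Section Pairs.
Variable I : {fset nat}.
Definition pairs : seq (nat * nat) := [seq (n, k) | n <- enum_fset I, k <- iota 0 n].
Lemma size_pairs : size pairs = (\sum_(n <- I) n)%N.
Proof.
rewrite size_allpairs_dep sumnE big_map.
by apply: eq_bigr => n _; rewrite size_iota.
Qed.
Lemma uniq_pairs : uniq pairs.
Proof.
apply: allpairs_uniq_dep => [|n _|]; [exact: fset_uniq | exact: iota_uniq |].
by move=> [a b] [c d] _ _ /= [-> ->].
Qed.
Lemma mem_pairs n k : ((n, k) \in pairs) = (n \in I) && (k < n)%N.
Proof.
apply/allpairsPdep/andP => [[m [l [mI]]]|[nI kn]].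
  by rewrite mem_iota => /andP[_ lm] [-> ->].
by exists n, k; rewrite mem_iota.
Qed.
Lemma in_fset1U_I n : n \in I -> n \in (1%N |` I)%fset.
Proof. by rewrite in_fset1U => ->; rewrite orbT. Qed.
End Pairs.

Section Interpolation.
Variable K : qField.
Local Notation F := (qbase K).
Local Notation q := (qparam K).
Local Notation A := (Cq K).
Local Notation X := (genX K).
Local Notation g := (geng K).
Local Notation zpt := (zpt K).
Implicit Types (I J : {fset nat}) (M : subspace A).
Hypothesis hq : forall n, (0 < n)%N -> q ^+ n != 1.
Let zn0 n : zpt n != 0. Proof. exact: zpt_neq0. Qed.

(** The interpolation polynomials at the points q^(n-1), n in I or n = 1, normalised
    by factors 1 - g/z. The point 1 = q^0 takes care of the counit. *)
Definition lagrange I (n : nat) : A :=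
  (\prod_(m <- (1%N |` I)%fset | m != n) (1 - (zpt m)^-1 * zpt n))^-1 *:
  \prod_(m <- (1%N |` I)%fset | m != n) (1 - (zpt m)^-1 *: g).

Lemma laurent_lagrange I n : laurent (lagrange I n).
Proof. by apply: laurentZ; apply: laurent_prod => m _; exact: laurent_lin. Qed.

Lemma ev_lagrange I n m : m \in (1%N |` I)%fset -> ev 0 (zpt m) (lagrange I n) = (m == n)%:R.
Proof.
move=> mI; rewrite (linZ (@ev_lin _ _ _)) ev_prod //; last by move=> *; exact: laurent_lin.
have [-> {m mI}|mn] := eqVneq m n.
  rewrite [X in _ *: X](eq_bigr (fun m => 1 - (zpt m)^-1 * zpt n)); last first.
    by move=> m _; rewrite ev_lin1.
  apply: mulVf; rewrite prodf_seq_neq0; apply/allP => m _; apply/implyP => mn.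
  rewrite subr_eq0 eq_sym.
  apply: contra mn => /eqP/(congr1 (fun x => zpt m * x)).
  by rewrite mulrA mulfV // mul1r mulr1 => /(zpt_inj hq) ->.
rewrite [X in _ *: X](big_rem m) //= mn ev_lin1 // mulVf // subrr mul0r.
exact: mulr0.
Qed.

Lemma ev_Xlagrange I n m j k : m \in (1%N |` I)%fset ->
  ev j (zpt m) (X ^+ k * lagrange I n) = ((n, k) == (m, j))%:R.
Proof.
move=> mI; rewrite ev_Xexp // ?ev_lagrange //; last exact: laurent_lagrange.
by rewrite xpair_eqE [n == m]eq_sym -natrM mulnb andbC.
Qed.
Lemma counit_Xlagrange I n k : n != 1%N -> counit (X ^+ k * lagrange I n) = 0.
Proof.
move=> n1; rewrite counit_ev -(zpt1 K) ev_Xlagrange ?fset1U1 // xpair_eqE.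
by rewrite (negPf n1).
Qed.

(** The polynomial vanishing at exactly the points of I and 1 lies in M_I. *)
Lemma M_sub I J : admissible J -> {subset M_ K I <= M_ K J} -> {subset J <= I}.
Proof.
move=> aJ IJ n nJ; apply: contrapT => /negP nI.
have n2 := aJ n nJ.
pose r : A := \prod_(m <- (1%N |` I)%fset) (1 - (zpt m)^-1 *: g).
have lr : laurent r by apply: laurent_prod => i _; exact: laurent_lin.
have /IJ/(M_vanishP hq)/(_ n (in_fset1U_I nJ) 0%N (ltnW n2))/eqP : r \in M_ K I.
  apply/(M_vanishP hq) => m mI k _; rewrite -[r]mul1r -(expr0 X) ev_Xexp //.
  rewrite /r ev_prod //; last by move=> i _; exact: laurent_lin.
  by rewrite (big_rem m) //= ev_lin1 // mulVf // subrr mul0r mulr0.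
rewrite /r ev_prod //; last by move=> i _; exact: laurent_lin.
apply/negP; rewrite prodf_seq_neq0; apply/allP => m mI /=; rewrite ev_lin1 //.
rewrite subr_eq0 eq_sym; apply/eqP => /(congr1 (fun x => zpt m * x)).
rewrite mulrA mulfV // mul1r mulr1 => /(zpt_inj hq) nm.
move: mI; rewrite -nm in_fset1U (negPf nI) orbF => /eqP n1.
by rewrite n1 in n2.
Qed.
Lemma M_inj I J : admissible I -> admissible J -> M_ K I =i M_ K J -> I = J.
Proof.
move=> aI aJ IJ; apply/fsetP => n; apply/idP/idP.
  by apply: M_sub => // m; rewrite IJ.
by apply: M_sub => // m; rewrite IJ.
Qed.

Definition evcoord I (p : nat * nat) (v : kerQ (M_ K I)) : F := ev p.2 (zpt p.1) (kval v).
Lemma evcoord_rho I n k a : n \in I -> (k < n)%N -> counit a = 0 ->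
  evcoord (n, k) (rho (M_ K I) a) = ev k (zpt n) a.
Proof.
move=> nI kn a0; rewrite /evcoord /=; apply: subr0_eq; rewrite -(linB (@ev_lin _ _ _)).
by have /(M_vanishP hq) -> := rho_kvalB (M_ K I) a0; rewrite ?in_fset1U_I.
Qed.
Lemma evcoord_lin I n k : n \in I -> (k < n)%N -> linear (evcoord (n, k) : kerQ (M_ K I) -> F^o).
Proof.
move=> nI kn c u v; have [a a0 ->] := rhoP u; have [b b0 ->] := rhoP v.
rewrite -[c *: rho _ a + rho _ b](rho_lin (M_ K I)) !evcoord_rho //; first exact: ev_lin.
by rewrite counitD counitZ a0 b0 mulr0 addr0.
Qed.

(** M_vanishP; the point n = 1 contributes nothing on ker eps, where it is the counit. *)
Lemma kerQ_eqP I (u v : kerQ (M_ K I)) :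
  (forall n k, n \in I -> (k < n)%N -> evcoord (n, k) u = evcoord (n, k) v) -> u = v.
Proof.
have [a a0 ->] := rhoP u; have [b b0 ->] := rhoP v => E.
apply/eqP; rewrite rho_eqB ?a0 //; apply/(M_vanishP hq) => n nI k kn.
rewrite (linB (@ev_lin _ _ _)); move: nI; rewrite in_fset1U => /orP[/eqP n1|nI].
  move: kn; rewrite {}n1 ltnS leqn0 => /eqP ->; rewrite zpt1 -!counit_ev a0 b0; exact: subrr.
by apply/eqP; rewrite subr_eq0 -!(evcoord_rho nI kn) // E.
Qed.

(** The X^k times the Lagrange polynomials of n, k < n, are dual to the ev k (q^(n-1)). *)
Lemma codim_M I : admissible I -> codim (M_ K I) (\sum_(n <- I) n)%N.
Proof.
move=> aI; rewrite -size_pairs.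
exists (fun i => let p := nth (0, 0)%N (pairs I) i in rho (M_ K I) (X ^+ p.2 * lagrange I p.1)).
have c0 n k : n \in I -> counit (X ^+ k * lagrange I n) = 0.
  by move=> /aI n2; apply: counit_Xlagrange; apply: contraL n2 => /eqP ->.
have fE n k m j : n \in I -> m \in I -> (j < m)%N ->
    evcoord (m, j) (rho (M_ K I) (X ^+ k * lagrange I n)) = ((m, j) == (n, k))%:R.
  move=> nI mI jm; rewrite evcoord_rho ?c0 // ev_Xlagrange ?in_fset1U_I //.
  by rewrite eq_sym.
apply: (@basis_of_dual _ _ _ _ (0, 0)%N (pairs I)
  (fun p => rho (M_ K I) (X ^+ p.2 * lagrange I p.1)) (@evcoord I)).
- exact: uniq_pairs.
- by [].
- by move=> [n k]; rewrite mem_pairs => /andP[nI kn]; exact: evcoord_lin.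
- by move=> [m j] [n k]; rewrite !mem_pairs => /andP[mI jm] /andP[nI kn]; exact: fE.
move=> v _; apply: kerQ_eqP => n k nI kn; have cl := evcoord_lin nI kn.
rewrite (lin_sum cl) (bigD1_seq (n, k)) ?uniq_pairs //=; last by rewrite mem_pairs nI.
rewrite (linZ cl) fE // eqxx big1_seq ?addr0; first by rewrite [RHS]mulr1.
move=> [m j] /= /andP[mn]; rewrite mem_pairs => /andP[mI jm].
by rewrite (linZ cl) fE // eq_sym (negPf mn); exact: mulr0.
Qed.

(** Finitely many powers of X are dependent modulo M, and M is graded in the
    degree of X. *)
Lemma codim_Xexp M d : crossed_submodule M -> codim M d -> exists N, X ^+ N \in M.
Proof.
move=> crM [e eb].
have [c [j cj] c0] := basis_dependent (u := fun i : 'I_d.+1 => rho M (X ^+ i.+1)) eb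
  (fun _ => isT) (leqnn _).
have Xc i : counit (X ^+ i.+1) = 0 by rewrite exprS counitM counitX mul0r.
have : \sum_i c i *: X ^+ i.+1 \in M.
  rewrite -rho_eq0.
    apply/eqP; rewrite (lin_sum (@rho_lin _ M)); apply: etrans c0; apply: eq_bigr => i _.
    by rewrite (linZ (@rho_lin _ M)).
  by rewrite (lin_sum (@counit_lin K)) big1 // => i _; rewrite (linZ (@counit_lin K)) Xc; exact: mulr0.
move=> /(lcomp_in crM j.+1).
rewrite (lin_sum (@lcomp_lin K _)) (bigD1 j) //= big1 ?addr0 => [|i ij].
  rewrite (linZ (@lcomp_lin K _)) Xexp lcompXG eqxx scale1r -scalerAr mulr1 => /(subZK cj) XM.
  by exists j.+1; rewrite Xexp.
rewrite (linZ (@lcomp_lin K _)) Xexp lcompXG eqSS.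
by rewrite val_eqE (negPf ij) scale0r scaler0.
Qed.
End Interpolation.

(** * The pairing *)

Section Pairing.
Variable K : qField.
Local Notation F := (qbase K).
Local Notation q := (qparam K).
Local Notation XG := (XG K).

Definition pconst (n : nat) : F := qfact K n * q ^- 'C(n, 2).

Lemma pairing_linl a : linear (fun x => pairing x a : F^o).
Proof.
have D : {morph (fun x => pairing x a : F^o) : x y / x + y}.
  apply: mextD => i u v; apply: mext_add => j w.
  by case: eqP => _; rewrite ?addr0 // !mulrDl.
apply: linP => // c; elim/pbw_ind => [x y IH IH'|i u].
  by rewrite scalerDr !D IH IH' scalerDr.
rewrite monoZ /pairing !mext_mono => [|j|j].
- elim/pbw_ind: a {D} => [a b IH IH'|j v].
    have D b' : {morph mext (W := F) (fun (j : nat * int) (d : F^o) =>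
        if i.1 == j.1 then b' * d * (qfact K i.1 * q ^- 'C(i.1, 2) * q ^ (- (i.2 * j.2))) else 0)
        : x y / x + y}.
      by apply: mextD => j v w; case: eqP => _; rewrite ?addr0 // mulrDr mulrDl.
    by rewrite !D IH IH' scalerDr.
  rewrite !mext_mono => [|l|l]; last 2 first.
  + by case: eqP => _ //; rewrite mulr0 mul0r.
  + by case: eqP => _ //; rewrite mulr0 mul0r.
  by case: eqP => _; rewrite ?scaler0 //; rewrite -!mulrA.
- by rewrite [@mext]unlock big1 // => l _; case: eqP => _ //; rewrite !mul0r.
- by rewrite [@mext]unlock big1 // => l _; case: eqP => _ //; rewrite !mul0r.
Qed.

(** The elements X^n g^s of the dual side are evaluation functionals: this ties the
    points q^(n-1) of M_I to the exponents 1-n of L_I. *)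
Lemma pairing_XG n s a : pairing (XG n s) a = pconst n * ev n (q ^ (- s)) a.
Proof.
have el := @ev_lin K.
rewrite /pairing {1}/Defs.XG mext_mono /=; last first.
  by move=> l; rewrite [@mext]unlock big1 // => i _; case: eqP => _ //; rewrite !mul0r.
elim/pbw_ind: a => [a b IH IH'|j v].
  rewrite mextD ?IH ?IH' ?(linD (el _ _)) ?mulrDr // => i u w.
  by case: eqP => _; rewrite ?addr0 // !mulrDr mulrDl.
rewrite mext_mono => [|l]; last by case: eqP => _ //; rewrite mulr0 mul0r.
rewrite monoE (linZ (el _ _)) evXG eq_sym; case: eqP => _; last by rewrite mul0r scaler0 mulr0.
rewrite !mul1r -/(pconst n) mulrA [v * _]mulrC -!mulrA; congr (_ * (_ * _)).
by rewrite exprz_exp mulNr.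
Qed.
End Pairing.

(** * The spaces L_I *)

Section Tangent.
Variable K : qField.
Local Notation F := (qbase K).
Local Notation q := (qparam K).
Local Notation A := (Cq K).
Local Notation X := (genX K).
Local Notation XG := (XG K).
Local Notation p := (q^-1).
Implicit Types (I J : {fset nat}) (L : subspace A).
Hypothesis hq : forall n, (0 < n)%N -> q ^+ n != 1.

(** X^k g^s corrected by a constant so as to lie in ker eps. Since tgen 0 0 = 0, the
    index (0, 0) is always to be treated apart. *)
Definition tgen (k : nat) (s : int) : A := XG k s - ((k == 0%N)%:R : F)%:A.
Lemma tgenE k s : tgen k s = XG k s - ((k == 0%N)%:R : F)%:A.
Proof. by []. Qed.
Lemma tgen0 s : tgen 0 s = XG 0 s - 1. Proof. by rewrite /tgen scale1r. Qed.
Lemma tgenS k s : tgen k.+1 s = XG k.+1 s. Proof. by rewrite /tgen scale0r subr0. Qed.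
Lemma tgen00 : tgen 0 0 = 0. Proof. by rewrite tgen0 XG01 subrr. Qed.
Lemma counit_XG n s : counit (XG n s) = (n == 0%N)%:R.
Proof. by rewrite counit_ev evXG exp1rz mulr1. Qed.
Lemma counit_tgen k s : counit (tgen k s) = 0.
Proof. by rewrite /tgen counitB counitZ counit1 mulr1 counit_XG subrr. Qed.
Lemma coef_tgen k s i : (k, s) != (0%N, 0) -> coef (tgen k s) i = ((k, s) == i)%:R - ((k == 0%N) && (i == (0%N, 0)))%:R.
Proof.
move=> ks; rewrite /tgen pcoefB pcoefZ -(XG01 K) !coef_XG [(0%N, 0) == i]eq_sym.
by congr (_ - _); rewrite -mulnb natrM.
Qed.

Lemma sum_tgen (x : A) : counit x = 0 ->
  x = \sum_(i <- msupp (x : {malg F^o[(nat * int)%type]})) coef x i *: tgen i.1 i.2.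
Proof.
move=> x0; rewrite /tgen; under eq_bigr do rewrite scalerBr.
rewrite sumrB -[X in X - _]A_sumE.
have E : \sum_(i <- msupp (x : {malg F^o[(nat * int)%type]}))
    coef x i *: (((i.1 == 0%N)%:R : F)%:A : A) = (counit x)%:A.
  transitivity ((counit (\sum_(i <- msupp (x : {malg F^o[(nat * int)%type]}))
      coef x i *: XG i.1 i.2))%:A : A); last by rewrite -A_sumE.
  rewrite (lin_sum (@counit_lin K)) scaler_suml.
  by apply: eq_bigr => i _; rewrite counitZ counit_XG scalerA.
by rewrite E x0 scale0r subr0.
Qed.

(** Where the elements of L_I may have nonzero coefficients; the coefficient at
    (0, 0) is then determined by the counit. *)
Definition L_supp I (k : nat) (s : int) :=
  (k = 0%N /\ s = 0) \/ exists2 n, n \in I & (k < n)%N /\ s = 1 - n%:Z.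

Lemma tgen_in I n k : n \in I -> (k < n)%N -> tgen k (1 - n%:Z) \in L_ K I.
Proof.
move=> nI kn; apply/asboolP; exists [:: (1, tgen k (1 - n%:Z))].
rewrite big_seq1 scale1r; split=> // x; rewrite inE => /eqP -> /=.
exists n => //; case: k kn => [|k] kn; first by left; rewrite tgen0.
by right; exists k.+1; rewrite ?tgenS //; lia.
Qed.

Lemma L_ind I (P : A -> Prop) : admissible I -> P 0 ->
  (forall c x y, P x -> P y -> P (c *: x + y)) ->
  (forall n k, n \in I -> (k < n)%N -> P (tgen k (1 - n%:Z))) -> forall x, x \in L_ K I -> P x.
Proof.
move=> aI P0 PL Pt x /asboolP[s [sP ->]]; elim: s sP => [|y s IH] sP; first by rewrite big_nil.
rewrite big_cons; apply: PL; last by apply: IH => z zs; apply: sP; rewrite inE zs orbT.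
have [n nI] := sP y (mem_head _ _); have n2 := aI n nI.
case=> [->|[[|k] kn ->]] //; first by rewrite -tgen0; apply: Pt => //; lia.
by rewrite -tgenS; apply: Pt => //; lia.
Qed.

(** L_I is spanned by members of the family tgen, hence is cut out by a support
    condition. *)
Lemma L_suppP I x : admissible I -> x \in L_ K I <->
  counit x = 0 /\ forall k s, ~ L_supp I k s -> coef x (k, s) = 0.
Proof.
move=> aI; split=> [|[x0 xs]].
  elim/(@L_ind I) => // [|c y z [y0 ys] [z0 zs]|n k nI kn].
  - by split=> *; [exact: (lin0 (@counit_lin K)) | exact: Defs.coef0].
  - split=> [|k s ks]; first by rewrite counitD counitZ y0 z0 mulr0 addr0.
    by rewrite Defs.coefD pcoefZ ys // zs // scaler0 addr0.
  - have n2 := aI n nI; split=> [|l s ls]; first exact: counit_tgen.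
    rewrite coef_tgen; last by apply/eqP => -[_]; lia.
    case: eqP => [[kl sl]|_]; first by case: ls; right; exists n; rewrite // -kl -sl.
    have -> : ((l, s) == (0%N, 0)) = false.
      by apply/eqP => -[l0 s0]; apply: ls; left.
    by rewrite andbF subrr.
rewrite (sum_tgen x0); apply: sub_sum => -[k s] _.
change (coef x (k, s) *: tgen k s \in L_ K I).
have [[[-> ->]|[n nI [kn ->]]]|/xs ->] := EM (L_supp I k s).
- by rewrite tgen00 scaler0; exact: sub0.
- by apply: (@subZ _ _ (L_ K I)); exact: tgen_in.
- by rewrite scale0r; exact: (@sub0 _ _ (L_ K I)).
Qed.

Lemma L_eq0 I x : admissible I -> x \in L_ K I ->
  (forall n k, n \in I -> (k < n)%N -> coef x (k, 1 - n%:Z) = 0) -> x = 0.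
Proof.
move=> aI /(L_suppP _ aI)[x0 xs] xz; rewrite (sum_tgen x0) big1_seq // => -[k s] _ /=.
have [[[-> ->]|[n nI [kn ->]]]|/xs ->] := EM (L_supp I k s).
- by rewrite tgen00 scaler0.
- by rewrite xz // scale0r.
- by rewrite scale0r.
Qed.

Lemma L_dim I : admissible I -> has_dim (L_ K I) (\sum_(n <- I) n)%N.
Proof.
move=> aI; rewrite -size_pairs.
exists (fun i => let p := nth (0, 0)%N (pairs I) i in tgen p.2 (1 - p.1%:Z)).
pose f (p : nat * nat) (x : A) : F := coef x (p.2, 1 - p.1%:Z).
have fl p : linear (f p : A -> F^o) by exact: coef_lin.
have fE n k m j : n \in I -> m \in I -> (j < m)%N ->
    f (m, j) (tgen k (1 - n%:Z)) = ((m, j) == (n, k))%:R.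
  move=> /aI n2 /aI m2 jm; rewrite /f coef_tgen; last by apply/eqP => -[_]; lia.
  rewrite [(_ == (0%N, 0))](_ : _ = false) ?andbF ?subr0; last by apply/eqP => -[_]; lia.
  congr (_%:R); rewrite !xpair_eqE andbC [j == k]eq_sym; congr (_ && _ : nat).
  by rewrite /=; apply/eqP/eqP; lia.
apply: (@basis_of_dual _ _ _ _ (0, 0)%N (pairs I) (fun p => tgen p.2 (1 - p.1%:Z)) f).
- exact: uniq_pairs.
- by move=> [n k]; rewrite mem_pairs => /andP[nI kn]; exact: tgen_in.
- by [].
- by move=> [m j] [n k]; rewrite !mem_pairs => /andP[mI jm] /andP[nI kn]; exact: fE.
move=> v vL; apply: subr0_eq; apply: (L_eq0 aI).
  apply: subB => //; rewrite big_seq; apply: sub_sum => -[n k].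
  by rewrite mem_pairs => /andP[nI kn]; apply: subZ; exact: tgen_in.
move=> n k nI kn; rewrite -[coef _ _]/(f (n, k) _) (linB (fl _)).
rewrite (lin_sum (fl _)) (bigD1_seq (n, k)) ?uniq_pairs //=; last by rewrite mem_pairs nI.
rewrite (linZ (fl _)) fE // eqxx big1_seq ?addr0; first by rewrite [X in _ - X]mulr1 subrr.
move=> [m j] /= /andP[mn]; rewrite mem_pairs => /andP[mI jm].
by rewrite (linZ (fl _)) fE // eq_sym (negPf mn); exact: mulr0.
Qed.

Lemma L_inj_sub I J : admissible I -> admissible J ->
  {subset L_ K I <= L_ K J} -> {subset I <= J}.
Proof.
move=> aI aJ IJ n nI; have n2 := aI n nI.
have /IJ/(L_suppP _ aJ)[_ ts] : tgen 0 (1 - n%:Z) \in L_ K I by apply: tgen_in => //; lia.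
have [[[_]|[m mJ [_ nm]]]|/ts] := EM (L_supp J 0 (1 - n%:Z)).
- lia.
- by have -> : n = m by lia.
rewrite coef_tgen; last by apply/eqP => -[]; lia.
rewrite !eqxx [(_ == (0%N, 0))](_ : _ = false); last by apply/eqP => -[]; lia.
by rewrite andbF subr0 => /eqP; rewrite (oner_eq0 F).
Qed.
Lemma L_inj I J : admissible I -> admissible J -> L_ K I =i L_ K J -> I = J.
Proof.
move=> aI aJ IJ; apply/fsetP => n; apply/idP/idP.
  by apply: L_inj_sub => // m; rewrite IJ.
by apply: L_inj_sub => // m; rewrite IJ.
Qed.

Lemma L_sub1 I n : n \in I -> {subset L_ K [fset n]%fset <= L_ K I}.
Proof.
move=> nI x /asboolP[s [sP ->]]; apply/asboolP; exists s; split=> // y /sP[m].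
by rewrite inE => /eqP -> h; exists n.
Qed.

Lemma L_direct_sum I : admissible I ->
  direct_sum I (L_ K I) (fun n => L_ K [fset n]%fset).
Proof.
move=> aI; have a1 n : n \in I -> admissible [fset n]%fset.
  by move=> /aI n2 m; rewrite inE => /eqP ->.
have cl i := @coef_lin K (F^o) i.
have out n x k m : n \in I -> m \in I -> n != m -> x \in L_ K [fset n]%fset -> coef x (k, 1 - m%:Z) = 0.
  move=> nI mI nm /(L_suppP _ (a1 n nI))[_]; apply => -[[_]|[l]]; first by have := aI _ mI; lia.
  by rewrite inE => /eqP -> [_ E]; move/eqP: nm; apply; lia.
split=> [x|y yL y0 i].
  split=> [xL|[y yL ->]]; last by apply: sub_sum => i _; exact: (L_sub1 (valP i)) (yL i).
  pose y (i : I) := \sum_(k < val i) coef x (val k, 1 - (val i)%:Z) *: tgen k (1 - (val i)%:Z).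
  have yL i : y i \in L_ K [fset (val i)]%fset.
    by apply: sub_sum => k _; apply: subZ; apply: tgen_in; rewrite ?inE.
  exists [ffun i => y i] => [i|]; first by rewrite ffunE.
  apply: subr0_eq; apply: (L_eq0 aI).
    apply: subB => //; apply: sub_sum => i _; rewrite ffunE; exact: (L_sub1 (valP i)) (yL i).
  move=> n k nI kn; rewrite pcoefB pcoef_sum (bigD1 [` nI]%fset) //= big1 ?addr0; last first.
    move=> i; rewrite -val_eqE /= => ni; rewrite ffunE.
    by apply: (out (val i)) => //; exact: valP.
  rewrite ffunE pcoef_sum (bigD1 (Ordinal kn)) //= pcoefZ coef_tgen; last first.
    by have := aI _ nI; rewrite xpair_eqE negb_and => ?; apply/orP; right; lia.
  rewrite eqxx [(_ == (0%N, 0))](_ : _ = false); last first.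
    by have := aI _ nI => ?; apply/eqP => -[_]; lia.
  rewrite andbF subr0 [_ *: 1]mulr1 big1 ?addr0 ?subrr // => l; rewrite -val_eqE /= => lk.
  rewrite pcoefZ coef_tgen; last first.
    by have := aI _ nI; rewrite xpair_eqE negb_and => ?; apply/orP; right; lia.
  rewrite [(_ == (0%N, 0))](_ : _ = false); last first.
    by have := aI _ nI => ?; apply/eqP => -[_]; lia.
  by rewrite xpair_eqE (negPf lk) andbF subr0 scaler0.
have iI := valP i; apply: (L_eq0 (a1 _ iI)) => // n k; rewrite inE => /eqP -> kn.
have := congr1 (fun x => coef x (k, 1 - (val i)%:Z)) y0; cbv beta.
rewrite Defs.coef0 pcoef_sum (bigD1 i) //= big1 ?addr0 // => j ji.
by apply: (out (val j)) => //; exact: valP.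
Qed.
End Tangent.

(** * Quantum tangent spaces *)

Section TangentSpaces.
Variable K : qField.
Local Notation F := (qbase K).
Local Notation q := (qparam K).
Local Notation A := (Cq K).
Local Notation X := (genX K).
Local Notation g := (geng K).
Local Notation XG := (XG K).
Local Notation tgen := (tgen K).
Local Notation p := (q^-1).
Local Notation gb := (gbin p).
Implicit Types (I J : {fset nat}) (L : subspace A).
Hypothesis hq : forall n, (0 < n)%N -> q ^+ n != 1.

Lemma adL_linl x : linear (fun h : A => adL h x).
Proof. rewrite /adL; lin. Qed.
Lemma adL_linr h : linear (fun x : A => adL h x).
Proof. rewrite /adL; lin. Qed.
Lemma adLM (a b x : A) : adL (a * b) x = adL a (adL b x).
Proof.
rewrite /adL sw_mul; last bil.
apply: eq_sw => a1 a2.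
rewrite (lin_sw _ _ (lin_mulr _ (lin_mull _ (@lin_id _ _)))).
by apply: eq_sw => b1 b2; rewrite antipodeM !mulrA.
Qed.
Lemma adL1 (x : A) : adL 1 x = x.
Proof. by rewrite /adL sw_1 ?antipode1 ?mul1r ?mulr1 //; bil. Qed.

Lemma adL_grp_XG t k s : adL (XG 0 t) (XG k s) = q ^ (- (t * k%:Z)) *: XG k s.
Proof.
rewrite /adL sw_XG0; last bil.
rewrite antipode_XG zpow_antipode mulr1 XG_mul -scalerAl XG_mul mulr0 oppr0 expr0z scale1r.
by rewrite add0n addn0 addrAC subrr add0r.
Qed.
Lemma adL_grp_tgen t k s : adL (XG 0 t) (tgen k s) = q ^ (- (t * k%:Z)) *: tgen k s.
Proof.
rewrite tgenE (linB (adL_linr _)) adL_grp_XG scalerBr; congr (_ - _).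
rewrite (linZ (adL_linr _)) -(XG01 K) adL_grp_XG mulr0 oppr0 expr0z scale1r.
case: k => [|k]; last by rewrite !scale0r scaler0.
by rewrite mulr0 oppr0 expr0z [RHS]scale1r.
Qed.
(** X |> x = X x - g x g^-1 X. The coefficient vanishes only for s = -k: the action of
    X runs through the string X^k g^s, X^(k+1) g^s, ..., and breaks off after
    X^(n-1) g^(1-n). *)
Lemma adL_X_XG k s : adL X (XG k s) = (1 - q ^ (- (k%:Z + s))) *: XG k.+1 s.
Proof.
rewrite /adL -[X]mulr1 sw_X; last bil.
rewrite sw_1; last bil.
rewrite antipode1 antipode_X antipode1 !mulr1 mul1r -XGS scalerBl scale1r; congr (_ + _).
rewrite /antX mulrN mulrA gmulXG -!scalerAl /gengV XG_mul mulr0 oppr0 expr0z scale1r addn0 addrK.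
rewrite XGmulX scalerA.
rewrite opprD expfzDr ?qparam_neq0 //; congr (- (_ *: _)).
by rewrite -exprnN exprVn.
Qed.
Lemma adL_X_tgen k s : adL X (tgen k s) = (1 - q ^ (- (k%:Z + s))) *: tgen k.+1 s.
Proof.
rewrite !tgenE (linB (adL_linr _)) adL_X_XG (linZ (adL_linr _)) scale0r subr0.
by rewrite -(XG01 K) adL_X_XG addr0 oppr0 expr0z subrr scale0r scaler0 subr0.
Qed.

(** The map of the coideal condition of tangent spaces. *)
Definition Theta (x : A) : pbw A := sweedler (fun x1 x2 => tens x1 (x2 - (counit x2)%:A)) x.
Lemma Theta_lin : linear Theta.
Proof. by apply: sw_lin; bil. Qed.
(** Only the X^i g^s with i <= n occur in the second leg, with the same s. *)
Lemma Theta_XG n s : Theta (XG n s) =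
  \sum_(i < n.+1) gb n i *: tens (XG (n - i)%N (i%:Z + s)) (tgen i s).
Proof.
rewrite /Theta sw_XG; last bil.
by apply: eq_bigr => i _; rewrite counit_XG.
Qed.
Lemma Theta1 : Theta 1 = 0.
Proof.
by rewrite -(XG01 K) Theta_XG big_ord1 tgen00 (lin0 (tens_linr _)) scaler0.
Qed.
Lemma Theta_tgen n s : Theta (tgen n s) = Theta (XG n s).
Proof. by rewrite tgenE (linB Theta_lin) (linZ Theta_lin) Theta1 scaler0 subr0. Qed.

Lemma in_tensor_lin L (f : A -> pbw A) : linear f -> in_tensor L (f 0) /\
  (forall c x y, in_tensor L (f x) -> in_tensor L (f y) -> in_tensor L (f (c *: x + y))).
Proof.
move=> fl; split=> [|c x y /in_tensorP fx /in_tensorP fy]; apply/in_tensorP => i.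
  by rewrite (lin0 fl) Defs.coef0; exact: (@sub0 _ _ L).
by rewrite fl Defs.coefD pcoefZ subDZ.
Qed.

(** X moves X^k g^(1-n) up to k+1 and kills it at k = n-1; the group-likes act by
    scalars; the coideal map moves k down. *)
Lemma L_tangent I : admissible I -> tangent_space (L_ K I).
Proof.
move=> aI; split=> [x /(L_suppP _ aI)[x0 _]|h x xL|x].
- exact/eqP.
- elim/A_gen_ind: h x xL => [a b IH IH'|c a IH||a IH|t a IH] x xL.
  + by rewrite (linD (adL_linl x)) subD ?IH ?IH'.
  + by rewrite (linZ (adL_linl x)) subZ ?IH.
  + by rewrite adL1.
  + rewrite adLM; move: {x xL IH} (adL a x) (IH x xL); apply: L_ind => //.
    * by rewrite (lin0 (adL_linr _)); exact: (@sub0 _ _ (L_ K I)).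
    * by move=> c x y xL yL; rewrite (adL_linr X) subDZ.
    move=> n k nI; rewrite adL_X_tgen leq_eqVlt => /predU1P[kn|kn].
      rewrite (_ : k%:Z + _ = 0); last lia.
      by rewrite oppr0 expr0z subrr scale0r; exact: (@sub0 _ _ (L_ K I)).
    by rewrite subZ // tgen_in.
  + rewrite adLM; move: {x xL IH} (adL a x) (IH x xL); apply: L_ind => //.
    * by rewrite (lin0 (adL_linr _)); exact: (@sub0 _ _ (L_ K I)).
    * by move=> c x y xL yL; rewrite (adL_linr (XG 0 t)) subDZ.
    by move=> n k nI kn; rewrite adL_grp_tgen subZ // tgen_in.
have [T0 TL] := in_tensor_lin (L_ K I) Theta_lin.
move: x; apply: L_ind => // n k nI kn; rewrite -/(Theta _) Theta_tgen Theta_XG.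
apply/in_tensorP => j; rewrite pcoef_sum; apply: (@sub_sum _ _ (L_ K I)) => -[i ik] _.
rewrite pcoefZ; apply: (@subZ _ _ (L_ K I)).
rewrite coef_tens; case: eqP => _; last by rewrite mulr0n; exact: (@sub0 _ _ (L_ K I)).
by rewrite mulr1n; apply: tgen_in => //; exact: leq_ltn_trans kn.
Qed.

Section Classification.
Variable L : subspace A.
Hypothesis tL : tangent_space L.
Let LZ := @subZ _ _ L.

Lemma Theta_in x i : x \in L -> coef (Theta x) i \in L.
Proof. by move=> xL; have /in_tensorP := tangent_coideal tL xL; apply. Qed.

(** The usual elimination: (T - lam k0) kills one summand and rescales the others
    by nonzero factors. *)
Lemma eigen_split (T : A -> A) (lam : nat -> F) (v : nat -> A) (s : seq nat) :
  linear T -> (forall x, x \in L -> T x \in L) -> uniq s -> injective lam ->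
  (forall k, T (v k) = lam k *: v k) -> \sum_(k <- s) v k \in L ->
  forall k, k \in s -> v k \in L.
Proof.
move=> Tl TL + lami; elim: s v => [|k0 s IH] v //= /andP[k0s us] Tv; rewrite big_cons => sL.
have vs k : k \in s -> v k \in L.
  move=> ks; have : (lam k - lam k0) *: v k \in L.
    apply: (IH (fun k => (lam k - lam k0) *: v k)) => // [j|].
      by rewrite (linZ Tl) Tv scalerA mulrC -scalerA.
    have := subB (TL _ sL) (LZ (lam k0) sL).
    rewrite (linD Tl) (lin_sum Tl) Tv scalerDr opprD addrACA subrr add0r.
    rewrite scaler_sumr -sumrB.
    by under eq_bigr do rewrite Tv -scalerBl.
  apply: subZK; rewrite subr_eq0; apply: contra k0s => /eqP/lami <-; exact: ks.
move=> k; rewrite inE => /predU1P[->|]; last exact: vs.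
have S : \sum_(k <- s) v k \in L by rewrite big_seq; apply: sub_sum => j /vs.
by have := subB sL S; rewrite addrK.
Qed.

(** The action of g has the eigenvalue q^(-k) in degree k. *)
Lemma tangent_lcomp x k : x \in L -> X ^+ k * lcomp k x \in L.
Proof.
move=> xL; have [N0 xE] := lcomp_sum x.
pose N := maxn N0 k.+1; have := xE N (leq_maxl _ _).
rewrite -(big_mkord xpredT (fun k => X ^+ k * lcomp k x)) => E.
apply: (eigen_split (T := adL g) (lam := fun k => q ^ (- k%:Z)) (v := fun k => X ^+ k * lcomp k x)
  (s := index_iota 0 N)).
- exact: adL_linr.
- by move=> y yL; exact: tangent_adL.
- exact: iota_uniq.
- by move=> i j /(qexpz_inj hq); lia.
- move=> i; have ll := @lcomp_lin K; have al := adL_linr.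
  apply: (A_ext (f := fun x => adL g (X ^+ i * lcomp i x))
    (h := fun x => q ^ (- i%:Z) *: (X ^+ i * lcomp i x))) => [||n s]; try lin.
  rewrite lcompXG; case: eqP => _; last by rewrite scale0r mulr0 (lin0 (al _)) scaler0.
  by rewrite scale1r -XG_split adL_grp_XG mul1r.
- by rewrite -E.
- by rewrite mem_index_iota /N leq_maxr.
Qed.

(** In the homogeneous part of degree k, the first leg g^(k+s) of the coideal map
    singles out the monomial X^k g^s. Tangent spaces are thus spanned by members of
    the family tgen. *)
Lemma tangent_coef x k s : x \in L -> coef x (k, s) *: tgen k s \in L.
Proof.
move=> /(tangent_lcomp k)/(Theta_in (0%N, k%:Z + s)).
suff -> : coef (Theta (X ^+ k * lcomp k x)) (0%N, k%:Z + s) = coef x (k, s) *: tgen k s by [].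
have ll := @lcomp_lin K; have Tl := Theta_lin.
have kl := @coef_lin K (F^o) (k, s); have kl' := @coef_lin K A (0%N, k%:Z + s).
apply: (A_ext (f := fun x => coef (Theta (X ^+ k * lcomp k x)) (0%N, k%:Z + s))
    (h := fun x => coef x (k, s) *: tgen k s)) => [||n r]; try lin.
rewrite lcompXG coef_XG xpair_eqE; case: eqP => [_|_]; last first.
  by rewrite !scale0r mulr0 (lin0 Tl) Defs.coef0.
rewrite scale1r -XG_split Theta_XG pcoef_sum big_ord_recr /= big1 => [|[i ik] _ /=].
  rewrite gbinn scale1r subnn coef_tens xpair_eqE eqxx /= add0r (inj_eq (addrI _)).
  by case: eqP => [->|_]; rewrite ?mulr1n ?scale1r // mulr0n scale0r.
rewrite pcoefZ coef_tens xpair_eqE (negPf (_ : (k - i)%N != 0%N)) ?mulr0n ?scaler0 //.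
by rewrite subn_eq0 -ltnNge.
Qed.

(** The first leg X^k g^s of the coideal map. *)
Lemma tangent_tgen0 k s : tgen k s \in L -> tgen 0 s \in L.
Proof.
case: k => // k /(Theta_in (k.+1, s)); rewrite Theta_tgen Theta_XG pcoef_sum big_ord_recl.
rewrite big1 ?addr0 => [|i _].
  by rewrite gbin0 scale1r subn0 add0r coef_tens eqxx mulr1n.
rewrite pcoefZ coef_tens xpair_eqE (negPf (_ : (k.+1 - lift ord0 i)%N != k.+1)).
  by rewrite mulr0n scaler0.
by rewrite lift0 subSS; apply/eqP; lia.
Qed.

Lemma tangent_climb k s : k%:Z + s != 0 -> tgen k s \in L -> tgen k.+1 s \in L.
Proof.
move=> ks /(tangent_adL tL X); rewrite adL_X_tgen; apply: subZK.
rewrite subr_eq0; apply: contra ks => /eqP E; apply/eqP.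
have /(qexpz_inj hq) : q ^ 0 = q ^ (- (k%:Z + s)) by rewrite -E expr0z.
lia.
Qed.

(** If tgen k s lies in L then so does tgen 0 s, and then the whole string above it
    until the factor 1 - q^(-k-s) vanishes. In a space of bounded degree the string
    must stop, which forces s = 1-n with n >= 2 and k <= n-1. Hence L is L_I for the
    set I of the n with g^(1-n) - 1 in L. *)
Lemma tangent_classification N : (forall x k s, x \in L -> (N <= k)%N -> coef x (k, s) = 0) ->
  exists I, admissible I /\ L =i L_ K I.
Proof.
move=> LN; pose I := [fset n in iota 2 N | tgen 0 (1 - n%:Z) \in L]%fset.
have inI n : n \in I = (2 <= n < 2 + N)%N && (tgen 0 (1 - n%:Z) \in L) by rewrite !inE mem_iota.
have aI : admissible I by move=> n; rewrite inI => /andP[/andP[]].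
(* A member of the family in L has degree below N, and climbs while k + s <> 0. *)
have bnd k s : (k, s) != (0%N, 0) -> tgen k s \in L -> (k < N)%N.
  move=> ks kL; rewrite ltnNge; apply/negP => /(LN _ _ s kL).
  rewrite coef_tgen // eqxx (negPf ks) andbF subr0 => /eqP.
  by rewrite (oner_eq0 F).
have up j k s : (forall i, (i < j)%N -> (k + i)%N%:Z + s != 0) -> tgen k s \in L -> tgen (k + j) s \in L.
  elim: j => [|j IH] h kL; first by rewrite addn0.
  rewrite addnS; apply: tangent_climb; first exact: h.
  by apply: IH => // i ij; apply: h; exact: ltnW.
exists I; split=> // x; apply/idP/idP => [xL|].
  apply/(L_suppP _ aI); split=> [|k s nks].
    by have /eqP := tangent_ker tL xL.
  apply: contrapT => /eqP xks; have kL : tgen k s \in L.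
    by apply: (@subZK _ _ L (coef x (k, s) : F)) (tangent_coef k s xL); exact: xks.
  apply: nks; have [s0|s0] : 0 <= s \/ s < 0 by lia.
    have [k0|k0] := eqVneq k 0%N; first have [s00|s00] := eqVneq s 0.
    - by left.
    - have /bnd : tgen (k + N) s \in L by apply: up => // i _; lia.
      by rewrite xpair_eqE negb_and s00 orbT => /(_ isT); lia.
    - have /bnd : tgen (k + N) s \in L by apply: up => // i _; lia.
      by rewrite xpair_eqE negb_and addn_eq0 (negPf k0) => /(_ isT); lia.
  right; exists (`|1 - s|%N); last first.
    split; last lia.
    rewrite ltnNge; apply/negP => ks; have : tgen (k + N) s \in L by apply: up => // i _; lia.
    move/bnd; rewrite xpair_eqE negb_and orbC; have -> : s != 0 by lia.
    by move=> /(_ isT); lia.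
  have t0 := tangent_tgen0 kL.
  have E : 1 - (`|1 - s|%N)%:Z = s by lia.
  rewrite inI E t0 andbT.
  have : tgen (0 + `|s|%N) s \in L by apply: up => // i; lia.
  move/bnd; rewrite xpair_eqE negb_and orbC; have -> : s != 0 by lia.
  by move=> /(_ isT); lia.
move: x; apply: L_ind => //; first exact: (@sub0 _ _ L).
  by move=> c x y xL yL; exact: subDZ.
move=> n k; rewrite inI => /andP[/andP[n2 _] tL0] kn.
by rewrite -[k]add0n; apply: up => // i; lia.
Qed.
End Classification.
End TangentSpaces.

(** * Annihilators and irreducible tangent spaces *)

Section Correspondence.
Variable K : qField.
Local Notation F := (qbase K).
Local Notation q := (qparam K).
Local Notation A := (Cq K).
Local Notation X := (genX K).
Local Notation g := (geng K).
Local Notation XG := (XG K).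
Local Notation zpt := (zpt K).
Local Notation tgen := (tgen K).
Implicit Types (I J : {fset nat}) (L M : subspace A) (G H : calculus K).
Hypothesis hq : forall n, (0 < n)%N -> q ^+ n != 1.
Let zn0 n : zpt n != 0. Proof. exact: zpt_neq0. Qed.

Lemma deg_bound (a : A) : exists N, forall k s, (N <= k)%N -> coef a (k, s) = 0.
Proof.
elim/A_lin_ind: a => [a b [N aN] [N' bN]|c a [N aN]|n s].
- exists (maxn N N') => k s; rewrite geq_max => /andP[/aN ak /bN bk].
  by rewrite Defs.coefD ak bk addr0.
- by exists N => k s /aN ak; rewrite pcoefZ ak scaler0.
- exists n.+1 => k r nk; rewrite coef_XG xpair_eqE.
  by have -> : (n == k) = false by apply/eqP; lia.
Qed.

Lemma dim_bound L d : has_dim L d ->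
  exists N, forall x k s, x \in L -> (N <= k)%N -> coef x (k, s) = 0.
Proof.
case=> e [_ eu].
have [N eN] : exists N, forall i, (i < d)%N -> forall k s, (N <= k)%N -> coef (e i) (k, s) = 0.
  elim: d {eu} => [|d [N eN]]; first by exists 0%N.
  have [N' eN'] := deg_bound (e d).
  exists (maxn N N') => i; rewrite ltnS leq_eqVlt => ik k s; rewrite geq_max => /andP[Nk Nk'].
  by case/predU1P: ik => [->|id]; [exact: eN' | exact: eN].
exists N => x k s xL Nk; have [c [-> _]] := eu x xL.
by rewrite pcoef_sum big1 // => i _; rewrite pcoefZ eN // scaler0.
Qed.

Lemma pairing_tgen k s m : counit m = 0 -> pairing (tgen k s) m = pconst K k * ev k (q ^ (- s)) m.
Proof.
move=> m0; rewrite tgenE (linB (@pairing_linl K m)) (linZ (@pairing_linl K m)).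
rewrite -(XG01 K) !pairing_XG oppr0 expr0z -counit_ev m0 mulr0.
by rewrite scaler0 subr0.
Qed.

Lemma qint_neq0 n : (0 < n)%N -> qint K n != 0.
Proof.
move=> n0; apply: contra (hq n0) => /eqP E.
by rewrite -subr_eq0 subrX1 -/(qint K n) E mulr0.
Qed.
Lemma qfact_neq0 n : qfact K n != 0.
Proof.
rewrite /qfact prodf_seq_neq0; apply/allP => i; rewrite mem_index_iota => /andP[i0 _].
exact: qint_neq0.
Qed.
Lemma pconst_neq0 n : pconst K n != 0.
Proof. by rewrite mulf_neq0 ?qfact_neq0 ?invr_neq0 ?expf_neq0 ?qparam_neq0. Qed.

(** The product of the 1 - g/z over zs. *)
Lemma ev_separate (zs : seq F) (w : F) : all (fun z => z != 0) zs -> w != 0 -> w \notin zs ->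
  exists2 r : A, laurent r & (forall z, z \in zs -> ev 0 z r = 0) /\ ev 0 w r != 0.
Proof.
move=> /allP z0 w0 wz; pose r : A := \prod_(z <- zs) (1 - z^-1 *: g).
exists r; first by apply: laurent_prod => *; exact: laurent_lin.
split=> [z zz|].
  rewrite /r ev_prod ?z0 //; last by move=> *; exact: laurent_lin.
  by rewrite (big_rem z) //= ev_lin1 ?z0 // mulVf ?z0 // subrr mul0r.
rewrite /r ev_prod //; last by move=> *; exact: laurent_lin.
rewrite prodf_seq_neq0; apply/allP => z zz /=; rewrite ev_lin1 // subr_eq0 eq_sym.
apply: contra wz => /eqP/(congr1 (fun x => z * x)).
by rewrite mulrA mulfV ?z0 // mul1r mulr1 => ->.
Qed.

Lemma zptqV n : q ^ (- (1 - n%:Z)) = zpt n.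
Proof. by rewrite zptE opprB. Qed.

(** X^k g^(1-n) pairs with M_I as the value at q^(n-1) in degree k, which vanishes for
    k < n. Conversely, if x has a nonzero coefficient at an index (k, s) outside the support
    of L_I, then q^(-s) is none of the points q^(n-1), n > k; a Laurent polynomial
    vanishing at all these and at the other q^(-t) occurring in x, but not at q^(-s),
    gives an element of M_I that does not annihilate x. *)
Lemma tangent_of_M I : admissible I -> L_ K I =i tangent_of (M_ K I).
Proof.
move=> aI x; apply/idP/idP => [xL|/andP[/eqP x0 /asboolP xM]].
  have /(L_suppP _ aI)[x0 _] := xL; apply/andP; split; first exact/eqP.
  apply/asboolP => m mM; have m0 := vanish_counit (M_vanishP hq _ _ mM).
  move: x xL {x0}; apply: L_ind => // [|c x y xm ym|n k nI kn].
  - exact: (lin0 (@pairing_linl K m)).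
  - by rewrite (@pairing_linl K m) xm ym scaler0 addr0.
  - rewrite pairing_tgen // zptqV; have /(M_vanishP hq) -> := mM; rewrite ?mulr0 //.
    exact: in_fset1U_I.
apply/(L_suppP _ aI); split=> // k s nks.
pose supp := msupp (x : {malg F^o[(nat * int)%type]}).
pose zs := [seq zpt n | n <- enum_fset (1%N |` I)%fset & (k < n)%N] ++
  [seq q ^ (- i.2) | i <- enum_fset supp & i.2 != s].
have qn u : q ^ u != 0 by rewrite expfz_neq0 // qparam_neq0.
have [||| r lr [rz rs]] := @ev_separate zs (q ^ (- s)).
- by rewrite all_cat; apply/andP; split; apply/allP => z /mapP[i _ ->].
- exact: qn.
- rewrite mem_cat; apply/norP; split; apply/mapP => -[i]; rewrite mem_filter => /andP[h1 h2].
    rewrite -zptqV => /(qexpz_inj hq) E; apply: nks.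
    move: h2; rewrite in_fset1U => /orP[/eqP i1|iI].
      by left; split; lia.
    by right; exists i => //; split=> //; lia.
  by move=> /(qexpz_inj hq)/oppr_inj E; rewrite E eqxx in h1.
have mM : X ^+ k * r \in M_ K I.
  apply/(M_vanishP hq) => n nI j jn; rewrite ev_Xexp //.
  have [kj|_] := eqVneq k j; last by rewrite mul0r.
  rewrite rz ?mulr0 // mem_cat; apply/orP; left; apply/mapP; exists n => //.
  by rewrite mem_filter kj jn.
have := xM _ mM; rewrite {1}(A_sumE x) (lin_sum (@pairing_linl K _)) -/supp.
have E i : pairing (coef x i *: XG i.1 i.2) (X ^+ k * r) =
    (if i == (k, s) then coef x (k, s) * (pconst K k * ev 0 (q ^ (- s)) r) else
     coef x i * (pconst K i.1 * ((k == i.1)%:R * ev 0 (q ^ (- i.2)) r))) :> F.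
  rewrite (linZ (@pairing_linl K _)) pairing_XG ev_Xexp //.
  by have [->|ik] := eqVneq i (k, s); rewrite /= ?eqxx ?mul1r.
have [ks|ks] := boolP ((k, s) \in supp); last first.
  by move=> _; rewrite [@coef]unlock; exact: mcoeff_outdom.
rewrite (bigD1_seq (k, s)) ?fset_uniq //= E eqxx big1_seq ?addr0.
  move/eqP; rewrite mulf_eq0 => /orP[/eqP //|].
  by rewrite (negPf (mulf_neq0 (pconst_neq0 k) rs)).
move=> [l t] /andP[/= ls lsupp]; rewrite E (negPf ls) /=.
have [kl|_] := eqVneq k l; last by rewrite mul0r !mulr0.
rewrite rz ?mulr0 // mem_cat; apply/orP; right; apply/mapP; exists (l, t) => //.
rewrite mem_filter lsupp andbT /=; apply: contra ls => /eqP ->.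
by rewrite kl.
Qed.

Lemma tangent_finite L : tangent_space L -> (exists d, has_dim L d) ->
  exists I, admissible I /\ L =i L_ K I.
Proof. by move=> tL [d /dim_bound[N LN]]; exact: tangent_classification LN. Qed.

Lemma admissible1 n : (2 <= n)%N -> admissible [fset n]%fset.
Proof. by move=> n2 m; rewrite inE => /eqP ->. Qed.
Lemma sum_fset1 n : (\sum_(m <- [fset n]%fset) m = n)%N.
Proof. exact: big_seq_fset1. Qed.

Lemma L_fset1_neq0 n : (2 <= n)%N -> tgen 0 (1 - n%:Z) != 0.
Proof.
move=> n2; apply/eqP => /(congr1 (fun x => coef x (0%N, 1 - n%:Z))); cbv beta.
rewrite Defs.coef0 coef_tgen; last by apply/eqP => -[]; lia.
rewrite !eqxx [(_ == (0%N, 0))](_ : _ = false) ?andbF ?subr0; last by apply/eqP => -[]; lia.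
by apply/eqP; rewrite (oner_eq0 F).
Qed.

(** The classification applies to subspaces as well, and L_J lies in L_I only if J
    lies in I. *)
Lemma L_sub_tangent I L : admissible I -> tangent_space L -> {subset L <= L_ K I} ->
  exists J, [/\ admissible J, L =i L_ K J & {subset J <= I}].
Proof.
move=> aI tL LI; have [N LN] := dim_bound (L_dim K aI).
have [J [aJ LJ]] := tangent_classification hq tL (fun x k s xL => LN x k s (LI x xL)).
exists J; split=> //; apply: (@L_inj_sub K _ _ aJ aI) => x; rewrite -LJ; exact: LI.
Qed.

(** L_{n} lies in L_I for n in I, so an irreducible L_I has a single index. *)
Lemma tangent_irreducibleP L n : tangent_space L ->
  (tangent_irreducible L /\ has_dim L n) <-> ((2 <= n)%N /\ L =i L_ K [fset n]%fset).
Proof.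
move=> tL; split=> [[[[x xL x0] Lmin] Ln]|[n2 Ln]].
  have [I [aI LI]] := tangent_finite tL (ex_intro _ n Ln).
  have [m mI] : exists m, m \in I.
    apply: contrapT => nI; move/eqP: x0; apply; apply: (L_eq0 aI); first by rewrite -LI.
    by move=> m k mI; case: nI; exists m.
  have m2 := aI m mI; have a1 := admissible1 m2.
  have [||z|Lm] := Lmin (L_ K [fset m]%fset).
  - exact: L_tangent.
  - by move=> y /(L_sub1 mI); rewrite LI.
  - have /z E : tgen 0 (1 - m%:Z) \in L_ K [fset m]%fset by apply: tgen_in; rewrite ?inE //; lia.
    by have := L_fset1_neq0 m2; rewrite E eqxx.
  have -> : n = m.
    rewrite -(sum_fset1 m); apply: (has_dim_uniq Ln); apply: eq_has_dim (L_dim K a1).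
    exact: Lm.
  by split=> // y; rewrite Lm.
have a1 := admissible1 n2; split; last first.
  by rewrite -[n in has_dim _ n]sum_fset1; apply: eq_has_dim (L_dim K a1) => y; rewrite Ln.
split.
  exists (tgen 0 (1 - n%:Z)); last exact: L_fset1_neq0.
  by rewrite Ln; apply: tgen_in; rewrite ?inE //; lia.
move=> L' tL' L'L.
have [y|J [aJ L'J Jn]] := L_sub_tangent a1 tL'; first by move/L'L; rewrite Ln.
have [nJ|nJ] := boolP (n \in J); last first.
  left=> y; rewrite L'J => /(L_eq0 aJ); apply=> m k mJ.
  by have := Jn m mJ; rewrite inE => /eqP mn; rewrite -mn mJ in nJ.
right=> y; rewrite L'J Ln; have -> // : J = [fset n]%fset.
by apply/fsetP => m; apply/idP/idP => [/Jn //|]; rewrite inE => /eqP ->.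
Qed.
End Correspondence.

(** * Finite dimensional calculi *)

Lemma eq_subspace (F : fieldType) (V : lmodType F) (M M' : subspace V) : M =i M' -> M = M'.
Proof.
case: M M' => [P cP] [Q cQ] /= E.
have PQ : P = Q by apply/funext => v; exact: E.
by rewrite {E}PQ in cP *; rewrite (Prop_irrelevance cP cQ).
Qed.

Section Calculi.
Variable K : qField.
Local Notation F := (qbase K).
Local Notation q := (qparam K).
Local Notation A := (Cq K).
Local Notation X := (genX K).
Local Notation zpt := (zpt K).
Implicit Types (I J : {fset nat}) (M : subspace A) (G H : calculus K).

Section Projection.
Variables M M' : subspace A.
(** For M contained in M', the calculus of M' is a quotient of that of M. *)
Definition calc_proj (w : calculus_of M) : calculus_of M' :=
  tlift (fun b (v : kerQ M) => tens b (rho M' (kval v))) w.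

Hypothesis MM' : {subset M <= M'}.
Lemma rho_kval_sub c : counit c = 0 -> rho M' (kval (rho M c)) = rho M' c.
Proof.
move=> c0; apply/eqP; rewrite rho_eqB ?counit_kval ?c0 //.
by apply: MM'; exact: rho_kvalB.
Qed.
Lemma rho_kval_lin : linear (fun v : kerQ M => rho M' (kval v)).
Proof.
move=> c u v; have [a a0 ->] := rhoP u; have [b b0 ->] := rhoP v.
rewrite -[c *: rho M a + rho M b](rho_lin M) !rho_kval_sub //; first exact: rho_lin.
by rewrite counitD counitZ a0 b0 mulr0 addr0.
Qed.
Let rl := rho_kval_lin.
Lemma calc_proj_lin : linear (calc_proj : pbw (kerQ M) -> pbw (kerQ M')).
Proof. by apply: tlift_lin; bil. Qed.
Lemma calc_projE b c : counit c = 0 -> calc_proj (tens b (rho M c)) = tens b (rho M' c).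
Proof. by move=> c0; rewrite /calc_proj tlift_tensE ?rho_kval_sub //; bil. Qed.
Lemma calc_projE' b c : calc_proj (tens b (rho M c)) = tens b (rho M' c).
Proof.
rewrite rho_counit calc_projE -?rho_counit //.
by rewrite counitB counitZ counit1 mulr1 subrr.
Qed.
Lemma calc_proj_morphism : crossed_submodule M -> crossed_submodule M' ->
  calculus_morphism calc_proj.
Proof.
move=> cM cM'; have pl := calc_proj_lin.
have lM := lact_linr cM; have lM' := lact_linr cM'.
have rM := @ract_linl K M; have rM' := @ract_linl K M'.
split; first exact: pl.
- move=> a; apply: kerQ_ext => [| |b c c0]; [by lin | by lin |].
  rewrite (lactE cM) // (lin_sw _ _ pl) calc_projE // (lactE cM') //.
  by apply: eq_sw => a1 a2; rewrite calc_projE'.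
- move=> w a; move: w; apply: kerQ_ext => [| |b c c0]; [by lin | by lin |].
  by rewrite ractE !calc_projE // ractE.
- by move=> a; rewrite !difE (lin_sw _ _ pl); apply: eq_sw => a1 a2; rewrite calc_projE'.
Qed.
Lemma calc_proj_surj w : exists v, calc_proj v = w.
Proof.
elim/kerQ_tens_ind: w => [v w [v' <-] [w' <-]|b c c0].
  by exists (v' + w' : pbw (kerQ M)); rewrite (linD calc_proj_lin).
by exists (tens b (rho M c)); rewrite calc_projE.
Qed.
End Projection.

(** The forms omega(c) b span, and morphisms fix them. *)
Lemma calc_of_endo M (f : calculus_of M -> calculus_of M) : calculus_morphism f -> f =1 id.
Proof.
move=> fm; have fl : linear (f : pbw (kerQ M) -> pbw (kerQ M)) := cmor_linear fm.
apply: kerQ_ext => [||b c c0]; [exact: fl | exact: lin_id |].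
have -> : tens b (rho M c) = ract (omega (calculus_of M) c) b.
  by rewrite omega_calc_of /inv_form ractE mul1r.
by rewrite (cmor_ract fm) (omega_morph _ fm).
Qed.

Hypothesis hq : forall n, (0 < n)%N -> q ^+ n != 1.
Let crM I : crossed_submodule (M_ K I) := M_crossed hq I.

Lemma Gamma_calculus I : is_calculus (Gamma_ K I).
Proof. exact: calc_of_is_calculus. Qed.

Lemma calculus_finite G : is_calculus G -> (exists d, calculus_dim G d) ->
  exists I, admissible I /\ calculus_iso G (Gamma_ K I).
Proof.
move=> cG [d Gd]; have [M cM GM] := woronowicz cG.
have /(calculus_dim_codim _ cM)/(codim_Xexp cM)[N XN] := calculus_dim_iso GM Gd.
have [I [aI MI]] := crossed_classification hq cM XN.
by exists I; split=> //; rewrite /Gamma_ -(eq_subspace MI).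
Qed.

Lemma Gamma_inj I J : admissible I -> admissible J ->
  calculus_iso (Gamma_ K I) (Gamma_ K J) -> I = J.
Proof.
move=> aI aJ IJ; apply: (M_inj hq aI aJ) => v.
have [f fm _] := IJ; have [h hm _] := iso_sym IJ.
by apply/idP/idP; [exact: calc_of_morph_sub fm _ | exact: calc_of_morph_sub hm _].
Qed.

Lemma Gamma_dim I : admissible I -> calculus_dim (Gamma_ K I) (\sum_(n <- I) n)%N.
Proof. by move=> aI; apply/calculus_dim_codim => //; exact: codim_M. Qed.

Lemma Gamma_empty I (w : Gamma_ K I) : (forall n, n \notin I) -> w = 0.
Proof.
move=> I0; elim/kerQ_tens_ind: w => [v w -> ->|b c c0]; first by rewrite addr0.
have -> : rho (M_ K I) c = 0; last exact: (lin0 (tens_linr _)).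
by apply: (kerQ_eqP hq) => n k nI; have := I0 n; rewrite nI.
Qed.

Lemma M_sub1 I n : n \in I -> {subset M_ K I <= M_ K [fset n]%fset}.
Proof.
move=> nI v /(M_vanishP hq) vI; apply/(M_vanishP hq) => m; rewrite !inE => mn k km; apply: vI => //.
by rewrite in_fset1U; case/orP: mn => [->//|/eqP ->]; rewrite nI orbT.
Qed.

Lemma Gamma1_neq0 n : (2 <= n)%N -> exists w : Gamma_ K [fset n]%fset, w != 0.
Proof.
move=> n2; pose I := [fset n]%fset; have nI : n \in I by rewrite inE.
pose c := X ^+ 0 * lagrange K I n.
have c0 : counit c = 0 by apply: (counit_Xlagrange hq); apply: contraL n2 => /eqP ->.
exists (inv_form (rho (M_ K I) c)); apply/eqP => /(congr1 (fun w : pbw (kerQ (M_ K I)) => coef w (0%N, 0))).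
rewrite Defs.coef0 /inv_form -{1}(XG01 K) coef_tens eqxx mulr1n => r0.
have := evcoord_rho hq nI (ltnW n2) c0; rewrite r0 (lin0 (evcoord_lin hq nI (ltnW n2))).
by rewrite (ev_Xlagrange hq) ?in_fset1U_I // eqxx => /esym/eqP; rewrite (oner_eq0 F).
Qed.

Lemma coirreducible_iso G H : calculus_iso G H -> coirreducible G -> coirreducible H.
Proof.
case=> f fm fb [[w w0] Gmin]; have fl := cmor_linear fm; split.
  exists (f w); apply: contra w0 => /eqP fw.
  by apply/eqP/(bij_inj fb); rewrite fw (lin0 fl).
move=> J h cJ hm hs.
have [|v|] := Gmin J (h \o f) cJ (morph_comp fm hm); [|by left|].
  move=> v; have [w' <-] := hs v; have [f' fK f'K] := fb.
  by exists (f' w') => /=; rewrite f'K.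
move=> hfb; right; have [f' fK f'K] := fb.
apply: (eq_bij (f := (h \o f) \o f')) => [|x]; last by rewrite /= f'K.
by apply: bij_comp => //; exists f.
Qed.

(** A quotient of Gamma_{n} is the calculus of some M containing M_{n}, so it is
    Gamma_J with J contained in {n}. If J = {n}, the quotient map followed by the
    isomorphism is an endomorphism, hence the identity. *)
Lemma Gamma1_coirreducible n : (2 <= n)%N -> coirreducible (Gamma_ K [fset n]%fset).
Proof.
move=> n2; split; first exact: Gamma1_neq0.
move=> H f cH fm fs; have [M cM [h hm hb]] := woronowicz cH.
have a1 := admissible1 n2.
have subM : {subset M_ K [fset n]%fset <= M}.
  exact: (calc_of_morph_sub (crM _) (morph_comp fm hm)).
have XM : X ^+ n \in M.
  apply: subM; apply/(M_vanishP hq) => m; rewrite !inE => mn k km.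
  rewrite -[X ^+ n]mulr1 ev_Xexp ?zpt_neq0 //; last exact: laurent1.
  rewrite (_ : (n == k) = false) ?mul0r //; apply/eqP; move: mn km n2.
  by case/orP=> /eqP ->; lia.
have [J [aJ MJ]] := crossed_classification hq cM XM.
rewrite {MJ}(eq_subspace MJ) in cM h hm hb subM XM.
have Jn := M_sub hq aJ subM.
have [nJ|nJ] := boolP (n \in J).
  right; have EJ : J = [fset n]%fset.
    by apply/fsetP => m; apply/idP/idP => [/Jn //|]; rewrite inE => /eqP ->.
  rewrite {}EJ in cM h hm hb subM XM Jn nJ aJ.
  have E := calc_of_endo (morph_comp fm hm).
  apply: inj_surj_bij => // u v uv.
  by rewrite -[u]E -[v]E /= uv.
left=> v; apply: (bij_inj hb); rewrite (lin0 (cmor_linear hm)).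
apply: Gamma_empty => m; apply/negP => mJ.
by have := Jn m mJ; rewrite inE => /eqP mn; rewrite -mn mJ in nJ.
Qed.

Lemma coirreducibleP G n : is_calculus G ->
  (coirreducible G /\ calculus_dim G n) <-> ((2 <= n)%N /\ calculus_iso G (Gamma_ K [fset n]%fset)).
Proof.
move=> cG; split=> [[Gc Gn]|[n2 Gn]]; last first.
  split; first exact: coirreducible_iso (iso_sym Gn) (Gamma1_coirreducible n2).
  rewrite -[n in calculus_dim _ n]sum_fset1.
  exact: calculus_dim_iso (iso_sym Gn) (Gamma_dim (admissible1 n2)).
have [I [aI [f fm fb]]] := calculus_finite cG (ex_intro _ n Gn).
have [[w w0] Gmin] := Gc.
have [m mI] : exists m, m \in I.
  apply: contrapT => nI; move/eqP: w0; apply; apply: (bij_inj fb).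
  by rewrite (lin0 (cmor_linear fm)); apply: Gamma_empty => m; apply/negP => mI; apply: nI; exists m.
have m2 := aI m mI; have sM := M_sub1 mI.
have pm := calc_proj_morphism sM (crM _) (crM _).
have pf := morph_comp fm pm.
have [v|z|pb] := Gmin _ _ (Gamma_calculus _) pf.
- have [u <-] := calc_proj_surj sM v; have [f' fK f'K] := fb.
  by exists (f' u); rewrite /= f'K.
- by have [v] := Gamma1_neq0 m2; rewrite (z v) eqxx.
have Gm : calculus_iso G (Gamma_ K [fset m]%fset) by exists (@calc_proj (M_ K I) _ \o f).
have -> : n = m.
  rewrite -(sum_fset1 m); apply: (has_dim_uniq Gn).
  exact: calculus_dim_iso (iso_sym Gm) (Gamma_dim (admissible1 m2)).
by [].
Qed.

(** The projections Gamma_I -> Gamma_{n} together are bijective by Chinese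
    remaindering: multiplication by the Lagrange polynomial of n is a section of the
    n-th projection that the others kill, and M_I is the intersection of the M_{n} in ker eps. *)
Lemma Gamma_sum I : admissible I -> calculus_sum I (Gamma_ K I) (fun n => Gamma_ K [fset n]%fset).
Proof.
move=> aI; exists (fun n => @calc_proj (M_ K I) (M_ K [fset n]%fset)).
split=> [n nI|w]; first exact: calc_proj_morphism (M_sub1 nI) (crM _) (crM _).
pose sec n (t : pbw (kerQ (M_ K [fset n]%fset))) : pbw (kerQ (M_ K I)) :=
  tlift (fun b u => tens b (rho (M_ K I) (kval u * lagrange K I n))) t.
have zn0 n : zpt n != 0 by exact: zpt_neq0.
have aI1 n : n \in I -> n != 1%N by move=> /aI n2; apply: contraL n2 => /eqP ->.
have c0 n (u : kerQ (M_ K [fset n]%fset)) : counit (kval u * lagrange K I n) = 0.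
  by rewrite counitM counit_kval mul0r.
have psec n m t : n \in I -> m \in I -> n != m ->
    calc_proj (M_ K [fset m]%fset) (sec n t) = 0.
  move=> nI mI nm; rewrite /sec (lin_tlift _ _ (calc_proj_lin (M_sub1 mI))) tliftE big1 // => i _.
  rewrite calc_projE ?c0 //; last exact: M_sub1.
  rewrite (_ : rho _ _ = 0); first exact: (lin0 (tens_linr _)).
  apply/eqP; rewrite rho_eq0 ?c0 //; apply/(M_vanishP hq) => l; rewrite !inE => lm k kl.
  rewrite ev_laurent //; last exact: laurent_lagrange.
  have lI : l \in (1%N |` I)%fset.
    by rewrite in_fset1U; case/orP: lm => [->//|/eqP ->]; rewrite mI orbT.
  have ln : (l == n) = false.
    by case/orP: lm => /eqP ->; apply/negbTE; rewrite eq_sym // aI1.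
  by rewrite (ev_lagrange hq _ lI) ln mulr0.
have psec1 n t : n \in I -> calc_proj (M_ K [fset n]%fset) (sec n t) = t.
  move=> nI; rewrite /sec (lin_tlift _ _ (calc_proj_lin (M_sub1 nI))).
  rewrite -[RHS]tlift_id; apply: eq_tlift => b u.
  rewrite calc_projE ?c0 //; last exact: M_sub1.
  congr tens; rewrite -[RHS]rho_kval; apply/eqP; rewrite rho_eqB ?c0 ?counit_kval //.
  apply/(M_vanishP hq) => l; rewrite !inE => ln k kl; rewrite (linB (@ev_lin _ _ _)).
  rewrite ev_laurent //; last exact: laurent_lagrange.
  case/orP: ln kl => /eqP -> kl.
    move: kl; rewrite ltnS leqn0 => /eqP ->.
    by rewrite zpt1 -counit_ev counit_kval mul0r subrr.
  by rewrite (ev_lagrange hq) ?in_fset1U_I // eqxx mulr1 subrr.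
exists (\sum_(n <- I) sec n (w n)); split=> [m mI|v vw].
  rewrite (lin_sum (calc_proj_lin (M_sub1 mI))) (bigD1_seq m) ?fset_uniq //= psec1 //.
  rewrite big1_seq ?addr0 // => n /andP[nm nI].
  exact: psec.
apply: subr0_eq.
set v' := \sum_(n <- I) _ in vw *.
have {vw} : forall n, n \in I -> calc_proj (M_ K [fset n]%fset) (v' - v : pbw _) = 0.
  move=> n nI; rewrite (linB (calc_proj_lin (M_sub1 nI))) vw // /v'.
  rewrite (lin_sum (calc_proj_lin (M_sub1 nI))) (bigD1_seq n) ?fset_uniq //= psec1 //.
  rewrite big1_seq ?addr0 ?subrr // => m /andP[nm mI].
  exact: psec.
move: (v' - v : pbw _) => t t0; apply: pbwP => i; rewrite Defs.coef0.
rewrite -[LHS]rho_kval; apply/eqP; rewrite rho_eq0 ?counit_kval //.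
have ck := counit_kval (coef t i).
apply/(M_vanishP hq) => n; rewrite in_fset1U => /orP[/eqP ->|nI] k kn.
  by move: kn; rewrite ltnS leqn0 => /eqP ->; rewrite zpt1 -counit_ev.
have := congr1 (fun t : pbw _ => coef t i) (t0 n nI); rewrite Defs.coef0 /calc_proj.
rewrite (coef_tlift (f := fun v => rho (M_ K [fset n]%fset) (kval v))); last first.
  exact: rho_kval_lin (M_sub1 nI).
by move/eqP; rewrite rho_eq0 // => /(M_vanishP hq); apply => //; rewrite !inE eqxx orbT.
Qed.

Lemma calculus_decomposition G : is_calculus G -> (exists d, calculus_dim G d) ->
  exists (J : {fset nat}) (Gs : nat -> calculus K),
    (forall n, n \in J -> [/\ is_calculus (Gs n), coirreducible (Gs n)
       & exists d, calculus_dim (Gs n) d]) /\ calculus_sum J G Gs.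
Proof.
move=> cG Gd; have [I [aI [f fm fb]]] := calculus_finite cG Gd.
exists I, (fun n => Gamma_ K [fset n]%fset); split=> [n /aI n2|].
  split; [exact: Gamma_calculus | exact: Gamma1_coirreducible |].
  exists (\sum_(m <- [fset n]%fset) m)%N; exact: Gamma_dim (admissible1 n2).
have [r [rm rb]] := Gamma_sum aI; have [f' fK f'K] := fb.
exists (fun n => r n \o f); split=> [n nI|w]; first exact: morph_comp fm (rm n nI).
have [v [vw vu]] := rb w; exists (f' v); split=> [n nI|u uw]; first by rewrite /= f'K vw.
by apply: (can_inj fK); rewrite f'K; apply: vu => n nI; exact: uw.
Qed.
End Calculi.

(** * Commutative Laurent polynomials *)

Section LaurentPolynomials.
Variable K : qField.
Local Notation F := (qbase K).
Local Notation lpoly := (lpoly K).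
Local Notation lmono := (lmono K).

Lemma lextw (W : lmodType F) (w : nat -> int -> W) (D : {fset (nat * int)}) (f : lpoly) :
  (msupp f `<=` D)%fset -> lext w f = \sum_(i <- D) lcoef f i.1 i.2 *: w i.1 i.2.
Proof.
move=> sD; rewrite /lext; apply: big_fset_incl => // -[m s] _ ia.
by rewrite /lcoef mcoeff_outdom // scale0r.
Qed.
Lemma lext_lin (W : lmodType F) (w : nat -> int -> W) : linear (lext w).
Proof.
move=> c f h; pose D := (msupp f `|` msupp h `|` msupp (c *: f + h))%fset.
rewrite !(@lextw _ _ D) /D ?fsubsetUr //; first last.
- by rewrite -fsetUA fsubsetUl.
- by rewrite [(msupp f `|` _)%fset]fsetUC -fsetUA fsubsetUl.
rewrite scaler_sumr -big_split; apply: eq_bigr => i _.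
by rewrite /lcoef mcoeffD mcoeffZ scalerDl scalerA.
Qed.
Lemma lext_mono (W : lmodType F) (w : nat -> int -> W) m s : lext w (lmono m s) = w m s.
Proof.
rewrite (@lextw _ _ [fset (m, s)]%fset); last by rewrite /Defs.lmono msuppU_le.
by rewrite big_seq_fset1 /= /lcoef /Defs.lmono mcoeffUU scale1r.
Qed.
Lemma lpoly_ext (W : lmodType F) (a b : lpoly -> W) : linear a -> linear b ->
  (forall m s, a (lmono m s) = b (lmono m s)) -> a =1 b.
Proof.
move=> al bl E f.
have fE : f = \sum_(i <- msupp f) (f@_i *: lmono i.1 i.2 : lpoly).
  rewrite [LHS]monalgE; apply: eq_bigr => -[m s] _ /=.
  by apply/malgP => j; rewrite mcoeffZ !mcoeffU; case: eqP => _; rewrite ?mulr1 ?mulr0.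
rewrite fE (lin_sum al) (lin_sum bl); apply: eq_bigr => i _.
by rewrite (linZ al) (linZ bl) E.
Qed.

Lemma dqX_lin : linear (@dqX K).
Proof.
move=> c f h; rewrite /dqX /divX /QX !(lext_lin _ c f h).
set a := lext _ f; set b := lext _ h; set L := lext _.
have Ll : linear L by exact: lext_lin.
rewrite opprD addrACA -scalerBr Ll scalerDr !scalerA mulrC -scalerA.
by [].
Qed.
End LaurentPolynomials.

(** * The calculus of a single n and its braided derivations *)

Section ExplicitBasis.
Variable K : qField.
Local Notation F := (qbase K).
Local Notation q := (qparam K).
Local Notation A := (Cq K).
Local Notation X := (genX K).
Local Notation g := (geng K).
Local Notation XG := (XG K).
Local Notation zpt := (zpt K).
Local Notation tgen := (tgen K).
Local Notation lmono := (lmono K).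
Local Notation gb := (gbin q^-1).
Hypothesis hq : forall n, (0 < n)%N -> q ^+ n != 1.

(** [m] [m-1] ... [m-i+1], which is 0 for m < i since then a factor [0] occurs; it is
    the coefficient of X^(m-i) in the i-th q-derivative of X^m. *)
Fixpoint qfalling (m i : nat) : F := if i is i'.+1 then qfalling m i' * qint K (m - i') else 1.

Lemma qint0 : qint K 0 = 0. Proof. exact: big_ord0. Qed.
Lemma qintD m n : qint K (m + n) = qint K m + q ^+ m * qint K n.
Proof.
rewrite /qint big_split_ord /=; congr (_ + _); rewrite mulr_sumr.
by apply: eq_bigr => i _; rewrite exprD.
Qed.
Lemma qfactS n : qfact K n.+1 = qfact K n * qint K n.+1.
Proof. by rewrite /qfact big_nat_recr. Qed.
Lemma qfact0 : qfact K 0 = 1. Proof. by rewrite /qfact big_geq. Qed.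
Lemma qfalling_small m i : (m < i)%N -> qfalling m i = 0.
Proof.
elim: i => // i IH; rewrite ltnS leq_eqVlt => /predU1P[->|/IH mi] /=.
  by rewrite subnn qint0 mulr0.
by rewrite mi mul0r.
Qed.
Lemma qfallingS m i : qfalling m.+1 i.+1 = qint K m.+1 * qfalling m i.
Proof.
elim: i => [|i IH]; first by rewrite /= mulr1 mul1r.
by rewrite -[LHS]/(qfalling m.+1 i.+1 * qint K (m.+1 - i.+1)) IH subSS mulrA.
Qed.

(** Compares the coefficients of Delta(X^m), Gaussian binomials at q^-1, with those of
    the q-derivative; both sides obey the same q-Pascal recursion. *)
Lemma qfalling_gbin m i : (i <= m)%N -> qfact K i * (q ^+ (i * (m - i)) * gb m (m - i)) = qfalling m i.
Proof.
elim: m i => [|m IH] [|i] //.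
- by rewrite qfact0 /= !mulr1.
- by rewrite qfact0 gbinn /= !mulr1.
rewrite ltnS leq_eqVlt => /predU1P[->|im].
  rewrite subnn muln0 gbin0 mulr1 qfallingS -IH // subnn muln0 gbin0 qfactS !mulr1.
  exact: mulrC.
rewrite qfallingS subSS -(subnSK im) gbinS'; last exact: leq_subr.
have -> : (m - (m - i.+1) = i.+1)%N by lia.
have E1 := IH i.+1 im; have E2 := IH i (ltnW im).
have -> : qint K m.+1 = qint K (m - i) + q ^+ (m - i) * qint K i.+1.
  by rewrite -qintD addnS subnK // ltnW.
rewrite mulrDl mulrDr mulrDr addrC; congr (_ + _).
  rewrite -[qint K (m - i) * _]mulrC -/(qfalling m i.+1) -E1; congr (_ * _).
  rewrite mulrA; congr (_ * _).
  by rewrite mulnS exprD mulrAC exprVn mulfV ?mul1r // expf_neq0 // qparam_neq0.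
rewrite -E2 qfactS (subnSK im).
have -> : (i.+1 * (m - i) = m - i + i * (m - i))%N by rewrite mulSn.
rewrite exprD; ring.
Qed.

Lemma dqX_mono m s : dqX (lmono m s) = qint K m *: lmono m.-1 s.
Proof.
rewrite /dqX /QX lext_mono /divX (linB (lext_lin _)) (linZ (lext_lin _)) !lext_mono.
case: m => [|m]; first by rewrite qint0 scale0r scaler0 subr0 scaler0.
rewrite -{1}[lmono m s]scale1r -scalerBl scalerA mul1r; congr (_ *: _).
have q1 : 1 - q != 0 by rewrite subr_eq0 eq_sym -[q]expr1 hq.
apply: (mulfI q1); rewrite mulrA mulfV // mul1r.
by rewrite -[LHS]opprB subrX1 -mulNr opprB.
Qed.
Lemma iter_dqX_mono i m s : iter i (@dqX K) (lmono m s) = qfalling m i *: lmono (m - i)%N s.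
Proof.
have dl := @dqX_lin K; elim: i => [|i IH]; first by rewrite scale1r subn0.
by rewrite iterS IH (linZ dl) dqX_mono scalerA subnS.
Qed.

Lemma normal_ord_lin : linear (@normal_ord K).
Proof. exact: lext_lin. Qed.
(** The price of moving g^s from the left of X^m to its right. *)
Lemma normal_ord_mono m s : normal_ord (lmono m s) = q ^ (- (s * m%:Z)) *: XG m s.
Proof.
by rewrite /normal_ord lext_mono Xexp XG_mul add0n addr0.
Qed.

Lemma pairing_linr x : linear (fun a : A => pairing x a : F^o).
Proof.
have pl := @pairing_linl K; have el := @ev_lin K.
elim/A_lin_ind: x => [x y xl yl c a b|d x xl c a b|m s c a b].
- by rewrite !(linD (pl _)) xl yl scalerDr addrACA.
- by rewrite !(linZ (pl _)) xl !scalerDr !scalerA mulrC.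
- by rewrite !pairing_XG el mulrDr; congr (_ + _); exact: mulrCA.
Qed.

Lemma braided_der_lin x : linear (@braided_der K x).
Proof. by have pl := pairing_linr x; apply: sw_lin; bil. Qed.

Lemma braided_der_XG x m s :
  braided_der x (XG m s) =
  \sum_(k < m.+1) gb m k *: (pairing x (XG (m - k)%N (k%:Z + s)) *: XG k s).
Proof. by have pl := pairing_linr x; rewrite /braided_der sw_XG //; bil. Qed.

Variable n : nat.
Hypothesis n2 : (2 <= n)%N.
Local Notation I := [fset n]%fset.
Local Notation M := (M_ K I).
Local Notation z := (zpt n).
Let z0 : z != 0. Proof. exact: zpt_neq0. Qed.
Let nI : n \in I. Proof. by rewrite inE. Qed.
Let a1 : admissible I. Proof. exact: admissible1. Qed.
Let crM : crossed_submodule M. Proof. exact: M_crossed. Qed.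

Lemma zE : z = q ^+ n.-1.
Proof. by case: n n2 => // m _; rewrite zptS. Qed.
Lemma z1_neq0 : q ^+ n.-1 - 1 != 0.
Proof. by rewrite subr_eq0 hq //; lia. Qed.

(** The counit is the value at g = 1, so this element vanishes there and takes the
    value 1 at g = z: modulo M it is a right unit for multiplication, and the
    elements X^i times it have coordinates delta_(ik). *)
Definition unit_rep : A := (q ^+ n.-1 - 1)^-1 *: (g - 1).
Lemma laurent_unit_rep : laurent unit_rep.
Proof.
by apply: laurentZ; apply: laurentB; [exact: laurentXG | exact: laurent1].
Qed.
Lemma counit_unit_rep : counit unit_rep = 0.
Proof. by rewrite counitZ counitB counitg counit1 subrr mulr0. Qed.
Lemma ev_unit_rep : ev 0 z unit_rep = 1.
Proof.
rewrite (linZ (@ev_lin _ _ _)) (linB (@ev_lin _ _ _)) ev1 // /geng evXG mul1r expr1z zE.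
exact: mulVf z1_neq0.
Qed.
Lemma gunit_rep : g - 1 = (q ^+ n.-1 - 1) *: unit_rep.
Proof. by rewrite scalerA mulfV ?z1_neq0 // scale1r. Qed.

(** The form dual to evaluation in degree i. *)
Definition inv_basis (i : nat) : kerQ M := rho M (X ^+ i * unit_rep).
Lemma counit_Xunit_rep i : counit (X ^+ i * unit_rep) = 0.
Proof. by rewrite counitM counit_unit_rep mulr0. Qed.
Lemma ev_Xunit_rep i k : ev k z (X ^+ i * unit_rep) = (i == k)%:R.
Proof. by rewrite ev_Xexp // ?ev_unit_rep ?mulr1 //; exact: laurent_unit_rep. Qed.

(** Modulo M, an element of ker eps is known by its values in degree k < n at the
    single point z. *)
Lemma rho_ev a b : counit a = 0 -> counit b = 0 ->
  (forall k, (k < n)%N -> ev k z a = ev k z b) -> rho M a = rho M b.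
Proof.
move=> a0 b0 ab; apply: (kerQ_eqP hq) => m k; rewrite inE => /eqP -> kn.
by rewrite !(evcoord_rho hq) // ab.
Qed.

Lemma evcoord_inv_basis k i : (k < n)%N -> evcoord (n, k) (inv_basis i) = (i == k)%:R.
Proof. by move=> kn; rewrite (evcoord_rho hq) ?counit_Xunit_rep // ev_Xunit_rep. Qed.

Lemma inv_basis_big i : (n <= i)%N -> inv_basis i = 0.
Proof.
move=> ni; rewrite -(rho1 M) /inv_basis rho_counit [in RHS]rho_counit counit_Xunit_rep scale0r subr0.
rewrite counit1 scale1r subrr; apply: rho_ev => [||k kn]; first exact: counit_Xunit_rep.
  exact: (lin0 (@counit_lin K)).
rewrite ev_Xunit_rep (lin0 (@ev_lin _ _ _)); have -> // : (i == k) = false by apply/eqP; lia.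
Qed.

Lemma inv_basis_basis : is_basis predT n inv_basis.
Proof.
have [eP eu] : is_basis (V := kerQ M) predT (size (iota 0 n)) (fun i => inv_basis (nth 0%N (iota 0 n) i)).
  apply: (@basis_of_dual _ _ _ _ 0%N (iota 0 n) inv_basis (fun k => evcoord (n, k))).
  - exact: iota_uniq.
  - by [].
  - by move=> k; rewrite mem_iota => /andP[_ kn]; exact: evcoord_lin.
  - by move=> k i; rewrite !mem_iota => /andP[_ kn] _; rewrite evcoord_inv_basis // eq_sym.
  move=> v _; apply: (kerQ_eqP hq) => m k; rewrite inE => /eqP -> kn.
  have cl := evcoord_lin hq nI kn.
  rewrite (lin_sum cl) (bigD1_seq k) ?iota_uniq ?mem_iota //= (linZ cl) evcoord_inv_basis // eqxx.
  rewrite big1_seq ?addr0 => [|i /andP[ik _]]; first by rewrite [RHS]mulr1.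
  by rewrite (linZ cl) evcoord_inv_basis // (negPf ik); exact: mulr0.
rewrite size_iota in eu; split=> // v /eu[c [vE cu]]; exists c; split.
  by rewrite [LHS]vE; apply: eq_bigr => i _; rewrite nth_iota.
by move=> d dE; apply: cu; rewrite dE; apply: eq_bigr => i _; rewrite nth_iota.
Qed.

Local Notation G := (calculus_of M).
Local Notation w i := (inv_form (inv_basis i) : G).

Lemma sw_geng (V : lmodType F) (f : A -> A -> V) : bilin f -> sweedler f g = f g g.
Proof. exact: sw_XG0. Qed.
Lemma sw_genX (V : lmodType F) (f : A -> A -> V) : bilin f -> sweedler f X = f X 1 + f g X.
Proof. by move=> fb; rewrite -[X]mulr1 sw_X ?sw_1 ?mulr1 //; bil. Qed.

Lemma lact_inv a c : counit c = 0 -> lact a (inv_form (rho M c) : G) =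
  sweedler (fun a1 a2 => tens a2 (rho M (a1 * c))) a.
Proof.
by move=> e0; rewrite (lactE crM) //; apply: eq_sw => a1' a2; rewrite mulr1.
Qed.
Lemma ract_inv a v : ract (inv_form v : G) a = tens a v.
Proof. by rewrite ractE mul1r. Qed.

Lemma rho_gX i : rho M (g * (X ^+ i * unit_rep)) = q ^+ (n.-1 - i) *: inv_basis i.
Proof.
have [ni|ni] := leqP n i.
  rewrite inv_basis_big // scaler0.
  have <- : rho M 0 = 0 by exact: (lin0 (@rho_lin _ M)).
  apply: rho_ev => [||k kn]; first by rewrite counitM counit_Xunit_rep mulr0.
    exact: (lin0 (@counit_lin K)).
  rewrite /geng ev_XGl // ev_Xunit_rep (lin0 (@ev_lin _ _ _)).
  by have -> : (i == k) = false; [apply/eqP; lia | rewrite mulr0].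
rewrite -(linZ (@rho_lin _ M)); apply: rho_ev => [||k kn].
- by rewrite counitM counit_Xunit_rep mulr0.
- by rewrite counitZ counit_Xunit_rep mulr0.
rewrite (linZ (@ev_lin _ _ _)) /geng ev_XGl // ev_Xunit_rep.
have [<-|_] := eqVneq i k; last by rewrite mulr0; symmetry; exact: mulr0.
rewrite mulr1 mul1r expr1z zE; symmetry; apply: etrans (mulr1 _) _.
rewrite -[q ^+ n.-1]/(q ^ (n.-1)%:Z) -[LHS]/(q ^ (n.-1 - i)%N%:Z) -expfzDr ?qparam_neq0 //.
by congr (q ^ _); lia.
Qed.

(** All relations are checked on the coordinates ev k z: g multiplies the degree i
    coordinate by q^(n-1-i), X raises the degree, and a times the unit representative
    has the coordinates of a. *)
Lemma explicit_relations :
  [/\ dif G X = w 1%N + (q ^+ n.-1 - 1) *: ract (w 0%N) X,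
      dif G g = (q ^+ n.-1 - 1) *: ract (w 0%N) g,
      forall a, qcomm 1 a (w 0%N) = dif G a,
      forall i, (i < n)%N -> qcomm (q ^+ (n.-1 - i)) g (w i) = 0
    & forall i, (i < n)%N -> qcomm (q ^+ (n.-1 - i)) X (w i) =
        if (i < n.-1)%N then w i.+1 else 0].
Proof.
have rl := @rho_lin _ M.
have rg : rho M g = (q ^+ n.-1 - 1) *: inv_basis 0.
  by rewrite rho_counit counitg scale1r gunit_rep (linZ rl) /inv_basis mul1r.
split.
- rewrite difE sw_genX; last bil.
  rewrite rg ract_inv (linZ (tens_linr _)); congr (_ + _); congr tens.
  apply: rho_ev => [||k kn]; [exact: counitX | exact: counit_Xunit_rep |].
  by rewrite ev_Xunit_rep /genX evXG mulr1.
- by rewrite difE sw_geng ?rg ?ract_inv ?(linZ (tens_linr _)) //; bil.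
- move=> a; rewrite /qcomm scale1r /inv_basis mul1r (lact_inv _ counit_unit_rep) ract_inv difE.
  apply: subr0_eq; rewrite -addrA -opprD; apply/eqP; rewrite subr_eq0; apply/eqP.
  rewrite -[tens a _](sw_counitl _ (f := fun a2 => tens a2 (rho M unit_rep))); last by lin.
  rewrite addrC -sw_add; apply: eq_sw => b1 b2.
  rewrite -(linZ (tens_linr _)) -(linD (tens_linr _)) -(linZ rl); congr tens.
  rewrite [rho M b1]rho_counit -(linD rl); apply: rho_ev => [||k kn].
  + by rewrite counitM counit_unit_rep mulr0.
  + by rewrite counitD counitB 2!counitZ counit1 counit_unit_rep mulr1 mulr0 subrr addr0.
  have el := @ev_lin K k z.
  rewrite ev_laurent ?ev_unit_rep ?mulr1 //; last exact: laurent_unit_rep.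
  have e0 : ev k z unit_rep = (0%N == k)%:R by rewrite -ev_Xunit_rep mul1r.
  have e1 : ev k z 1 = (0%N == k)%:R by rewrite -(XG01 K) evXG mulr1.
  by rewrite (linD el) (linB el) 2!(linZ el) e0 e1 subrK.
- move=> i ni; rewrite /qcomm (lact_inv _ (counit_Xunit_rep i)) ract_inv sw_geng; last bil.
  by rewrite rho_gX (linZ (tens_linr _)) subrr.
- move=> i ni; rewrite /qcomm (lact_inv _ (counit_Xunit_rep i)) ract_inv sw_genX; last bil.
  rewrite rho_gX (linZ (tens_linr _)) addrK mulrA -exprS.
  case: ltnP => // ni'; rewrite -/(inv_basis i.+1) inv_basis_big; last lia.
  exact: (lin0 (tens_linr _)).
Qed.

(** Normalised so that on ker eps it is evaluation in degree i at z. *)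
Definition inv_dual (i : nat) : A := (pconst K i)^-1 *: tgen i (1 - n%:Z).

Lemma pairing_inv_dual i m : counit m = 0 -> pairing (inv_dual i) m = ev i z m.
Proof.
move=> m0; rewrite (linZ (@pairing_linl K m)) pairing_tgen // zptqV.
by apply: etrans (mulrA _ _ _) _; rewrite mulVf ?pconst_neq0 // mul1r.
Qed.

Lemma pairing_evcoord i v : (i < n)%N -> pairing (inv_dual i) (kerE_val v) = evcoord (n, i) (ker_pi M v).
Proof.
by move=> ni; rewrite ker_pi_rho (evcoord_rho hq) ?pairing_inv_dual // kerE_counit.
Qed.

Lemma inv_dual_dual : dual_basis n inv_dual inv_basis.
Proof.
by move=> i j ni nj v vE; rewrite pairing_evcoord // vE evcoord_inv_basis // eq_sym.
Qed.

Lemma coef_tgen1 k j : coef (tgen k (1 - n%:Z)) (j, 1 - n%:Z) = (j == k)%:R.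
Proof.
rewrite coef_tgen; last by rewrite xpair_eqE negb_and; apply/orP; right; lia.
rewrite [((j, _) == (0%N, 0))](_ : _ = false); last by rewrite xpair_eqE; apply/andP => -[_]; lia.
by rewrite andbF subr0 xpair_eqE eqxx andbT eq_sym.
Qed.

Lemma inv_dual_basis : is_basis (L_ K I) n inv_dual.
Proof.
pose f i (x : A) : F := pconst K i * coef x (i, 1 - n%:Z).
have fl i : linear (f i : A -> F^o).
  by move=> c x y; rewrite /f (@coef_lin K) mulrDr; congr (_ + _); exact: mulrCA.
have fE i j : f i (inv_dual j) = (i == j)%:R.
  rewrite /f pcoefZ coef_tgen1; have [->|_] := eqVneq i j; last by rewrite scaler0 mulr0.
  by rewrite [_ *: 1]mulr1 mulfV // pconst_neq0.
have pL i : (i < n)%N -> inv_dual i \in L_ K I by move=> ni; apply: subZ; exact: tgen_in.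
have [eP eu] : is_basis (L_ K I) (size (iota 0 n)) (fun i => inv_dual (nth 0%N (iota 0 n) i)).
  apply: (@basis_of_dual _ _ _ _ 0%N (iota 0 n) inv_dual f).
  - exact: iota_uniq.
  - by move=> i; rewrite mem_iota => /andP[_]; exact: pL.
  - by move=> i _; exact: fl.
  - by move=> i j _ _; exact: fE.
  move=> v vL; apply: subr0_eq; apply: (L_eq0 a1).
    apply: subB => //; rewrite big_seq; apply: sub_sum => i.
    by rewrite mem_iota => /andP[_ /pL]; exact: subZ.
  move=> m k; rewrite inE => /eqP -> kn.
  suff : f k (v - \sum_(i <- iota 0 n) f i v *: inv_dual i) = 0.
    by move/eqP; rewrite mulf_eq0 (negPf (pconst_neq0 hq k)) => /eqP.
  rewrite (linB (fl _)) (lin_sum (fl _)) (bigD1_seq k) ?iota_uniq ?mem_iota //= (linZ (fl _)).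
  rewrite fE eqxx big1_seq ?addr0 => [|i /andP[ik _]]; first by rewrite [_ *: 1]mulr1 subrr.
  by rewrite (linZ (fl _)) fE eq_sym (negPf ik); exact: mulr0.
rewrite size_iota in eP eu; split=> [|v /eu[c [vE cu]]]; first exact: pL.
exists c; split.
  by rewrite [LHS]vE; apply: eq_bigr => i _; rewrite nth_iota.
by move=> d dE; apply: cu; rewrite dE; apply: eq_bigr => i _; rewrite nth_iota.
Qed.

(** A basis dual to a given one is unique, so the formulas below hold for any choice. *)
Lemma inv_dual_uniq psi i : is_basis (L_ K I) n psi -> dual_basis n psi inv_basis -> (i < n)%N -> psi i = inv_dual i.
Proof.
move=> [pL _] pd ni; have [_ /(_ _ (pL i ni))[c [cE _]]] := inv_dual_basis.
rewrite cE (bigD1 (Ordinal ni)) //= big1 ?addr0.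
  suff -> : c (Ordinal ni) = 1 by rewrite scale1r.
  pose v := lrepr (inv_basis i); have vE : ker_pi M v = inv_basis i by exact: lreprK.
  have := pd i i ni ni v vE; rewrite eqxx cE (lin_sum (@pairing_linl K _)).
  rewrite (bigD1 (Ordinal ni)) //= big1 ?addr0.
    rewrite (linZ (@pairing_linl K _)) (inv_dual_dual _ _ vE) // eqxx => E.
    by rewrite -[LHS]mulr1; exact: E.
  move=> j; rewrite -val_eqE /= => ji; rewrite (linZ (@pairing_linl K _)) (inv_dual_dual _ _ vE) //.
  by rewrite (negPf ji); exact: mulr0.
move=> j; rewrite -val_eqE /= => ji.
pose v := lrepr (inv_basis j); have vE : ker_pi M v = inv_basis j by exact: lreprK.
have := pd i j ni (ltn_ord j) v vE; rewrite eq_sym (negPf ji) cE (lin_sum (@pairing_linl K _)).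
rewrite (bigD1 j) //= big1 ?addr0.
  rewrite (linZ (@pairing_linl K _)) (inv_dual_dual _ _ vE) // eqxx => E.
  have -> : c j = 0 by rewrite -[LHS]mulr1; exact: E.
  by rewrite scale0r.
move=> l; rewrite -val_eqE /= => lj; rewrite (linZ (@pairing_linl K _)) (inv_dual_dual _ _ vE) //.
by rewrite (negPf lj); exact: mulr0.
Qed.

Lemma pairing_inv_dualS i a : (0 < i)%N -> pairing (inv_dual i) a = ev i z a.
Proof.
case: i => // i _; rewrite (linZ (@pairing_linl K a)) tgenS pairing_XG zptqV.
by apply: etrans (mulrA _ _ _) _; rewrite mulVf ?pconst_neq0 // mul1r.
Qed.
(** On all of A the counit correction reappears, which is the term - f in the
    derivation of index 0. *)
Lemma pairing_inv_dual0 a : pairing (inv_dual 0) a = ev 0 z a - counit a.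
Proof.
have pl := @pairing_linr (inv_dual 0); rewrite -[a in LHS](subrK ((counit a)%:A)).
rewrite (linD pl) (linZ pl) pairing_inv_dual ?counitB ?counitZ ?counit1 ?mulr1 ?subrr //.
have -> : pairing (inv_dual 0) 1 = 0.
  rewrite (linZ (@pairing_linl K _)) tgen0 (linB (@pairing_linl K _)) -(XG01 K) !pairing_XG.
  by rewrite !evXG !mulr1 subrr scaler0.
by rewrite scaler0 addr0 (linB (@ev_lin _ _ _)) (linZ (@ev_lin _ _ _)) ev1 // [_ *: 1]mulr1.
Qed.

Lemma zexp (s : int) : z ^ s = q ^ ((n.-1)%:Z * s).
Proof. by rewrite zE -exprz_exp. Qed.

(** On X^m g^s only the term X^i g^(m-i+s) (x) X^(m-i) g^s of Delta contributes, and
    evaluation gives z^(m-i+s). What remains is to collect the powers of q coming from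
    z = q^(n-1), the normal ordering and qfalling_gbin. *)
Lemma braided_der_inv_dual i f : (1 <= i <= n.-1)%N ->
  braided_der (inv_dual i) (normal_ord f) =
  normal_ord (Qg (n.-1 - i)%N (QX (n.-1 - i)%N ((qfact K i)^-1 *: iter i (@dqX K) f))).
Proof.
case/andP=> i1 ni; have dl := @dqX_lin K.
have il : linear (iter i (@dqX K)).
  elim: i {i1 ni} => [|i IH] c x y; first by rewrite /iter.
  by rewrite !iterS IH dl.
move: f; apply: lpoly_ext => [||m s].
- exact: (lin_comp (braided_der_lin _) (lext_lin _)).
- apply: (lin_comp (lext_lin _)); apply: (lin_comp (lext_lin _)).
  by apply: (lin_comp (lext_lin _)); exact: lin_scalef.
rewrite normal_ord_mono (linZ (braided_der_lin _)) braided_der_XG.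
rewrite iter_dqX_mono scalerA /QX /Qg !(linZ (lext_lin _)) !lext_mono.
rewrite (linZ (lext_lin _)) lext_mono !(linZ normal_ord_lin) normal_ord_mono !scalerA.
have [im|mi] := leqP i m; last first.
  rewrite qfalling_small // mulr0 !mul0r scale0r big1 ?scaler0 // => -[k km] _ /=.
  rewrite pairing_inv_dualS // evXG (_ : (m - k == i)%N = false) ?mul0r ?scale0r ?scaler0 //.
  by apply/eqP; lia.
have mi : (m - i < m.+1)%N by rewrite ltnS leq_subr.
rewrite (bigD1 (Ordinal mi)) //= big1 ?addr0 => [|[k km]]; last first.
  rewrite -val_eqE /= => kmi; rewrite pairing_inv_dualS // evXG.
  rewrite (_ : (m - k == i)%N = false) ?mul0r ?scale0r ?scaler0 //.
  by apply/eqP => E; move/eqP: kmi; apply; lia.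
rewrite pairing_inv_dualS // evXG subKn // eqxx mul1r !scalerA; congr (_ *: _).
rewrite -qfalling_gbin //.
have f0 := qfact_neq0 hq i.
rewrite (mulKf f0) zexp.
rewrite -[q ^+ (i * (m - i))]/(q ^ (i * (m - i))%N%:Z).
set b := gb m _.
rewrite [RHS](_ : _ = b * (q ^ (i * (m - i))%N%:Z * q ^ ((n.-1 - i)%N%:Z * (m - i)%N%:Z) *
  q ^ ((n.-1 - i)%N%:Z * s) * q ^ (- (s * (m - i)%N%:Z)))); last by ring.
rewrite [LHS](_ : _ = b * (q ^ (- (s * m%:Z)) * q ^ ((n.-1)%:Z * ((m - i)%N%:Z + s)))); last by ring.
congr (_ * _); rewrite -!expfzDr ?qparam_neq0 //; congr (q ^ _).
have -> : (n.-1 - i)%N%:Z = (n.-1)%:Z - i%:Z by lia.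
rewrite PoszM; have -> : (m - i)%N%:Z = m%:Z - i%:Z by lia.
ring.
Qed.

Lemma braided_der_inv_dual0 f :
  braided_der (inv_dual 0) (normal_ord f) = normal_ord (Qg n.-1 (QX n.-1 f) - f).
Proof.
move: f; apply: lpoly_ext => [||m s].
- exact: (lin_comp (braided_der_lin _) (lext_lin _)).
- apply: (lin_comp (lext_lin _)); apply: lin_addf; last exact: lin_oppf.
  by apply: (lin_comp (lext_lin _)); exact: lext_lin.
rewrite (linB normal_ord_lin) normal_ord_mono (linZ (braided_der_lin _)) braided_der_XG.
rewrite /QX /Qg lext_mono (linZ (lext_lin _)) lext_mono !(linZ normal_ord_lin).
rewrite normal_ord_mono !scalerA -scalerBl.
rewrite (bigD1 ord_max) //= big1 ?addr0 => [|[k km]]; last first.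
  rewrite -val_eqE /= => kmi; rewrite pairing_inv_dual0 evXG counit_XG.
  rewrite (_ : (m - k == 0)%N = false) ?mul0r ?subrr ?scale0r ?scaler0 //.
  by apply/eqP => E; move/eqP: kmi; apply; lia.
rewrite pairing_inv_dual0 evXG counit_XG subnn eqxx mul1r gbinn scale1r scalerA; congr (_ *: _).
rewrite zexp mulrBr mulr1; congr (_ - _); rewrite mulrC; congr (_ * _).
by rewrite -expfzDr ?qparam_neq0 // mulrDr.
Qed.
End ExplicitBasis.

(** * The theorem over k(q) *)

(** q is transcendental over k. *)
Lemma ratq_not_root (k : fieldType) n : (0 < n)%N -> qparam (ratq k) ^+ n != 1.
Proof.
move=> n0; rewrite /= -tofracXn -tofrac1 tofrac_eq; apply/eqP => /(congr1 (fun p : {poly k} => size p)).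
by rewrite size_polyXn size_poly1; lia.
Qed.

Theorem theorem2p5 (k : fieldType) (hk : [pchar k] =i pred0) :
  let K := ratq k in
  let q := qparam K in
  let X := genX K in
  let g := geng K in
  (* (a) *)
  ((forall I : {fset nat}, admissible I ->
      [/\ crossed_submodule (M_ K I), is_calculus (Gamma_ K I),
          tangent_space (L_ K I), L_ K I =i tangent_of (M_ K I)
        & [/\ codim (M_ K I) (\sum_(n <- I) n)%N,
              calculus_dim (Gamma_ K I) (\sum_(n <- I) n)%N
            & has_dim (L_ K I) (\sum_(n <- I) n)%N]]) /\
   (forall M : subspace (Cq K), crossed_submodule M -> (exists d, codim M d) ->
      exists! I : {fset nat}, admissible I /\ M =i M_ K I) /\
   (forall G : calculus K, is_calculus G -> (exists d, calculus_dim G d) ->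
      exists! I : {fset nat}, admissible I /\ calculus_iso G (Gamma_ K I)) /\
   (forall L : subspace (Cq K), tangent_space L -> (exists d, has_dim L d) ->
      exists! I : {fset nat}, admissible I /\ L =i L_ K I)) /\
  (* (b) *)
  ((forall G : calculus K, is_calculus G -> forall n : nat,
      (coirreducible G /\ calculus_dim G n) <->
      ((2 <= n)%N /\ calculus_iso G (Gamma_ K [fset n]%fset))) /\
   (forall L : subspace (Cq K), tangent_space L -> forall n : nat,
      (tangent_irreducible L /\ has_dim L n) <->
      ((2 <= n)%N /\ L =i L_ K [fset n]%fset)) /\
   (forall n : nat, (2 <= n)%N ->
      let M := M_ K [fset n]%fset in
      let G := calculus_of M in
      exists eta : nat -> kerQ M,
        let w i : G := inv_form (eta i) in
        is_basis predT n eta /\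
        [/\ dif G X = w 1%N + (q ^+ n.-1 - 1) *: ract (w 0%N) X,
            dif G g = (q ^+ n.-1 - 1) *: ract (w 0%N) g,
            forall a, qcomm 1 a (w 0%N) = dif G a,
            forall i, (i < n)%N -> qcomm (q ^+ (n.-1 - i)) g (w i) = 0
          & forall i, (i < n)%N -> qcomm (q ^+ (n.-1 - i)) X (w i) =
              if (i < n.-1)%N then w i.+1 else 0] /\
        (exists phi : nat -> Cq K,
           is_basis (L_ K [fset n]%fset) n phi /\ dual_basis n phi eta) /\
        (forall phi : nat -> Cq K,
           is_basis (L_ K [fset n]%fset) n phi -> dual_basis n phi eta ->
           (forall (i : nat) (f : lpoly K), (1 <= i <= n.-1)%N ->
              braided_der (phi i) (normal_ord f) =
              normal_ord (Qg (n.-1 - i)%N (QX (n.-1 - i)%N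
                ((qfact K i)^-1 *: iter i (@dqX K) f)))) /\
           (forall f : lpoly K,
              braided_der (phi 0%N) (normal_ord f) =
              normal_ord (Qg n.-1 (QX n.-1 f) - f))))) /\
  (* (c) *)
  ((forall I : {fset nat}, admissible I ->
      calculus_sum I (Gamma_ K I) (fun n => Gamma_ K [fset n]%fset) /\
      direct_sum I (L_ K I) (fun n => L_ K [fset n]%fset)) /\
   (forall G : calculus K, is_calculus G -> (exists d, calculus_dim G d) ->
      exists (J : {fset nat}) (Gs : nat -> calculus K),
        (forall n, n \in J -> [/\ is_calculus (Gs n), coirreducible (Gs n)
           & exists d, calculus_dim (Gs n) d]) /\
        calculus_sum J G Gs) /\
   (forall L : subspace (Cq K), tangent_space L -> (exists d, has_dim L d) ->
      exists (J : {fset nat}) (Ls : nat -> subspace (Cq K)),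
        (forall n, n \in J -> [/\ tangent_space (Ls n), tangent_irreducible (Ls n)
           & exists d, has_dim (Ls n) d]) /\
        direct_sum J L Ls)).
Proof.
move=> K q X g; have hq := @ratq_not_root k : forall n, (0 < n)%N -> q ^+ n != 1.
split; [split; [|split; [|split]] | split; [split; [|split] | split; [|split]]].
- move=> I aI; split.
  + exact: M_crossed.
  + exact: Gamma_calculus.
  + exact: L_tangent.
  + exact: tangent_of_M.
  + by split; [exact: codim_M | exact: Gamma_dim | exact: L_dim].
- move=> M cM [d Md]; have [N XN] := codim_Xexp cM Md.
  have [I [aI MI]] := crossed_classification hq cM XN.
  exists I; split=> // J [aJ MJ]; apply: (M_inj hq) => // v.
  by rewrite -MI MJ.
- move=> G cG Gd; have [I [aI GI]] := calculus_finite hq cG Gd.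
  exists I; split=> // J [aJ GJ]; apply: (Gamma_inj hq) => //.
  exact: iso_trans (iso_sym GI) GJ.
- move=> L tL Ld; have [I [aI LI]] := tangent_finite hq tL Ld.
  exists I; split=> // J [aJ LJ]; apply: (@L_inj K) => // x.
  by rewrite -LI LJ.
- by move=> G cG n; exact: coirreducibleP.
- by move=> L tL n; exact: tangent_irreducibleP.
- move=> n n2 M G; exists (@inv_basis K n) => w; split; first exact: inv_basis_basis.
  split; first exact: explicit_relations.
  split; first by exists (@inv_dual K n); split; [exact: inv_dual_basis | exact: inv_dual_dual].
  move=> psi pb pd; have n0 : (0 < n)%N by exact: ltnW.
  split=> [i f ni|f].
    rewrite (inv_dual_uniq hq n2 pb pd) ?(braided_der_inv_dual hq n2) //.
    by case/andP: ni => _ ni; lia.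
  by rewrite (inv_dual_uniq hq n2 pb pd) // (braided_der_inv_dual0 hq n2).
- by move=> I aI; split; [exact: Gamma_sum | exact: L_direct_sum].
- by move=> G cG Gd; exact: calculus_decomposition.
- move=> L tL Ld; have [I [aI LI]] := tangent_finite hq tL Ld.
  exists I, (fun n => L_ K [fset n]%fset); split=> [n nI|].
    have a1 := admissible1 (aI n nI); have t1 := L_tangent K a1.
    have [|ir d1] := (tangent_irreducibleP hq n t1).2.
      by split; first exact: aI.
    by split=> //; exists n.
  by rewrite (eq_subspace LI); exact: L_direct_sum.
Qed.
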